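(* 1) There is a unique map $f:B_3\times\mathfrak H\to\mathbb C$ such that $f(\sigma_1,\tau)=0$, $f(\sigma_2,\tau)=-\log\big(\frac{-1}{\tau-1}\big)$, and $f(gg',\tau)=f(g,\overline{g'}\cdot\tau)+f(g',\tau)$ for all $g,g'\in B_3$, $\tau\in\mathfrak H$. 2) For any $g\in B_3$ and $\tau\in\mathfrak H$, $$e(\overline g\cdot\tau)=\mathrm{Ad}(e^{f(g,\tau)t})\Big(g*\big(a(\overline g,\tau)\bullet e(\tau)\big)\Big).$$
   Context: $\mathfrak H=\{\tau\in\mathbb C\mid\Im\tau>0\}$; $\log:\mathbb C^\times\to\mathbb C$ has image in $\mathbb R+\mathrm i[-\pi,\pi[$. $B_3$ is the braid group on generators $\sigma_1,\sigma_2$; $g\mapsto\overline g$ is the morphism $B_3\to SL_2(\mathbb Z)$, $\sigma_1\mapsto\begin{pmatrix}1&1\\ 0&1\end{pmatrix}$, $\sigma_2\mapsto\begin{pmatrix}1&0\\ -1&1\end{pmatrix}$; $SL_2(\mathbb Z)$ acts on $\mathfrak H$ by $\begin{pmatrix}\alpha&\beta\\ \gamma&\delta\end{pmatrix}\cdot\tau=\frac{\alpha\tau+\beta}{\gamma\tau+\delta}$. $\hat{\mathfrak f}_2^{\mathbb C}$ is the degree-completed free complex Lie algebra on $x,y$; $t:=-[x,y]$. Operations on pairs $e=(A,B)$ in $\exp(\hat{\mathfrak f}_2^{\mathbb C})^2$: - $\mathrm{Ad}(e^{\alpha t})(e)=(e^{\alpha t}Ae^{-\alpha t},e^{\alpha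 t}Be^{-\alpha t})$ for $\alpha\in\mathbb C$; - $*$ is the left action of $B_3$ with $\sigma_1*(A,B)=(A,BA)$, $\sigma_2*(A,B)=(AB^{-1},B)$; - for $a=\begin{pmatrix}p&q\\ r&s\end{pmatrix}\in SL_2(\mathbb C)$, $a\bullet(A,B)=(\alpha_a(A),\alpha_a(B))$, where $\alpha_a$ is the automorphism of $\exp(\hat{\mathfrak f}_2^{\mathbb C})$ induced by $x\mapsto px+qy$, $y\mapsto rx+sy$; - $a(\overline g,\tau)=\begin{pmatrix}\gamma\tau+\delta&0\\ 2\pi\mathrm i\gamma&(\gamma\tau+\delta)^{-1}\end{pmatrix}$ if $\overline g=\begin{pmatrix}\alpha&\beta\\ \gamma&\delta\end{pmatrix}$. $\theta(z|\tau)$ is the holomorphic function on $\mathbb C\times\mathfrak H$ with $\theta(z+1|\tau)=-\theta(z|\tau)=\theta(-z|\tau)$, $\theta(z+\tau|\tau)=-e^{-2\pi\mathrm iz-\pi\mathrm i\tau}\theta(z|\tau)$, zero set $\mathbb Z+\tau\mathbb Z$ in $z$, $\partial_z\theta(0|\tau)=1$. $F(z|\tau)$ is the holomorphic function on $\{z=a+b\tau\mid a,b\in\mathbb R,\ a\in]0,1[\text{ or }b\in]0,1[\}$ with values in $\exp(\hat{\mathfrak f}_2^{\mathbb C})$ such that $$\partial_zF(z|\tau)=-\frac{\theta(z+\mathrm{ad}x|\tau)\,\mathrm{ad}x}{\theta(z|\tau)\theta(\mathrm{ad}x|\tau)}(y)\cdot F(z|\tau),\qquad F(z|\tau)\sim(-2\pi\mathrm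 iz)^t\ (z\to0)$$ (branch of $\log(-2\pi\mathrm iz)$ continuous on the domain near $0$, with imaginary part $-\pi/2$ for small $z>0$). $e(\tau)=(A(\tau),B(\tau))$ with $A(\tau)=F(z|\tau)^{-1}F(z+1|\tau)$, $B(\tau)=F(z|\tau)^{-1}e^{2\pi\mathrm ix}F(z+\tau|\tau)$. *)

(* Defs.v *)
From HB Require Import structures.
From Stdlib Require Import Reals ZArith.
From mathcomp Require Import all_boot all_algebra ssrZ boolp.
From Coquelicot Require Import Coquelicot.

Set Implicit Arguments.
Unset Strict Implicit.
Unset Printing Implicit Defensive.

(* C is Coquelicot's type of complex numbers; derivatives over C_AbsRing are
   complex derivatives.  %R is ring_scope. *)
Delimit Scope C_scope with C.
Local Open Scope C_scope.

Definition cexp (z : C) : C :=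
  (Rmult (exp (fst z)) (cos (snd z)), Rmult (exp (fst z)) (sin (snd z))).

(* The argument in [-PI, PI[ : the value on the negative half-line is -PI. *)
Definition carg (z : C) : R :=
  if Rlt_dec 0 (snd z) then acos (Rdiv (fst z) (Cmod z))
  else Ropp (acos (Rdiv (fst z) (Cmod z))).

Definition clog (z : C) : C := (ln (Cmod z), carg z).

Definition twopii : C := RtoC (Rmult 2 PI) * Ci.

Definition upper_half_plane (tau : C) : Prop := Rlt 0 (Im tau).

Definition mx2 (T : Type) (p q r s : T) : 'M[T]_2 :=
  \matrix_(i < 2, j < 2)
    if i == ord0 then (if j == ord0 then p else q)
    else (if j == ord0 then r else s).

Section IntegralMatrices.
Variable M : 'M[Z]_2.
Definition Malpha : C := RtoC (IZR (M ord0 ord0)).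
Definition Mbeta : C := RtoC (IZR (M ord0 ord_max)).
Definition Mgamma : C := RtoC (IZR (M ord_max ord0)).
Definition Mdelta : C := RtoC (IZR (M ord_max ord_max)).
End IntegralMatrices.

Definition mobius (M : 'M[Z]_2) (tau : C) : C :=
  (Malpha M * tau + Mbeta M) / (Mgamma M * tau + Mdelta M).

(* The matrix a(M, tau). *)
Definition autfactor (M : 'M[Z]_2) (tau : C) : 'M[C]_2 :=
  mx2 (Mgamma M * tau + Mdelta M) 0
      (twopii * Mgamma M) (/ (Mgamma M * tau + Mdelta M)).

(* The letter (b, e) is sigma_1 (b = false) or sigma_2 (b = true), with
   exponent 1 (e = false) or -1 (e = true). *)
Definition braid_letter : Type := (bool * bool)%type.
Definition braid_word : Type := seq braid_letter.

Inductive braid_eq : braid_word -> braid_word -> Prop :=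
| braid_eq_refl u : braid_eq u u
| braid_eq_sym u v : braid_eq u v -> braid_eq v u
| braid_eq_trans u v w : braid_eq u v -> braid_eq v w -> braid_eq u w
| braid_eq_cat u u' v v' :
    braid_eq u u' -> braid_eq v v' -> braid_eq (u ++ v) (u' ++ v')
| braid_eq_cancel b e : braid_eq [:: (b, e); (b, ~~ e)] [::]
| braid_eq_braid :
    braid_eq [:: (false, false); (true, false); (false, false)]
             [:: (true, false); (false, false); (true, false)].

Definition braid_eqb : rel braid_word := fun u v => `[< braid_eq u v >].

Lemma braid_eqb_refl : reflexive braid_eqb.
Proof. by move=> u; apply/asboolP; apply: braid_eq_refl. Qed.
Lemma braid_eqb_sym : symmetric braid_eqb.
Proof. by move=> u v; apply/asboolP/asboolP; apply: braid_eq_sym. Qed.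
Lemma braid_eqb_trans : transitive braid_eqb.
Proof.
by move=> v u w /asboolP uv /asboolP vw; apply/asboolP; apply: braid_eq_trans vw.
Qed.

Canonical braid_equiv :=
  EquivRel braid_eqb braid_eqb_refl braid_eqb_sym braid_eqb_trans.

Local Open Scope quotient_scope.

Definition B3 : Type := {eq_quot braid_equiv}.
HB.instance Definition _ := Choice.on B3.
HB.instance Definition _ := EqQuotient.on B3.

Definition braid_class (w : braid_word) : B3 := \pi_B3 w.

Definition sigma1 : B3 := braid_class [:: (false, false)].
Definition sigma2 : B3 := braid_class [:: (true, false)].

Lemma braid_classP u v : braid_class u = braid_class v <-> braid_eq u v.
Proof.
rewrite /braid_class; split=> [/eqquotP|uv]; first by move/asboolP.
by apply/eqquotP/asboolP.
Qed.

Lemma braid_class_repr (g : B3) : braid_class (repr g) = g.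
Proof. exact: reprK. Qed.

Lemma braid_repr w : braid_eq (repr (braid_class w)) w.
Proof. by apply/braid_classP; rewrite braid_class_repr. Qed.

Definition braid_inv_word (w : braid_word) : braid_word :=
  rev [seq (l.1, ~~ l.2) | l <- w].

Lemma braid_inv_wordK : involutive braid_inv_word.
Proof.
move=> w; rewrite /braid_inv_word map_rev revK -map_comp -[RHS]map_id.
by apply: eq_map => -[b e] /=; rewrite negbK.
Qed.

Lemma braid_inv_wordr w : braid_eq (w ++ braid_inv_word w) [::].
Proof.
elim: w => [|[b e] w IHw]; first exact: braid_eq_refl.
rewrite /braid_inv_word /= rev_cons -cats1 -cat_cons catA.
apply: (braid_eq_trans (v := [:: (b, e)] ++ [:: (b, ~~ e)])).
  apply: braid_eq_cat; last exact: braid_eq_refl.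
  rewrite -cat1s -catA -[X in braid_eq _ X]cats0.
  by apply: braid_eq_cat IHw; apply: braid_eq_refl.
exact: braid_eq_cancel.
Qed.

Lemma braid_inv_wordl w : braid_eq (braid_inv_word w ++ w) [::].
Proof.
by have := braid_inv_wordr (braid_inv_word w); rewrite braid_inv_wordK.
Qed.

Definition B3_mul (g h : B3) : B3 := braid_class (repr g ++ repr h).
Definition B3_inv (g : B3) : B3 := braid_class (braid_inv_word (repr g)).
Definition B3_one : B3 := braid_class [::].

Lemma B3_mulE u v :
  B3_mul (braid_class u) (braid_class v) = braid_class (u ++ v).
Proof. by apply/braid_classP; apply: braid_eq_cat; apply: braid_repr. Qed.

Lemma B3_mulA : associative B3_mul.
Proof.
move=> f g h; rewrite -[f]braid_class_repr -[g]braid_class_repr.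
by rewrite -[h]braid_class_repr !B3_mulE catA.
Qed.
Lemma B3_mul1g : left_id B3_one B3_mul.
Proof. by move=> g; rewrite -[g]braid_class_repr B3_mulE. Qed.
Lemma B3_mulg1 : right_id B3_one B3_mul.
Proof. by move=> g; rewrite -[g]braid_class_repr B3_mulE cats0. Qed.
Lemma B3_mulVg : left_inverse B3_one B3_inv B3_mul.
Proof.
move=> g; rewrite -{2}[g]braid_class_repr B3_mulE.
by apply/braid_classP; apply: braid_inv_wordl.
Qed.
Lemma B3_mulgV : right_inverse B3_one B3_inv B3_mul.
Proof.
move=> g; rewrite -{1}[g]braid_class_repr B3_mulE.
by apply/braid_classP; apply: braid_inv_wordr.
Qed.

HB.instance Definition _ :=
  isGroup.Build B3 B3_mulA B3_mul1g B3_mulg1 B3_mulVg B3_mulgV.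

Section BraidAction.
Variables (T : Type) (act1 : braid_letter -> T -> T).
Hypothesis act1K : forall b e x, act1 (b, e) (act1 (b, ~~ e) x) = x.
Hypothesis act1_braid : forall x,
  act1 (false, false) (act1 (true, false) (act1 (false, false) x)) =
  act1 (true, false) (act1 (false, false) (act1 (true, false) x)).

Lemma foldr_braid_eq u v : braid_eq u v ->
  forall x, foldr act1 x u = foldr act1 x v.
Proof.
elim=> {u v} [//|u v _ IH x|u v w _ IH1 _ IH2 x|u u' v v' _ IH1 _ IH2 x|b e|].
- by rewrite IH.
- by rewrite IH1 IH2.
- by rewrite !foldr_cat IH2 IH1.
- exact: act1K.
- exact: act1_braid.
Qed.
End BraidAction.

Definition sl2_letter (l : braid_letter) : 'M[Z]_2 :=
  match l with
  | (false, false) => mx2 1 1 0 1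
  | (false, true) => mx2 1 (-1) 0 1
  | (true, false) => mx2 1 0 (-1) 1
  | (true, true) => mx2 1 0 1 1
  end%R.

(* sl2_bar and braid_act are computed on a representative of g; sl2_bar_class
   and braid_act_class show that any word representing g gives the same value. *)
Definition sl2_bar (g : B3) : 'M[Z]_2 :=
  foldr (fun l M => (sl2_letter l *m M)%R) 1%:M%R (repr g).

Lemma mulmx_mx2 (S : pzRingType) (p q r s p' q' r' s' : S) :
  (mx2 p q r s *m mx2 p' q' r' s' =
   mx2 (p * p' + q * r') (p * q' + q * s')
       (r * p' + s * r') (r * q' + s * s'))%R.
Proof.
apply/matrixP => i j; rewrite !mxE big_ord_recl big_ord1 !mxE /=.
by case: (i == ord0); case: (j == ord0).
Qed.

Lemma mx2_id (S : pzRingType) : (mx2 1 0 0 1 = 1%:M :> 'M[S]_2)%R.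
Proof.
by apply/matrixP => -[[|[|i]] // Hi] [[|[|j]] // Hj]; rewrite !mxE.
Qed.

Lemma det_mx2 (S : comPzRingType) (p q r s : S) :
  (\det (mx2 p q r s) = p * s - q * r)%R.
Proof.
rewrite (expand_det_row _ ord0) big_ord_recl big_ord1 /cofactor !det_mx11 !mxE.
by rewrite /= GRing.expr0 GRing.expr1 !GRing.mulN1r GRing.mul1r GRing.mulrN.
Qed.

Lemma sl2_bar_class w :
  sl2_bar (braid_class w) =
  foldr (fun l M => (sl2_letter l *m M)%R) 1%:M%R w.
Proof.
apply: foldr_braid_eq (braid_repr w) _ => [[] [] M|M].
1-4: by rewrite /= mulmxA mulmx_mx2 /= mx2_id mul1mx.
by rewrite /= !mulmxA !mulmx_mx2.
Qed.

Lemma sl2_barM g h : sl2_bar (g * h)%g = (sl2_bar g *m sl2_bar h)%R.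
Proof.
rewrite -[g]braid_class_repr -[h]braid_class_repr [(_ * _)%g]B3_mulE.
rewrite !sl2_bar_class foldr_cat.
by elim: (repr g) => [|l w IHw] /=; rewrite ?mul1mx // IHw mulmxA.
Qed.

Lemma sl2_bar1 : (sl2_bar sigma1 = mx2 1 1 0 1)%R.
Proof. by rewrite sl2_bar_class /= mulmx1. Qed.

Lemma sl2_bar2 : (sl2_bar sigma2 = mx2 1 0 (-1) 1)%R.
Proof. by rewrite sl2_bar_class /= mulmx1. Qed.

Lemma det_sl2_bar g : (\det (sl2_bar g) = 1)%R.
Proof.
rewrite /sl2_bar; elim: (repr g) => [|l w IHw] /=; first exact: det1.
rewrite det_mulmx IHw GRing.mulr1.
by case: l => -[] []; rewrite /= det_mx2.
Qed.

Section BraidActionOnPairs.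
Variable G : groupType.

Definition braid_pair_letter (l : braid_letter) (e : G * G) : G * G :=
  match l with
  | (false, false) => (e.1, e.2 * e.1)%g
  | (false, true) => (e.1, e.2 * e.1^-1)%g
  | (true, false) => (e.1 * e.2^-1, e.2)%g
  | (true, true) => (e.1 * e.2, e.2)%g
  end.

Definition braid_act (g : B3) (e : G * G) : G * G :=
  foldr braid_pair_letter e (repr g).

Lemma braid_act_class w e :
  braid_act (braid_class w) e = foldr braid_pair_letter e w.
Proof.
apply: foldr_braid_eq (braid_repr w) e => [[] [] [A B]|[A B]] /=.
1-4: by rewrite ?mulgK ?mulgVK.
by rewrite !invgM !mulgA !(mulgK, mulgVK, mulgV, mul1g).
Qed.

Lemma braid_actM g h e : braid_act (g * h)%g e = braid_act g (braid_act h e).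
Proof.
rewrite -[g]braid_class_repr -[h]braid_class_repr [(_ * _)%g]B3_mulE.
by rewrite !braid_act_class foldr_cat.
Qed.

Lemma braid_act1 e : braid_act 1%g e = e.
Proof. exact: (braid_act_class [::]). Qed.

Lemma braid_act_sigma1 A B : braid_act sigma1 (A, B) = (A, B * A)%g.
Proof. by rewrite braid_act_class. Qed.

Lemma braid_act_sigma2 A B : braid_act sigma2 (A, B) = (A * B^-1, B)%g.
Proof. by rewrite braid_act_class. Qed.

End BraidActionOnPairs.

(* The letter x is ord0 : 'I_2 and the letter y is ord_max : 'I_2.  A series
   is the family of its coefficients. *)
Definition ncword : Type := seq 'I_2.
Definition ncseries : Type := ncword -> C.

Definition nc_letter (i : 'I_2) : ncseries :=
  fun w => if w == [:: i] then 1 else 0.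
Definition ncX : ncseries := nc_letter ord0.
Definition ncY : ncseries := nc_letter ord_max.

Definition nc_one : ncseries := fun w => if w == [::] then 1 else 0.
Definition nc_add (A B : ncseries) : ncseries := fun w => A w + B w.
Definition nc_sub (A B : ncseries) : ncseries := fun w => A w - B w.
Definition nc_scale (c : C) (A : ncseries) : ncseries := fun w => c * A w.
Definition nc_mul (A B : ncseries) : ncseries :=
  fun w => sum_n (fun i => A (take i w) * B (drop i w)) (size w).
Arguments nc_mul : simpl never.
Definition nc_bracket (A B : ncseries) : ncseries :=
  nc_sub (nc_mul A B) (nc_mul B A).
Definition nc_pow (A : ncseries) (n : nat) : ncseries :=
  iter n (nc_mul A) nc_one.

Definition nc_hom (n : nat) (A : ncseries) : ncseries :=
  fun w => if size w == n then A w else 0.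

(* exp and inverse of series with constant term 0, resp. 1: the terms of degree
   n > size w of the usual expansions do not contribute to the coefficient of
   w. *)
Definition nc_exp (A : ncseries) : ncseries :=
  fun w => sum_n (fun n => nc_pow A n w / RtoC (INR (fact n))) (size w).
Definition nc_inv (A : ncseries) : ncseries :=
  fun w => sum_n (fun n => nc_pow (nc_sub nc_one A) n w) (size w).

(* The free Lie algebra on x, y is realized as the Lie subalgebra generated by
   x, y in the free associative algebra; lie_series is its degree completion. *)
Inductive lie_poly : ncseries -> Prop :=
| lie_poly_letter i : lie_poly (nc_letter i)
| lie_poly_add A B : lie_poly A -> lie_poly B -> lie_poly (nc_add A B)
| lie_poly_scale c A : lie_poly A -> lie_poly (nc_scale c A)
| lie_poly_bracket A B : lie_poly A -> lie_poly B -> lie_poly (nc_bracket A B).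

Definition lie_series (A : ncseries) : Prop :=
  forall n : nat, lie_poly (nc_hom n A).

Definition exp_lie (S : ncseries) : Prop :=
  exists2 A, lie_series A & S = nc_exp A.

(* The continuous algebra morphism with x |-> p x + q y, y |-> r x + s y for
   a = (p, q; r, s): a word of the source contributes to the words of the same
   length, letter by letter (see nc_subst_letter and nc_substM). *)
Fixpoint nc_subst (a : 'M[C]_2) (A : ncseries) (w : ncword) : C :=
  match w with
  | [::] => A [::]
  | j :: w' =>
      a ord0 j * nc_subst a (fun v => A (ord0 :: v)) w' +
      a ord_max j * nc_subst a (fun v => A (ord_max :: v)) w'
  end.

Lemma nc_ext (A B : ncseries) : A =1 B -> A = B.
Proof. exact: funext. Qed.

Lemma nc_mul_nil A B : nc_mul A B [::] = A [::] * B [::].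
Proof. by rewrite /nc_mul /= sum_O. Qed.

Lemma nc_mul_cons A B l w :
  nc_mul A B (l :: w) =
  A [::] * B (l :: w) + nc_mul (fun v => A (l :: v)) B w.
Proof.
rewrite /nc_mul /= /sum_n sum_Sn_m; last exact/leP.
by rewrite -sum_n_m_S.
Qed.

Lemma nc_mulDl A B D : nc_mul (nc_add A B) D = nc_add (nc_mul A D) (nc_mul B D).
Proof.
apply: nc_ext => w; rewrite /nc_add; elim: w A B => [|l w IH] A B.
  by rewrite !nc_mul_nil; ring.
rewrite !nc_mul_cons.
by rewrite (IH (fun v => A (l :: v)) (fun v => B (l :: v))); ring.
Qed.

Lemma nc_mulDr A B D : nc_mul A (nc_add B D) = nc_add (nc_mul A B) (nc_mul A D).
Proof.
apply: nc_ext => w; rewrite /nc_add; elim: w A => [|l w IH] A.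
  by rewrite !nc_mul_nil; ring.
by rewrite !nc_mul_cons IH; ring.
Qed.

Lemma nc_mulZl c A B : nc_mul (nc_scale c A) B = nc_scale c (nc_mul A B).
Proof.
apply: nc_ext => w; rewrite /nc_scale; elim: w A => [|l w IH] A.
  by rewrite !nc_mul_nil; ring.
by rewrite !nc_mul_cons (IH (fun v => A (l :: v))); ring.
Qed.

Lemma nc_mulA A B D : nc_mul A (nc_mul B D) = nc_mul (nc_mul A B) D.
Proof.
apply: nc_ext => w; elim: w A B => [|l w IH] A B.
  by rewrite !nc_mul_nil; ring.
rewrite !nc_mul_cons !nc_mul_nil IH.
have -> : (fun v => nc_mul A B (l :: v)) =
    nc_add (nc_scale (A [::]) (fun v => B (l :: v)))
           (nc_mul (fun v => A (l :: v)) B).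
  by apply: nc_ext => v; rewrite nc_mul_cons.
by rewrite nc_mulDl nc_mulZl /nc_add /nc_scale; ring.
Qed.

Lemma nc_mul0l B : nc_mul (fun=> 0) B = (fun=> 0).
Proof.
apply: nc_ext; elim=> [|l w IH]; first by rewrite nc_mul_nil; ring.
by rewrite nc_mul_cons IH; ring.
Qed.

Lemma nc_mul1l A : nc_mul nc_one A = A.
Proof.
apply: nc_ext => -[|l w]; first by rewrite nc_mul_nil /nc_one /=; ring.
rewrite nc_mul_cons; have -> : (fun v => nc_one (l :: v)) = (fun=> 0) by [].
by rewrite nc_mul0l /nc_one /=; ring.
Qed.

Lemma nc_mul1r A : nc_mul A nc_one = A.
Proof.
apply: nc_ext => w; elim: w A => [|l w IH] A.
  by rewrite nc_mul_nil /nc_one /=; ring.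
by rewrite nc_mul_cons IH /nc_one /=; ring.
Qed.

Lemma nc_pow_nil (A : ncseries) n : A [::] = 0 -> nc_pow A n.+1 [::] = 0.
Proof. by move=> A0; rewrite /nc_pow /= nc_mul_nil A0; ring. Qed.

Lemma nc_mul_small (A B : ncseries) n : A [::] = 0 ->
  (forall w, (size w < n)%N -> B w = 0) ->
  forall w, (size w < n.+1)%N -> nc_mul A B w = 0.
Proof.
move=> A0 Bn [|l w] /=; first by rewrite nc_mul_nil A0 => _; ring.
rewrite ltnS => wn; rewrite nc_mul_cons A0.
suff -> : forall A', nc_mul A' B w = 0 by ring.
elim: w wn {A A0} => [|k w IH] wn A; first by rewrite nc_mul_nil Bn //; ring.
by rewrite nc_mul_cons Bn // IH; [ring|exact: ltnW].
Qed.

Lemma nc_pow_small (A : ncseries) n w : A [::] = 0 -> (size w < n)%N -> nc_pow A n w = 0.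
Proof.
by move=> A0; elim: n w => [|n IH] w lt_w; [by []|exact: (nc_mul_small A0 IH lt_w)].
Qed.

Definition nc_geom (A : ncseries) (m : nat) : ncseries :=
  fun w => sum_n (fun n => nc_pow (nc_sub nc_one A) n w) m.

Lemma nc_geomE (A : ncseries) m w : A [::] = 1 -> (size w <= m)%N ->
  nc_geom A m w = nc_inv A w.
Proof.
move=> A1 /subnKC <-; elim: (_ - _)%N => [|k IH]; first by rewrite addn0.
rewrite addnS /nc_geom sum_Sn -/(nc_geom A _ w) IH nc_pow_small.
- exact: Cplus_0_r.
- by rewrite /nc_sub A1 /nc_one /=; ring.
- by rewrite ltnS leq_addr.
Qed.

Lemma nc_geomS A m : nc_geom A m.+1 = nc_add (nc_geom A m) (nc_pow (nc_sub nc_one A) m.+1).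
Proof. by apply: nc_ext => w; rewrite /nc_geom sum_Sn. Qed.

Lemma nc_mul_geom A m :
  nc_mul A (nc_geom A m) = nc_sub nc_one (nc_pow (nc_sub nc_one A) m.+1).
Proof.
elim: m => [|m IH].
  have -> : nc_geom A 0 = nc_one by apply: nc_ext => w; rewrite /nc_geom sum_O.
  rewrite nc_mul1r /= /nc_pow /= nc_mul1r.
  by apply: nc_ext => w; rewrite /nc_sub; ring.
rewrite nc_geomS nc_mulDr IH.
have -> : nc_pow (nc_sub nc_one A) m.+2 =
    nc_mul (nc_sub nc_one A) (nc_pow (nc_sub nc_one A) m.+1) by [].
set P := nc_pow _ m.+1.
have <- : nc_add (nc_scale (-(1)) (nc_mul A P)) P = nc_mul (nc_sub nc_one A) P.
  rewrite -nc_mulZl -{2}[P]nc_mul1l -nc_mulDl; congr nc_mul.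
  by apply: nc_ext => w; rewrite /nc_add /nc_sub /nc_scale; ring.
by apply: nc_ext => w; rewrite /nc_sub /nc_add /nc_scale; ring.
Qed.

Lemma nc_mul_congr A B B' w :
  (forall v, (size v <= size w)%N -> B v = B' v) -> nc_mul A B w = nc_mul A B' w.
Proof.
elim: w A => [|l w IH] A BB'; first by rewrite !nc_mul_nil BB'.
by rewrite !nc_mul_cons BB' // (IH _ (fun v vw => BB' v (leqW vw))).
Qed.

Lemma nc_mul_inv (A : ncseries) : A [::] = 1 -> nc_mul A (nc_inv A) = nc_one.
Proof.
move=> A1; apply: nc_ext => w.
rewrite (@nc_mul_congr A _ (nc_geom A (size w))); last first.
  by move=> v vw; rewrite nc_geomE.
rewrite nc_mul_geom /nc_sub nc_pow_small //; first by ring.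
by rewrite /nc_sub A1 /nc_one /=; ring.
Qed.

Lemma nc_inv_nil A : nc_inv A [::] = 1.
Proof. by rewrite /nc_inv /= sum_O. Qed.

Lemma nc_inv_mul (A : ncseries) : A [::] = 1 -> nc_mul (nc_inv A) A = nc_one.
Proof.
move=> A1; have H := nc_mul_inv (nc_inv_nil A).
suff -> : nc_mul (nc_inv A) A = nc_mul (nc_inv A) (nc_inv (nc_inv A)) by [].
congr nc_mul; rewrite -[LHS]nc_mul1r -H nc_mulA nc_mul_inv //.
exact: nc_mul1l.
Qed.

Lemma nc_exp_nil A : nc_exp A [::] = 1.
Proof. by rewrite /nc_exp /= sum_O /nc_pow /= /nc_one /=; field. Qed.

Lemma nc_subst_letter a i :
  nc_subst a (nc_letter i) =
  nc_add (nc_scale (a i ord0) ncX) (nc_scale (a i ord_max) ncY).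
Proof.
have subst0 w : nc_subst a (fun=> 0) w = 0.
  by elim: w => [|j w IH] //=; rewrite IH; ring.
have subst1 w : nc_subst a (fun v => if v == [::] then 1 else 0) w = nc_one w.
  by case: w => [|j w] //=; rewrite subst0 /nc_one /=; ring.
apply: nc_ext => -[|j w] /=.
  by rewrite /nc_add /nc_scale /ncX /ncY /nc_letter /=; ring.
rewrite /nc_add /nc_scale /ncX /ncY /nc_letter /=.
have E k : (fun v => if k :: v == [:: i] then 1 else 0) =
    (fun v => if k == i then (if v == [::] then 1 else 0) else 0) :> ncseries.
  by apply: nc_ext => v; rewrite eqseq_cons; case: (k == i).
rewrite !E.
have J (k : 'I_2) : k = ord0 \/ k = ord_max.
  by case: k => -[|[|k]] // Hk; [left|right]; apply: val_inj.
have D k : (j :: w == [:: k]) = (j == k) && (w == [::]) by rewrite eqseq_cons.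
rewrite !D; case: (J i) => -> /=; rewrite subst0 subst1 /nc_one.
  by case: (J j) => -> /=; case: (w == [::]); ring.
by case: (J j) => -> /=; case: (w == [::]); ring.
Qed.

Lemma nc_substM a A B :
  nc_subst a (nc_mul A B) = nc_mul (nc_subst a A) (nc_subst a B).
Proof.
have substD A' B' : nc_subst a (nc_add A' B') = nc_add (nc_subst a A') (nc_subst a B').
  apply: nc_ext => w; rewrite /nc_add; elim: w A' B' => [|l w IH] A' B' //=.
  by rewrite !(IH (fun v => A' (_ :: v)) (fun v => B' (_ :: v))); ring.
have substZ c A' : nc_subst a (nc_scale c A') = nc_scale c (nc_subst a A').
  apply: nc_ext => w; rewrite /nc_scale; elim: w A' => [|l w IH] A' //=.
  by rewrite !(IH (fun v => A' (_ :: v))); ring.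
apply: nc_ext => w; elim: w A => [|j w IH] A; first by rewrite /= !nc_mul_nil.
rewrite nc_mul_cons /=.
have E k : (fun v => nc_mul A B (k :: v)) =
    nc_add (nc_scale (A [::]) (fun v => B (k :: v)))
           (nc_mul (fun v => A (k :: v)) B).
  by apply: nc_ext => v; rewrite nc_mul_cons.
have S k : nc_subst a (fun v => nc_mul A B (k :: v)) w =
    A [::] * nc_subst a (fun v => B (k :: v)) w +
    nc_mul (nc_subst a (fun v => A (k :: v))) (nc_subst a B) w.
  rewrite E (substD (nc_scale _ _) (nc_mul _ _)) /nc_add substZ /nc_scale.
  by rewrite IH.
rewrite !S.
have -> : (fun v => nc_subst a A (j :: v)) =
    nc_add (nc_scale (a ord0 j) (nc_subst a (fun v => A (ord0 :: v))))
           (nc_scale (a ord_max j) (nc_subst a (fun v => A (ord_max :: v)))) by [].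
by rewrite nc_mulDl !nc_mulZl /nc_add /nc_scale; ring.
Qed.

(* The group of series with constant term 1; it contains exp_lie, and all the
   operations on pairs are defined on it. *)
Record useries : Type := USeries {
  ucoef :> ncseries;
  ucoef_nil : ucoef [::] = RtoC 1
}.

HB.instance Definition _ := gen_eqMixin useries.
HB.instance Definition _ := gen_choiceMixin useries.

Lemma useriesP (A B : useries) : ucoef A = ucoef B -> A = B.
Proof.
case: A B => [A A1] [B B1] /= AB; case: B / AB B1 => B1.
by rewrite (Prop_irrelevance A1 B1).
Qed.

Lemma umul_nil (A B : useries) : nc_mul A B [::] = RtoC 1.
Proof. by rewrite nc_mul_nil !ucoef_nil; ring. Qed.

Definition uone : useries := @USeries nc_one erefl.
Definition umul (A B : useries) : useries := USeries (umul_nil A B).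
Definition uinv (A : useries) : useries := USeries (nc_inv_nil A).

Lemma umulA : associative umul.
Proof. by move=> A B D; apply/useriesP/nc_mulA. Qed.
Lemma umul1g : left_id uone umul.
Proof. by move=> A; apply/useriesP/nc_mul1l. Qed.
Lemma umulg1 : right_id uone umul.
Proof. by move=> A; apply/useriesP/nc_mul1r. Qed.
Lemma umulVg : left_inverse uone uinv umul.
Proof. by move=> A; apply/useriesP/nc_inv_mul/ucoef_nil. Qed.
Lemma umulgV : right_inverse uone uinv umul.
Proof. by move=> A; apply/useriesP/nc_mul_inv/ucoef_nil. Qed.

HB.instance Definition _ :=
  isGroup.Build useries umulA umul1g umulg1 umulVg umulgV.

Definition uexp (A : ncseries) : useries := USeries (nc_exp_nil A).

Definition usubst (a : 'M[C]_2) (A : useries) : useries :=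
  @USeries (nc_subst a A) (ucoef_nil A).

Definition nc_t : ncseries := nc_scale (-(1)) (nc_bracket ncX ncY).

Definition Ad_exp_t (alpha : C) (e : useries * useries) : useries * useries :=
  let u := uexp (nc_scale alpha nc_t) in
  (u * e.1 * u^-1, u * e.2 * u^-1)%g.

Definition sl2_act (a : 'M[C]_2) (e : useries * useries) : useries * useries :=
  (usubst a e.1, usubst a e.2).

(* (sum_n c_n (ad A)^n)(B), for A with constant term 0. *)
Definition nc_ad_series (c : nat -> C) (A B : ncseries) : ncseries :=
  fun w => sum_n (fun n => c n * iter n (nc_bracket A) B w) (size w).

Definition holomorphic2_at (f : C -> C -> C) (z tau : C) : Prop :=
  @ex_filterdiff C_AbsRing
    (prod_NormedModule C_AbsRing C_NormedModule C_NormedModule) C_NormedModule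
    (fun p => f (fst p) (snd p)) (locally (z, tau)).

Record is_theta (theta : C -> C -> C) : Prop := {
  theta_holomorphic : forall z tau, upper_half_plane tau ->
    holomorphic2_at theta z tau;
  theta_add1 : forall z tau, upper_half_plane tau ->
    theta (z + 1) tau = - theta z tau;
  theta_opp : forall z tau, upper_half_plane tau ->
    theta (- z) tau = - theta z tau;
  theta_addtau : forall z tau, upper_half_plane tau ->
    theta (z + tau) tau =
    - cexp (- (twopii * z) - RtoC PI * Ci * tau) * theta z tau;
  theta_zeros : forall z tau, upper_half_plane tau ->
    (theta z tau = 0 <->
     exists m n : Z, z = RtoC (IZR m) + RtoC (IZR n) * tau);
  theta_derive0 : forall tau, upper_half_plane tau ->
    @is_derive C_AbsRing C_NormedModule (fun z => theta z tau) (RtoC 0) (RtoC 1)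
}.

Definition F_domain (tau z : C) : Prop :=
  exists a b : R, z = RtoC a + RtoC b * tau /\
    ((Rlt 0 a /\ Rlt a 1) \/ (Rlt 0 b /\ Rlt b 1)).

(* c is the sequence of Taylor coefficients at 0 of k, whose singularity at 0
   is removable: the value of k at 0 is not used. *)
Definition taylor_at0 (k : C -> C) (c : nat -> C) : Prop :=
  exists r : posreal, forall u : C, u <> 0 -> Rlt (Cmod u) r ->
    @is_pseries C_AbsRing C_NormedModule c u (k u).

(* The branch of log (- 2 pi i z): clog (- 2 pi i) = ln (2 pi) - i pi / 2, and
   clog is continuous on F_domain tau, which does not meet the negative
   half-line. *)
Definition log_m2pii (z : C) : C := clog z + clog (- twopii).

(* The limits and derivatives of functions with values in series are taken
   coefficientwise. *)
Record is_F (theta : C -> C -> C) (F : C -> C -> useries) : Prop := {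
  F_exp_lie : forall z tau, upper_half_plane tau -> F_domain tau z ->
    exp_lie (F z tau);
  F_ode : forall z tau, upper_half_plane tau -> F_domain tau z ->
    exists2 c : nat -> C,
      taylor_at0 (fun u => theta (z + u) tau * u / (theta z tau * theta u tau)) c
      & forall w : ncword,
        @is_derive C_AbsRing C_NormedModule (fun z' => ucoef (F z' tau) w) z
          (- nc_mul (nc_ad_series c ncX ncY) (F z tau) w);
  F_asymptotics : forall tau, upper_half_plane tau -> forall w : ncword,
    filterlim
      (fun z => ucoef (F z tau * (uexp (nc_scale (log_m2pii z) nc_t))^-1)%g w)
      (within (F_domain tau) (locally (RtoC 0))) (locally (nc_one w))
}.

(* e tau = (A tau, B tau); the right-hand sides are independent of z, which
   ranges over all the points at which they make sense. *)
Record is_e (F : C -> C -> useries) (e : C -> useries * useries) : Prop := {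
  e_A : forall z tau, upper_half_plane tau ->
    F_domain tau z -> F_domain tau (z + RtoC 1) ->
    (e tau).1 = ((F z tau)^-1 * F (z + RtoC 1)%C tau)%g;
  e_B : forall z tau, upper_half_plane tau ->
    F_domain tau z -> F_domain tau (z + tau) ->
    (e tau).2 =
    ((F z tau)^-1 * uexp (nc_scale twopii ncX) * F (z + tau)%C tau)%g
}.

Record is_cocycle (f : B3 -> C -> C) : Prop := {
  cocycle_sigma1 : forall tau, upper_half_plane tau -> f sigma1 tau = 0;
  cocycle_sigma2 : forall tau, upper_half_plane tau ->
    f sigma2 tau = - clog (-(1) / (tau - 1));
  cocycle_mul : forall g g' tau, upper_half_plane tau ->
    f (g * g')%g tau = f g (mobius (sl2_bar g') tau) + f g' tau
}.

(* Main.v *)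
From Stdlib Require Import Reals Psatz.
Require Import Defs.
From mathcomp Require Import all_boot all_algebra ssrZ boolp.
From Coquelicot Require Import Coquelicot.

(* In 2) it suffices to treat sigma_1 and sigma_2, since both sides compose in the
   same way under products and inverses of braids.  For these, the modular
   transformation of theta turns the differential equation of F(z | tau) into
   that of F(z / j | gbar tau), up to the substitution a(gbar, tau) and the
   factor exp(2 pi i gamma z x); the two solutions then differ by a constant
   right factor, read off from the behaviour at z -> 0+, and e(gbar tau) is
   computed from e(tau) by choosing suitable base points.

   The modular transformation of theta follows from the uniqueness of a function
   phi with the properties of theta.  If phi, psi are two such functions, then
   L = ln |phi / psi| is continuous and periodic.  As the Taylor expansion in F_ode
   describes theta(z + u) / theta(u) near u = 0, the second differences
   L(z + s) + L(z + is) + L(z - s) + L(z - is) - 4 L(z) are independent of z up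
   to O(s^3), so those of z |-> L(z + w) - L(z) are O(s^3); a comparison with
   ln |z| makes this bounded function constant.  Hence L is additive and bounded,
   so L = 0, and phi / psi is holomorphic of modulus 1, hence constant.  This
   needs neither Cauchy's theorem nor the analyticity of theta. *)

Set Implicit Arguments.
Unset Strict Implicit.
Unset Printing Implicit Defensive.
Delimit Scope R_scope with R.
Delimit Scope ring_scope with ring.
Local Open Scope R_scope.
Local Open Scope C_scope.

(** * Complex derivatives *)

(** The exponent in 2) arises at z -> 0+. With j = gamma tau + delta, the two solutions behave like
    (-2 pi i z)^t and (-2 pi i z / j)^t, and the substitution a(gbar, tau) fixes t; hence the
    constant right factor is exp(log(1 / j) t). For sigma_1 one has j = 1, and for sigma_2, 1 / j =
    -1 / (tau - 1). On the positive half-line log(s / j) = log s + log(1 / j) holds without a change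
    of branch. The obstacle there is that the domain of F is not convex, while uniqueness for the
    differential equation is proved along segments. Each transformation law is therefore proved on
    two convex pieces with a common point, one of them containing ]0, 1[, and the base points for e
    are chosen so that all values of F lie in these pieces. For theta, only complex
    differentiability and Taylor expansions in u are at hand. The directions 1, i, -1, -i are used
    because the sums of their first, second and third powers vanish: a Taylor remainder O(u^3) then
    leaves O(s^3), which is small against the sum 4 s^2 belonging to |u|^2. This is all that the
    maximum principle asks for. *)

Definition cderiv (f : C -> C) (z l : C) : Prop :=
  forall eps : R, (0 < eps)%R -> exists2 d : R, (0 < d)%R &
  forall z', (Cmod (z' - z) < d)%R ->
    (Cmod (f z' - f z - l * (z' - z)) <= eps * Cmod (z' - z))%R.

Definition ccont (f : C -> C) (z : C) : Prop :=
  forall eps : R, (0 < eps)%R -> exists2 d : R, (0 < d)%R &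
  forall z', (Cmod (z' - z) < d)%R -> (Cmod (f z' - f z) < eps)%R.

Lemma Cmod_le_abs z : (Cmod z <= Rabs (fst z) + Rabs (snd z))%R.
Proof.
have -> : z = (RtoC (fst z) + RtoC (snd z) * Ci).
  by case: z => x y; rewrite /Cplus /Cmult /=; congr pair; ring.
apply: Rle_trans (Cmod_triangle _ _) _.
rewrite Cmod_mult !Cmod_R.
have -> : Cmod Ci = 1%R.
  rewrite /Cmod /=; have -> : (0 * (0 * 1) + 1 * (1 * 1))%R = 1%R by ring.
  exact: sqrt_1.
rewrite /= !Rmult_0_r !Rmult_0_l !Rmult_1_r /Rminus ?Ropp_0 !Rplus_0_r !Rplus_0_l.
exact: Rle_refl.
Qed.

Lemma abs_fst_le z : (Rabs (fst z) <= Cmod z)%R.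
Proof. by have := Rmax_Cmod z; have := Rmax_l (Rabs (fst z)) (Rabs (snd z)); lra. Qed.

Lemma abs_snd_le z : (Rabs (snd z) <= Cmod z)%R.
Proof. by have := Rmax_Cmod z; have := Rmax_r (Rabs (fst z)) (Rabs (snd z)); lra. Qed.

Lemma Cmod_sub_sym a b : Cmod (a - b) = Cmod (b - a).
Proof. by rewrite -Cmod_opp; congr Cmod; ring. Qed.

Lemma Cmod_triangle3 a b c : (Cmod (a - c) <= Cmod (a - b) + Cmod (b - c))%R.
Proof.
have -> : a - c = (a - b) + (b - c) by ring.
exact: Cmod_triangle.
Qed.

Lemma Cmod_rev_triangle a b : (Cmod a - Cmod b <= Cmod (a - b))%R.
Proof.
have := Cmod_triangle (a - b) b; have -> : a - b + b = a by ring.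
lra.
Qed.

Lemma Csub_add (a b : C) : a - b + b = a.
Proof. ring. Qed.

Lemma is_derive_cderiv (f : C -> C) (z l : C) :
  @is_derive C_AbsRing C_NormedModule f z l <-> cderiv f z l.
Proof.
split=> [[_ H] eps eps0|H].
- have [d Hd] := H z (fun P HP => HP) (mkposreal _ eps0).
  exists d; first exact: cond_pos.
  move=> z' Hz'; have /= := Hd z' Hz'.
  rewrite /minus /plus /opp /scal /= /norm /= /mult /= /abs /=.
  by rewrite [(z' + - z) * l]Cmult_comm.
- split; first exact: is_linear_scal_l.
  move=> x /= Hx eps; have {Hx} <- : z = x.
    exact: (@is_filter_lim_locally_unique C_AbsRing (AbsRing_NormedModule C_AbsRing) z x Hx).
  have [d d0 Hd] := H eps (cond_pos eps).
  exists (mkposreal d d0) => y Hy.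
  have := Hd y Hy.
  rewrite /minus /plus /opp /scal /= /norm /= /mult /= /abs /=.
  by rewrite [(y + - z) * l]Cmult_comm.
Qed.

Lemma cderiv_is f z l : @is_derive C_AbsRing C_NormedModule f z l -> cderiv f z l.
Proof. by move/is_derive_cderiv. Qed.

Lemma cderiv_ccont f z l : cderiv f z l -> ccont f z.
Proof.
move=> H eps eps0; have [d d0 Hd] := H 1%R Rlt_0_1.
set m := (1 + Cmod l)%R; have m0 : (0 < m)%R by rewrite /m; have := Cmod_ge_0 l; lra.
exists (Rmin d (eps / m)).
  by apply: Rmin_pos => //; apply: Rdiv_lt_0_compat.
move=> z' Hz'.
have /Hd A : (Cmod (z' - z) < d)%R by have := Rmin_l d (eps / m); lra.
have B : (Cmod (z' - z) < eps / m)%R by have := Rmin_r d (eps / m); lra.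
have -> : f z' - f z = (f z' - f z - l * (z' - z)) + l * (z' - z) by ring.
apply: Rle_lt_trans (Cmod_triangle _ _) _; rewrite Cmod_mult.
apply: (@Rle_lt_trans _ (m * Cmod (z' - z))); first by rewrite /m; lra.
have -> : eps = (m * (eps / m))%R by field; lra.
exact: Rmult_lt_compat_l.
Qed.

Lemma cderiv_ext_loc f g z l d : (0 < d)%R ->
  (forall z', (Cmod (z' - z) < d)%R -> f z' = g z') -> cderiv f z l -> cderiv g z l.
Proof.
move=> d0 fg H eps eps0; have [d1 d10 Hd] := H eps eps0.
exists (Rmin d d1) => [|z' Hz']; first exact: Rmin_pos.
have A := Rmin_l d d1; have B := Rmin_r d d1.
rewrite -!fg; [apply: Hd; lra| |lra].
have -> : z - z = 0 by ring.
by rewrite Cmod_0.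
Qed.

Lemma cderiv_ext f g z l : f =1 g -> cderiv f z l -> cderiv g z l.
Proof. by move=> fg; apply: (@cderiv_ext_loc f g z l 1%R) => // *; lra. Qed.

Lemma cderiv_const c z : cderiv (fun=> c) z 0.
Proof.
move=> eps eps0; exists 1%R; first lra.
move=> z' _; have -> : c - c - 0 * (z' - z) = 0 by ring.
by rewrite Cmod_0; apply: Rmult_le_pos; [lra|exact: Cmod_ge_0].
Qed.

Lemma cderiv_id z : cderiv id z 1.
Proof.
move=> eps eps0; exists 1%R; first lra.
move=> z' _; have -> : z' - z - 1 * (z' - z) = 0 by ring.
by rewrite Cmod_0; apply: Rmult_le_pos; [lra|exact: Cmod_ge_0].
Qed.

Lemma cderiv_plus f g z l m : cderiv f z l -> cderiv g z m ->
  cderiv (fun x => f x + g x) z (l + m).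
Proof.
move=> Hf Hg eps eps0.
have e2 : (0 < eps / 2)%R by lra.
have [d1 d10 H1] := Hf _ e2; have [d2 d20 H2] := Hg _ e2.
exists (Rmin d1 d2) => [|z' Hz']; first exact: Rmin_pos.
have A := Rmin_l d1 d2; have B := Rmin_r d1 d2.
have {}H1 := H1 z' (Rlt_le_trans _ _ _ Hz' A).
have {}H2 := H2 z' (Rlt_le_trans _ _ _ Hz' B).
have -> : f z' + g z' - (f z + g z) - (l + m) * (z' - z) =
  (f z' - f z - l * (z' - z)) + (g z' - g z - m * (z' - z)) by ring.
by apply: Rle_trans (Cmod_triangle _ _) _; lra.
Qed.

Lemma cderiv_mult f g z l m : cderiv f z l -> cderiv g z m ->
  cderiv (fun x => f x * g x) z (l * g z + f z * m).
Proof.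
move=> Hf Hg eps eps0.
have Hc := cderiv_ccont Hg.
set A := (1 + Cmod (g z))%R; set B := (1 + Cmod (f z))%R; set L := (1 + Cmod l)%R.
have A0 : (0 < A)%R by rewrite /A; have := Cmod_ge_0 (g z); lra.
have B0 : (0 < B)%R by rewrite /B; have := Cmod_ge_0 (f z); lra.
have L0 : (0 < L)%R by rewrite /L; have := Cmod_ge_0 l; lra.
have e1 : (0 < eps / 3 / A)%R by apply: Rdiv_lt_0_compat; lra.
have e2 : (0 < eps / 3 / B)%R by apply: Rdiv_lt_0_compat; lra.
have e3 : (0 < Rmin 1 (eps / 3 / L))%R by apply: Rmin_pos; [|apply: Rdiv_lt_0_compat]; lra.
have [d1 d10 H1] := Hf _ e1; have [d2 d20 H2] := Hg _ e2; have [d3 d30 H3] := Hc _ e3.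
exists (Rmin d1 (Rmin d2 d3)) => [|z' Hz']; first by do 2?apply: Rmin_pos.
have D1 := Rmin_l d1 (Rmin d2 d3); have D2 := Rmin_r d1 (Rmin d2 d3).
have D3 := Rmin_l d2 d3; have D4 := Rmin_r d2 d3.
have {}H1 := H1 z' ltac:(lra); have {}H2 := H2 z' ltac:(lra).
have {}H3 := H3 z' ltac:(lra).
have M1 := Rmin_l 1 (eps / 3 / L); have M2 := Rmin_r 1 (eps / 3 / L).
have -> : f z' * g z' - f z * g z - (l * g z + f z * m) * (z' - z) =
  (f z' - f z - l * (z' - z)) * g z' + (f z * (g z' - g z - m * (z' - z)) +
  l * (g z' - g z) * (z' - z)) by ring.
apply: Rle_trans (Cmod_triangle _ _) _.
apply: (@Rle_trans _ (_ + (_ + _)))%R.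
  apply: Rplus_le_compat_l; exact: Cmod_triangle.
rewrite !Cmod_mult.
set h := Cmod (z' - z) in H1 H2 *.
have h0 : (0 <= h)%R := Cmod_ge_0 _.
have gA : (Cmod (g z') <= A)%R.
  rewrite /A; have := Cmod_rev_triangle (g z') (g z); lra.
have T1 : (Cmod (f z' - f z - l * (z' - z)) * Cmod (g z') <= eps / 3 * h)%R.
  have -> : (eps / 3 * h = (eps / 3 / A * h) * A)%R by field; lra.
  by apply: Rmult_le_compat => //; apply: Cmod_ge_0.
have T2 : (Cmod (f z) * Cmod (g z' - g z - m * (z' - z)) <= eps / 3 * h)%R.
  have -> : (eps / 3 * h = B * (eps / 3 / B * h))%R by field; lra.
  by apply: Rmult_le_compat => //; rewrite /B; try apply: Cmod_ge_0; lra.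
have T3 : (Cmod l * Cmod (g z' - g z) <= eps / 3)%R.
  have -> : (eps / 3 = L * (eps / 3 / L))%R by field; lra.
  by apply: Rmult_le_compat; [exact: Cmod_ge_0|exact: Cmod_ge_0|rewrite /L; lra|lra].
have T4 : (Cmod l * Cmod (g z' - g z) * h <= eps / 3 * h)%R by apply: Rmult_le_compat_r.
lra.
Qed.

Lemma cderiv_scal c f z l : cderiv f z l -> cderiv (fun x => c * f x) z (c * l).
Proof.
move=> H; have := cderiv_mult (cderiv_const c z) H.
by have -> : 0 * f z + c * l = c * l by ring.
Qed.

Lemma cderiv_opp f z l : cderiv f z l -> cderiv (fun x => - f x) z (- l).
Proof.
move=> H; have -> : - l = (-(1)) * l by ring.
apply: cderiv_ext (cderiv_scal (-(1)) H) => x; ring.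
Qed.

Lemma cderiv_minus f g z l m : cderiv f z l -> cderiv g z m ->
  cderiv (fun x => f x - g x) z (l - m).
Proof. by move=> Hf Hg; apply: cderiv_plus Hf (cderiv_opp Hg). Qed.

Lemma cderiv_comp f g z l m : cderiv f (g z) l -> cderiv g z m ->
  cderiv (fun x => f (g x)) z (l * m).
Proof.
move=> Hf Hg eps eps0; have Hc := cderiv_ccont Hg.
set A := (1 + Cmod m)%R; set L := (1 + Cmod l)%R.
have A0 : (0 < A)%R by rewrite /A; have := Cmod_ge_0 m; lra.
have L0 : (0 < L)%R by rewrite /L; have := Cmod_ge_0 l; lra.
have e1 : (0 < eps / 2 / A)%R by apply: Rdiv_lt_0_compat; lra.
have e2 : (0 < Rmin 1 (eps / 2 / L))%R by apply: Rmin_pos; [|apply: Rdiv_lt_0_compat]; lra.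
have [d1 d10 H1] := Hf _ e1; have [d2 d20 H2] := Hg _ e2; have [d3 d30 H3] := Hc _ d10.
exists (Rmin d2 d3) => [|z' Hz']; first exact: Rmin_pos.
have D3 := Rmin_l d2 d3; have D4 := Rmin_r d2 d3.
have {}H3 := H1 _ (H3 z' ltac:(lra)); have {}H2 := H2 z' ltac:(lra).
have M1 := Rmin_l 1 (eps / 2 / L); have M2 := Rmin_r 1 (eps / 2 / L).
have -> : f (g z') - f (g z) - l * m * (z' - z) =
  (f (g z') - f (g z) - l * (g z' - g z)) + l * (g z' - g z - m * (z' - z)) by ring.
apply: Rle_trans (Cmod_triangle _ _) _; rewrite Cmod_mult.
set h := Cmod (z' - z) in H2 *.
have h0 : (0 <= h)%R := Cmod_ge_0 _.
have G : (Cmod (g z' - g z) <= A * h)%R.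
  have -> : g z' - g z = (g z' - g z - m * (z' - z)) + m * (z' - z) by ring.
  apply: Rle_trans (Cmod_triangle _ _) _; rewrite Cmod_mult -/h /A.
  have := Rmult_le_compat_r h _ _ h0 M1; lra.
have T1 : (eps / 2 / A * Cmod (g z' - g z) <= eps / 2 * h)%R.
  have -> : (eps / 2 * h = eps / 2 / A * (A * h))%R by field; lra.
  by apply: Rmult_le_compat_l => //; lra.
have T2 : (Cmod l * Cmod (g z' - g z - m * (z' - z)) <= eps / 2 * h)%R.
  have -> : (eps / 2 * h = L * (eps / 2 / L * h))%R by field; lra.
  apply: Rmult_le_compat; try apply: Cmod_ge_0; first by rewrite /L; lra.
  by apply: Rle_trans H2 _; apply: Rmult_le_compat_r.
lra.
Qed.

Lemma cderiv_affine a b z : cderiv (fun x => a * x + b) z a.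
Proof.
have := cderiv_plus (cderiv_scal a (cderiv_id z)) (cderiv_const b z).
by have -> : a * 1 + 0 = a by ring.
Qed.

Lemma cderiv_comp_affine f a b z l : cderiv f (a * z + b) l ->
  cderiv (fun x => f (a * x + b)) z (a * l).
Proof.
move=> H; rewrite Cmult_comm.
exact: (cderiv_comp (g := fun x => a * x + b) H (cderiv_affine a b z)).
Qed.

(* Apply the real mean value theorem to
   [t |-> Re (conj (f z1 - f z0) * f (z0 + t (z1 - z0)))]. *)
Lemma cderiv_mvt f f' z0 z1 (D : R) :
  (forall t : R, (0 <= t <= 1)%R -> cderiv f (z0 + t * (z1 - z0)) (f' t) /\
     (Cmod (f' t) <= D)%R) ->
  (Cmod (f z1 - f z0) <= D * Cmod (z1 - z0))%R.
Proof.
move=> H; set v := z1 - z0; set w := Cconj (f z1 - f z0).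
set g := fun t : R => fst (w * f (z0 + t * v)).
have gd t : (0 <= t <= 1)%R -> is_derive g t (fst (w * (f' t * v))).
  move=> /H [Hd _]; apply/is_derive_Reals => eps eps0.
  have {}Hd := cderiv_scal w (cderiv_comp_affine (f := f) (a := v) (b := z0) (z := RtoC t) ltac:(by rewrite Cplus_comm Cmult_comm; exact: Hd)).
  have [d d0 {}Hd] := Hd (eps / 2)%R ltac:(lra).
  exists (mkposreal d d0) => h h0 /= Hh.
  have Q : RtoC (t + h) - RtoC t = RtoC h by rewrite RtoC_plus; ring.
  have := Hd (RtoC (t + h)); rewrite Q Cmod_R => /(_ Hh) K.
  have h1 : (0 < Rabs h)%R := Rabs_pos_lt _ h0.
  rewrite /g [z0 + RtoC (t + h) * v]Cplus_comm [RtoC (t + h) * v]Cmult_comm.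
  rewrite [z0 + RtoC t * v]Cplus_comm [RtoC t * v]Cmult_comm.
  set f1 := f _ in K *; set f2 := f _ in K *.
  have E : ((fst (Cmult w f1) - fst (Cmult w f2)) / h - fst (Cmult w (Cmult (f' t) v)) =
    fst (Cminus (Cminus (Cmult w f1) (Cmult w f2)) (Cmult (Cmult w (Cmult v (f' t))) (RtoC h))) / h)%R.
    by rewrite /Cminus /=; field.
  rewrite E Rabs_div // .
  apply/(Rmult_lt_reg_r _ _ _ h1); rewrite /Rdiv Rmult_assoc Rinv_l ?Rmult_1_r; last lra.
  apply: Rle_lt_trans (abs_fst_le _) _; apply: Rle_lt_trans K _.
  apply: Rmult_lt_compat_r; lra.
have [||c [Hc Heq]] := @MVT_gen g 0 1 (fun t => fst (w * (f' t * v))).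
- by rewrite Rmin_left ?Rmax_right; try lra; move=> x Hx; apply: gd; lra.
- rewrite Rmin_left ?Rmax_right; try lra; move=> x Hx.
  apply: derivable_continuous_pt; exists (fst (w * (f' x * v))).
  by apply/is_derive_Reals; apply: gd; lra.
move: Hc Heq; rewrite Rmin_left ?Rmax_right; try lra; move=> Hc Heq.
have [_ Dc] := H c Hc.
set W := Cmod (f z1 - f z0).
have W0 : (0 <= W)%R := Cmod_ge_0 _.
have wW : Cmod w = W by rewrite /w Cmod_conj.
have G : (g 1 - g 0 = W * W)%R.
  rewrite /g.
  have -> : z0 + RtoC 1 * v = z1 by rewrite /v; ring.
  have -> : z0 + RtoC 0 * v = z0 by ring.
  have -> : (fst (Cmult w (f z1)) - fst (Cmult w (f z0)) = fst (Cmult w (Cminus (f z1) (f z0))))%R.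
    by rewrite /Cminus /=; ring.
  have := Cmod2_conj (f z1 - f z0); rewrite -/W Cmult_comm -/w => <-.
  by rewrite /RtoC /=; ring.
have B : (W * W <= W * (D * Cmod v))%R.
  rewrite -G Heq Rminus_0_r Rmult_1_r.
  apply: Rle_trans (Rle_abs _) _; apply: Rle_trans (abs_fst_le _) _.
  rewrite !Cmod_mult wW; apply: Rmult_le_compat_l => //.
  by apply: Rmult_le_compat_r => //; apply: Cmod_ge_0.
have [W1|W1] : (0 < W)%R \/ W = 0%R by lra.
  by apply: (Rmult_le_reg_l W).
rewrite W1; apply: Rmult_le_pos; last exact: Cmod_ge_0.
by apply: Rle_trans Dc; apply: Cmod_ge_0.
Qed.

(** The case [D = 0] of the mean value inequality. Both the uniqueness of solutions of differential
    equations and the constancy of phi / psi pass through it. *)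
Lemma cderiv_zero f z0 z1 :
  (forall t : R, (0 <= t <= 1)%R -> cderiv f (z0 + t * (z1 - z0)) 0) -> f z1 = f z0.
Proof.
move=> H; have := @cderiv_mvt f (fun=> RtoC 0) z0 z1 0%R.
rewrite Rmult_0_l => K; have {}K : (Cmod (f z1 - f z0) <= 0)%R.
  by apply: K => t /H; split=> //; rewrite Cmod_0; lra.
have /Cmod_eq_0 E : Cmod (f z1 - f z0) = 0%R by have := Cmod_ge_0 (f z1 - f z0); lra.
by rewrite -[f z1](Csub_add _ (f z0)) E; ring.
Qed.

(** * The complex exponential *)

Lemma cexp0 : cexp 0 = 1.
Proof. by rewrite /cexp /= exp_0 cos_0 sin_0 Rmult_0_r Rmult_1_l. Qed.

Lemma cexp_add a b : cexp (a + b) = cexp a * cexp b.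
Proof.
rewrite /cexp /Cmult /= exp_plus cos_plus sin_plus; congr pair; ring.
Qed.

Lemma Cmod_cexp z : Cmod (cexp z) = exp (fst z).
Proof.
rewrite /Cmod /cexp /=.
have -> : (exp z.1 * cos z.2 * (exp z.1 * cos z.2 * 1) +
  exp z.1 * sin z.2 * (exp z.1 * sin z.2 * 1))%R =
  (Rsqr (exp z.1) * (Rsqr (sin z.2) + Rsqr (cos z.2)))%R.
  by rewrite /Rsqr; ring.
rewrite sin2_cos2 Rmult_1_r sqrt_Rsqr //; exact/Rlt_le/exp_pos.
Qed.

Lemma cexp_neq0 z : cexp z <> 0.
Proof. by apply/Cmod_gt_0; rewrite Cmod_cexp; apply: exp_pos. Qed.

Lemma cexp_opp z : cexp (- z) * cexp z = 1.
Proof. by rewrite -cexp_add -cexp0; congr cexp; ring. Qed.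

Lemma cderiv_cexp0 : cderiv cexp 0 1.
Proof.
(* The terms below add up to at most 7 e |h|, so that eps / 10 leaves room. *)
move=> eps eps0; set e := (Rmin 1 (eps / 10))%R.
have e0 : (0 < e)%R by apply: Rmin_pos; lra.
have e1 : (e <= 1)%R := Rmin_l _ _. have e2 : (e <= eps / 10)%R := Rmin_r _ _.
have tr (f : R -> R) (l : R) : derivable_pt_lim f 0 l ->
  exists2 d : R, (0 < d)%R & forall x : R, (Rabs x < d)%R ->
    (Rabs (f x - f 0 - l * x) <= e * Rabs x)%R.
  move=> /(_ e e0) [d Hd]; exists d; first exact: cond_pos.
  move=> x Hx; case: (Req_dec x 0) => [->|x0].
    have -> : (f 0 - f 0 - l * 0 = 0)%R by ring.
    by rewrite Rabs_R0 Rmult_0_r; lra.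
  have := Hd x x0 Hx; rewrite Rplus_0_l => K.
  have -> : (f x - f 0 - l * x = ((f x - f 0) / x - l) * x)%R by field.
  rewrite Rabs_mult; apply: Rmult_le_compat_r; [exact: Rabs_pos|lra].
have [d1 d10 H1] := tr exp _ (derivable_pt_lim_exp 0).
have [d2 d20 H2] := tr cos _ (derivable_pt_lim_cos 0).
have [d3 d30 H3] := tr sin _ (derivable_pt_lim_sin 0).
exists (Rmin (Rmin d1 d2) (Rmin d3 e)); first by apply: Rmin_pos; apply: Rmin_pos.
move=> h; have -> : h - 0 = h by ring.
move=> Hh; rewrite cexp0.
have D1 := Rmin_l (Rmin d1 d2) (Rmin d3 e); have D2 := Rmin_r (Rmin d1 d2) (Rmin d3 e).
have D3 := Rmin_l d1 d2; have D4 := Rmin_r d1 d2.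
have D5 := Rmin_l d3 e; have D6 := Rmin_r d3 e.
have xh := abs_fst_le h; have yh := abs_snd_le h.
set x := fst h in xh *; set y := snd h in yh *.
have {}H1 := H1 x ltac:(lra); have {}H2 := H2 y ltac:(lra); have {}H3 := H3 y ltac:(lra).
rewrite exp_0 cos_0 sin_0 in H1 H2 H3.
have M := Cmod_ge_0 h; set m := Cmod h in M xh yh Hh *.
have x0 := Rabs_pos x; have y0 := Rabs_pos y.
apply: Rle_trans (Cmod_le_abs _) _.
(* Both parts are expressed through the first-order remainders of the real functions exp, cos and
   sin at 0. *)
have -> : (cexp h - 1 - 1 * h).1 = ((exp x - 1 - 1 * x) * cos y + x * (cos y - 1 - - 0 * y) + (cos y - 1 - - 0 * y))%R.
  by rewrite /= -/x -/y; ring.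
have -> : (cexp h - 1 - 1 * h).2 = ((exp x - 1 - 1 * x) * sin y + x * sin y + (sin y - 0 - 1 * y))%R.
  by rewrite /= -/x -/y; ring.
have T1 : (Rabs (exp x - 1 - 1 * x) <= e * m)%R.
  by apply: Rle_trans H1 _; apply: Rmult_le_compat_l; lra.
have T2 : (Rabs (cos y - 1 - - 0 * y) <= e * m)%R.
  by apply: Rle_trans H2 _; apply: Rmult_le_compat_l; lra.
have T3 : (Rabs (sin y - 0 - 1 * y) <= e * m)%R.
  by apply: Rle_trans H3 _; apply: Rmult_le_compat_l; lra.
have c1 : (Rabs (cos y) <= 1)%R by apply: Rabs_le; exact: COS_bound.
have s1 : (Rabs (sin y) <= 1)%R by apply: Rabs_le; exact: SIN_bound.
have T4 : (Rabs (sin y) <= 2 * m)%R.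
  have -> : sin y = ((sin y - 0 - 1 * y) + y)%R by ring.
  apply: Rle_trans (Rabs_triang _ _) _; have : (e * m <= 1 * m)%R by apply: Rmult_le_compat_r.
  lra.
have P (a b A B : R) : (Rabs a <= A)%R -> (Rabs b <= B)%R -> (Rabs (a * b) <= A * B)%R.
  by move=> aA bB; rewrite Rabs_mult; apply: Rmult_le_compat => //; apply: Rabs_pos.
have Q1 := P _ _ _ _ T1 c1; have Q2 := P _ _ _ _ (Rlt_le _ _ (Rle_lt_trans _ _ _ xh Hh)) T2.
have Q3 := P _ _ _ _ T1 s1; have Q4 := P _ _ _ _ xh T4.
have Q5 : (Rmin (Rmin d1 d2) (Rmin d3 e) * (e * m) <= 1 * (e * m))%R.
  by apply: Rmult_le_compat_r; [apply: Rmult_le_pos|]; lra.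
have Q6 : (m * (2 * m) <= 2 * (e * m))%R.
  have : (m * m <= e * m)%R by apply: Rmult_le_compat_r; lra.
  lra.
have Q7 : (10 * (e * m) <= eps * m)%R.
  have : (e * m <= eps / 10 * m)%R by apply: Rmult_le_compat_r.
  lra.
have TR a b c := Rle_trans _ _ _ (Rabs_triang (a + b) c) (Rplus_le_compat_r _ _ _ (Rabs_triang a b)).
apply: Rle_trans (Rplus_le_compat _ _ _ _ (TR _ _ _) (TR _ _ _)) _.
have em := Rmult_le_pos _ _ (Rlt_le _ _ e0) M; lra.
Qed.

Lemma cderiv_cexp z : cderiv cexp z (cexp z).
Proof.
have H := @cderiv_comp_affine cexp 1 (- z) z 1.
have E : 1 * z + - z = RtoC 0 by ring.
rewrite E in H; have {}H := cderiv_scal (cexp z) (H cderiv_cexp0).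
have -> : cexp z = cexp z * (1 * 1) by ring.
apply: cderiv_ext H => x; rewrite -cexp_add; congr cexp; ring.
Qed.

(** * Bounded functions with vanishing four-point sums are constant *)

(** Compactness for a class [A] of bounds that is closed under maxima: local bounds on finitely many
    discs combine to a single one in [A]. With all reals for [A] this gives boundedness; with the
    reals below a supremum it shows that the supremum is attained. The local bound is asked at every
    point of the plane, so that [S] may be any bounded set. *)
Lemma bounded_cover (A : R -> Prop) (S : C -> Prop) (f : C -> R) (K : R) :
  (exists c, A c) -> (forall a b, A a -> A b -> A (Rmax a b)) ->
  (forall p, S p -> (Cmod p <= K)%R) ->
  (forall p, exists2 d : R, (0 < d)%R & exists2 c, A c &
     forall q, S q -> (Cmod (q - p) < d)%R -> (f q <= c)%R) ->
  exists2 c, A c & forall q, S q -> (f q <= c)%R.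
Proof.
move=> [c0 Ac0] Amax SK H.
(* [compactness_list] speaks of nested pairs of reals; [tn] and [nt] translate. *)
pose tn (p : C) : Compactness.Tn 2 R := (fst p, (snd p, tt)).
pose nt (t : Compactness.Tn 2 R) : C := (fst t, fst (snd t)).
have [g Hg] : exists g : C -> posreal * R, forall p, A (g p).2 /\
    forall q, S q -> (Rabs (fst q - fst p) < (g p).1)%R ->
      (Rabs (snd q - snd p) < (g p).1)%R -> (f q <= (g p).2)%R.
  suff /choice[g] : forall p, exists y : posreal * R, A y.2 /\
      forall q, S q -> (Rabs (fst q - fst p) < y.1)%R ->
        (Rabs (snd q - snd p) < y.1)%R -> (f q <= y.2)%R by exists g.
  move=> p; have [d d0 [c Ac Hc]] := H p.
  have d2 : (0 < d / 2)%R by lra.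
  (* A square of half-side d / 2 lies in the disc of radius d. *)
  exists (mkposreal _ d2, c); split=> // q Sq /= q1 q2; apply: Hc => //.
  by apply: (@Rle_lt_trans _ (Rabs (q.1 - p.1) + Rabs (q.2 - p.2))); [exact: Cmod_le_abs|lra].
apply: contrapT => nex.
apply: (@compactness_list 2 (tn (-K, -K)%R) (tn (K, K)) (fun t => (g (nt t)).1)).
move=> [l Hl]; apply: nex.
have [c [Ac Hc]] : exists c, A c /\ forall t, List.In t l -> ((g (nt t)).2 <= c)%R.
  elim: l {Hl} => [|t l [c [Ac Hc]]]; first by exists c0.
  exists (Rmax (g (nt t)).2 c); split; first by apply: Amax => //; case: (Hg (nt t)).
  move=> t' [->|/Hc t'c]; first exact: Rmax_l.
  by apply: Rle_trans t'c (Rmax_r _ _).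
exists c => // q Sq.
have [] := Hl (tn q).
  have := SK q Sq; have := abs_fst_le q; have := abs_snd_le q => q1 q2 q3.
  have /Rabs_le_between r1 : (Rabs q.1 <= K)%R by lra.
  have /Rabs_le_between r2 : (Rabs q.2 <= K)%R by lra.
  by rewrite /tn /=; do !split; lra.
move=> [t1 [t2 []]] [tl [_ [qt1 [qt2 _]]]]; apply: Rle_trans (Hc _ tl).
by have [_ {}Hg] := Hg (nt (t1, (t2, tt))); apply: Hg.
Qed.

Definition rcont (f : C -> R) (z : C) : Prop :=
  forall eps : R, (0 < eps)%R -> exists2 d : R, (0 < d)%R &
  forall z', (Cmod (z' - z) < d)%R -> (Rabs (f z' - f z) < eps)%R.

Lemma compact_bounded (S : C -> Prop) (f : C -> R) (K : R) :
  (forall p, S p -> (Cmod p <= K)%R) -> (forall p, rcont f p) ->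
  exists c, forall q, S q -> (f q <= c)%R.
Proof.
move=> SK fc; have [|//|p|c _ Hc] := @bounded_cover (fun=> True) S f K _ _ SK.
- by exists 0%R.
- have [d d0 Hd] := fc p 1%R Rlt_0_1; exists d => //; exists (f p + 1)%R => // q _.
  by move/Hd/Rabs_def2; lra.
- by exists c.
Qed.

Lemma compact_max (S : C -> Prop) (f : C -> R) (K : R) :
  (forall p, S p -> (Cmod p <= K)%R) ->
  (forall p, ~ S p -> exists2 d : R, (0 < d)%R & forall q, (Cmod (q - p) < d)%R -> ~ S q) ->
  (forall p, S p -> rcont f p) -> (exists p, S p) ->
  exists2 p, S p & forall q, S q -> (f q <= f p)%R.
Proof.
move=> SK Sc fc [p0 Sp0].
have [c _ Hc] : exists2 c, True & forall q, S q -> (f q <= c)%R.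
  apply: (@bounded_cover (fun=> True) S f K) => // p.
  have [Sp|/Sc [d d0 Hd]] := EM (S p); last first.
    by exists d => //; exists 0%R => // q Sq /Hd /(_ Sq).
  have [d d0 Hd] := fc p Sp 1%R Rlt_0_1; exists d => //; exists (f p + 1)%R => // q _.
  by move/Hd/Rabs_def2; lra.
pose E (y : R) := exists2 p, S p & y = f p.
have [|| M [Mub Mlub]] := completeness E.
- by exists c => y [p /Hc ? ->].
- by exists (f p0); exists p0.
apply: contrapT => nmax.
have lt p : S p -> (f p < M)%R.
  move=> Sp; case: (Rle_lt_or_eq_dec (f p) M); [by apply: Mub; exists p|by []|].
  move=> fpM; case: nmax; exists p => // q Sq; rewrite fpM; apply: Mub; by exists q.
(* If M is not attained, every point has a local bound below M, and hence so has all of S. *)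
have [|a b aM bM|p|c' c'M Hc'] := @bounded_cover (fun c => (c < M)%R) S f K _ _ SK.
- by exists (f p0); apply: lt.
- exact: Rmax_lub_lt.
- have [Sp|/Sc [d d0 Hd]] := EM (S p); last first.
    by exists d => //; exists (M - 1)%R; [lra|move=> q Sq /Hd /(_ Sq)].
  have fpM := lt p Sp.
  have [d d0 Hd] := fc p Sp ((M - f p) / 2)%R ltac:(lra); exists d => //.
  exists (f p + (M - f p) / 2)%R; first lra.
  by move=> q _ /Hd /Rabs_def2; lra.
have : (M <= c')%R by apply: Mlub => y [p Sp ->]; apply: Hc'.
lra.
Qed.

(** The discrete Laplacian on the square z + s i^k: linear terms and harmonic quadratic terms
    contribute nothing, and |u|^2 contributes 4 s^2. *)
Definition fourpt (h : C -> R) (z : C) (s : R) : R :=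
  (h (z + s)%C + h (z + Ci * s)%C + h (z - s)%C + h (z - Ci * s)%C - 4 * h z)%R.

Definition flat4 (h : C -> R) (z : C) : Prop :=
  exists M r : R, (0 < r)%R /\
  forall s : R, (0 < s < r)%R -> (Rabs (fourpt h z s) <= M * s ^ 3)%R.

Lemma ln_near1 x : (Rabs (x - 1) <= / 2)%R -> (Rabs (ln x) <= 2 * Rabs (x - 1))%R.
Proof.
move=> /[dup] H /Rabs_le_between Hx; have x0 : (0 < x)%R by lra.
have L1 : (ln x <= x - 1)%R.
  by have := exp_ineq1_le (ln x); rewrite exp_ln //; lra.
have L2 : (- ln x <= / x - 1)%R.
  have ix := Rinv_0_lt_compat x x0; rewrite -ln_Rinv //.
  by have := exp_ineq1_le (ln (/ x)); rewrite exp_ln //; lra.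
have L3 : (/ x - 1 <= 2 * Rabs (x - 1))%R.
  have -> : (/ x - 1 = (1 - x) * / x)%R by field; lra.
  have : (/ x <= 2)%R by rewrite -[2%R]Rinv_inv; apply: Rinv_le_contravar; lra.
  have := Rinv_0_lt_compat x x0 => i0 i2.
  have := Rle_abs (1 - x); rewrite -Rabs_Ropp => A.
  have -> : (x - 1 = - (1 - x))%R by ring.
  have : ((1 - x) * / x <= Rabs (- (1 - x)) * / x)%R by apply: Rmult_le_compat_r; lra.
  have : (Rabs (- (1 - x)) * / x <= Rabs (- (1 - x)) * 2)%R.
    by apply: Rmult_le_compat_l => //; apply: Rabs_pos.
  lra.
have := Rle_abs (x - 1) => L4; have := Rabs_pos (x - 1) => L5.
by apply: Rabs_le; lra.
Qed.

Lemma ln_Cmod_mult (x y : C) : x <> 0 -> y <> 0 ->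
  ln (Cmod (x * y)) = (ln (Cmod x) + ln (Cmod y))%R.
Proof. by move=> x0 y0; rewrite Cmod_mult ln_mult //; apply/Cmod_gt_0. Qed.

(** Replacing one factor at a time leaves four terms, each at most 27 e; hence 108. *)
Lemma norm_prod4_sub (a b c d a' b' c' d' : C) (e : R) :
  (Cmod a <= 2)%R -> (Cmod b <= 2)%R -> (Cmod c <= 2)%R -> (Cmod d <= 2)%R ->
  (Cmod a' <= e)%R -> (Cmod b' <= e)%R -> (Cmod c' <= e)%R -> (Cmod d' <= e)%R ->
  (e <= 1)%R ->
  (Cmod ((a + a') * (b + b') * (c + c') * (d + d') - a * b * c * d) <= 108 * e)%R.
Proof.
move=> a2 b2 c2 d2 a1 b1 c1 d1 e1.
have e0 : (0 <= e)%R by apply: Rle_trans (Cmod_ge_0 a') a1.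
have P (x y : C) (X Y : R) : (Cmod x <= X)%R -> (Cmod y <= Y)%R -> (Cmod (x * y) <= X * Y)%R.
  by move=> xX yY; rewrite Cmod_mult; apply: Rmult_le_compat => //; apply: Cmod_ge_0.
have T (x y : C) : (Cmod x <= 2)%R -> (Cmod y <= e)%R -> (Cmod (x + y) <= 3)%R.
  by move=> x2 y1; apply: Rle_trans (Cmod_triangle _ _) _; lra.
have -> : (a + a') * (b + b') * (c + c') * (d + d') - a * b * c * d =
  a' * (b + b') * (c + c') * (d + d') + (a * b' * (c + c') * (d + d') +
  (a * b * c' * (d + d') + a * b * c * d')) by ring.
have A3 := T _ _ a2 a1; have B3 := T _ _ b2 b1; have C3 := T _ _ c2 c1; have D3 := T _ _ d2 d1.
apply: Rle_trans (Cmod_triangle _ _) _; apply: Rle_trans (Rplus_le_compat_l _ _ _ (Cmod_triangle _ _)) _.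
apply: Rle_trans (Rplus_le_compat_l _ _ _ (Rplus_le_compat_l _ _ _ (Cmod_triangle _ _))) _.
have Q1 := P _ _ _ _ (P _ _ _ _ (P _ _ _ _ a1 B3) C3) D3.
have Q2 := P _ _ _ _ (P _ _ _ _ (P _ _ _ _ a2 b1) C3) D3.
have Q3 := P _ _ _ _ (P _ _ _ _ (P _ _ _ _ a2 b2) c1) D3.
have Q4 := P _ _ _ _ (P _ _ _ _ (P _ _ _ _ a2 b2) c2) d1.
lra.
Qed.

(* Writing k / p0 = 1 + al u + be u^2 + O(u^3), the product of the quadratic
   polynomial over u = s, is, -s, -is equals (1 + be^2 s^4)^2 - ga^2 s^4 with
   ga = 2 be - al^2: the terms of order 1, 2, 3 vanish. *)
Lemma ln_fourpt (k : C -> C) (p0 p1 p2 : C) (M r : R) :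
  p0 <> 0 -> (0 < r)%R ->
  (forall u : C, u <> 0 -> (Cmod u < r)%R ->
     (Cmod (k u - (p0 + p1 * u + p2 * u ^ 2)) <= M * Cmod u ^ 3)%R) ->
  exists M' r' : R, (0 < r')%R /\ forall s : R, (0 < s < r')%R ->
   [/\ k s <> 0, k (Ci * s) <> 0, k (- s) <> 0, k (- (Ci * s)) <> 0 &
   (Rabs (ln (Cmod (k s)) + ln (Cmod (k (Ci * s)%C)) + ln (Cmod (k (- s)%C))
     + ln (Cmod (k (- (Ci * s))%C)) - 4 * ln (Cmod p0)) <= M' * s ^ 3)%R].
Proof.
move=> p00 r0 H; set al := p1 / p0; set be := p2 / p0.
have m0 : (0 < Cmod p0)%R by apply/Cmod_gt_0.
set N := (Rabs M / Cmod p0 + 1)%R.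
have N1 : (1 <= N)%R.
  by rewrite /N; have := Rdiv_le_0_compat _ _ (Rabs_pos M) m0; lra.
set a := Cmod al; set b := Cmod be.
have a0 : (0 <= a)%R := Cmod_ge_0 _. have b0 : (0 <= b)%R := Cmod_ge_0 _.
have E (u : C) : u <> 0 -> (Cmod u < r)%R ->
    exists2 e : C, k u = p0 * (1 + al * u + be * u ^ 2 + e) & (Cmod e <= N * Cmod u ^ 3)%R.
  move=> u0 ur; exists (k u / p0 - (1 + al * u + be * u ^ 2)).
    by field.
  have -> : k u / p0 - (1 + al * u + be * u ^ 2) = (k u - (p0 + p1 * u + p2 * u ^ 2)) / p0.
    by rewrite /al /be; field.
  rewrite Cmod_div //; apply: (Rmult_le_reg_r (Cmod p0)) => //.
  rewrite /Rdiv Rmult_assoc Rinv_l ?Rmult_1_r; last lra.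
  apply: Rle_trans (H u u0 ur) _.
  have u3 : (0 <= Cmod u ^ 3)%R by apply: pow_le; apply: Cmod_ge_0.
  have -> : (N * Cmod u ^ 3 * Cmod p0 = (Rabs M + Cmod p0) * Cmod u ^ 3)%R.
    by rewrite /N; field; lra.
  by apply: Rmult_le_compat_r => //; have := Rle_abs M; lra.
(* The first summand accounts for the cubic remainders through [norm_prod4_sub], the others for the
   three terms of [EP]. *)
set Q := (108 * N + (2 * b ^ 2 + b ^ 4 + (2 * b + a ^ 2) ^ 2))%R.
have Q1 : (108 <= Q)%R.
  rewrite /Q; have := pow2_ge_0 (2 * b + a ^ 2)%R; have := pow2_ge_0 b.
  have : (0 <= b ^ 4)%R by apply: pow_le.
  lra.
(* The four bounds on s make the expansion valid, powers of s decreasing, each quadratic factor at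
   most 2 in modulus, and Q s^3 at most 1 / 2 as [ln_near1] asks. *)
set r' := Rmin (Rmin r 1) (Rmin (/ (1 + a + b)) (/ (2 * Q))).
have ab1 : (0 < / (1 + a + b))%R by apply: Rinv_0_lt_compat; lra.
have Qi : (0 < / (2 * Q))%R by apply: Rinv_0_lt_compat; lra.
exists (2 * Q)%R, r'; split.
  by rewrite /r'; apply: Rmin_pos; apply: Rmin_pos; lra.
move=> s [s0 sr'].
have R1 := Rmin_l (Rmin r 1) (Rmin (/ (1 + a + b)) (/ (2 * Q))).
have R2 := Rmin_r (Rmin r 1) (Rmin (/ (1 + a + b)) (/ (2 * Q))).
have R3 := Rmin_l r 1; have R4 := Rmin_r r 1.
have R5 := Rmin_l (/ (1 + a + b)) (/ (2 * Q)); have R6 := Rmin_r (/ (1 + a + b)) (/ (2 * Q)).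
rewrite -/r' in R1 R2.
have s1 : (s < 1)%R by lra.
have sab : (s * (1 + a + b) <= 1)%R.
  by have := Rmult_le_compat_r (1 + a + b) s (/ (1 + a + b)); rewrite Rinv_l; lra.
have sQ : (s * (2 * Q) <= 1)%R.
  by have := Rmult_le_compat_r (2 * Q) s (/ (2 * Q)); rewrite Rinv_l; lra.
have s2 : (s ^ 2 <= s)%R by rewrite /= Rmult_1_r -{3}(Rmult_1_r s); apply: Rmult_le_compat_l; lra.
have s30 : (0 < s ^ 3)%R by apply: pow_lt.
have s32 : (s ^ 3 <= s)%R.
  have -> : (s ^ 3 = s * s ^ 2)%R by ring.
  by rewrite -{3}(Rmult_1_r s); apply: Rmult_le_compat_l; lra.
have s4 : (s ^ 4 <= s ^ 3)%R.
  have -> : (s ^ 4 = s ^ 3 * s)%R by ring.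
  by rewrite -{2}(Rmult_1_r (s ^ 3)); apply: Rmult_le_compat_l; lra.
have cs0 : RtoC s <> 0 by move=> [] ?; lra.
have ms : Cmod s = s by rewrite Cmod_R Rabs_right //; lra.
have mis : Cmod (Ci * s) = s by rewrite Cmod_mult Cmod_Ci ms Rmult_1_l.
have mns : Cmod (- s) = s by rewrite Cmod_opp.
have mnis : Cmod (- (Ci * s)) = s by rewrite Cmod_opp.
have nz u : Cmod u = s -> u <> 0 by move=> us; apply/Cmod_gt_0; lra.
have [e1 k1 E1] := E _ (nz _ ms) ltac:(lra).
have [e2 k2 E2] := E _ (nz _ mis) ltac:(lra).
have [e3 k3 E3] := E _ (nz _ mns) ltac:(lra).
have [e4 k4 E4] := E _ (nz _ mnis) ltac:(lra).
rewrite ms in E1; rewrite mis in E2; rewrite mns in E3; rewrite mnis in E4.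
have B2 u : Cmod u = s -> (Cmod (1 + al * u + be * u ^ 2) <= 2)%R.
  move=> us; apply: Rle_trans (Cmod_triangle _ _) _.
  apply: Rle_trans (Rplus_le_compat_r _ _ _ (Cmod_triangle _ _)) _.
  rewrite Cmod_1 (Cmod_mult al) (Cmod_mult be) Cmod_pow us -/a -/b.
  have : (b * s ^ 2 <= b * s)%R by apply: Rmult_le_compat_l.
  lra.
have NQ : (108 * N <= Q)%R.
  rewrite /Q; have := pow2_ge_0 (2 * b + a ^ 2)%R; have := pow2_ge_0 b.
  have : (0 <= b ^ 4)%R by apply: pow_le.
  lra.
have Ns : (N * s ^ 3 <= 1)%R.
  have : (N * s ^ 3 <= N * s)%R by apply: Rmult_le_compat_l; lra.
  have : (108 * N * s <= Q * s)%R by apply: Rmult_le_compat_r; lra.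
  have : (0 <= N * s)%R by apply: Rmult_le_pos; lra.
  lra.
have := norm_prod4_sub (B2 _ ms) (B2 _ mis) (B2 _ mns) (B2 _ mnis) E1 E2 E3 E4 Ns.
set Pi := (_ + e1) * _ * _ * _.
set Pz := _ * _ * _ * (1 + _ + _).
have Ci2 : Ci * Ci = - (1) by rewrite /Ci /Cmult /Copp /=; congr pair; ring.
have EP : Pz - 1 = 2 * be ^ 2 * s ^ 4 + be ^ 4 * s ^ 8 - (2 * be - al ^ 2) ^ 2 * s ^ 4.
  rewrite /Pz.
  have -> : (1 + al * (Ci * s) + be * (Ci * s) ^ 2) = 1 + al * s * Ci - be * s ^ 2.
    have -> : (Ci * s) ^ 2 = (Ci * Ci) * s ^ 2 by ring.
    by rewrite Ci2; ring.
  have -> : (1 + al * - (Ci * s) + be * (- (Ci * s)) ^ 2) = 1 - al * s * Ci - be * s ^ 2.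
    have -> : (- (Ci * s)) ^ 2 = (Ci * Ci) * s ^ 2 by ring.
    by rewrite Ci2; ring.
  have -> : (1 + al * s + be * s ^ 2) * (1 + al * s * Ci - be * s ^ 2) *
     (1 + al * - s + be * (- s) ^ 2) * (1 - al * s * Ci - be * s ^ 2) =
     ((1 + be * s ^ 2) ^ 2 - al ^ 2 * s ^ 2) * ((1 - be * s ^ 2) ^ 2 - (Ci * Ci) * (al ^ 2 * s ^ 2)) by ring.
  rewrite Ci2; have -> : RtoC 2 = RtoC 1 + RtoC 1 by rewrite -RtoC_plus.
  ring.
have BP : (Cmod (Pz - 1) <= (Q - 108 * N) * s ^ 3)%R.
  rewrite EP.
  have T1 : (Cmod (2 * be ^ 2 * s ^ 4) <= 2 * b ^ 2 * s ^ 3)%R.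
    rewrite (Cmod_mult (2 * be ^ 2)) (Cmod_mult 2) !Cmod_pow ms Cmod_R Rabs_right; last lra.
    by apply: Rmult_le_compat_l => //; have := pow2_ge_0 (Cmod be); lra.
  have T2 : (Cmod (be ^ 4 * s ^ 8) <= b ^ 4 * s ^ 3)%R.
    rewrite (Cmod_mult (be ^ 4)) !Cmod_pow ms.
    apply: Rmult_le_compat_l; first exact: pow_le.
    have -> : (s ^ 8 = s ^ 4 * s ^ 4)%R by ring.
    have s40 : (0 <= s ^ 4)%R by apply: pow_le; lra.
    have : (s ^ 4 * s ^ 4 <= s ^ 4 * 1)%R by apply: Rmult_le_compat_l; lra.
    lra.
  have T3 : (Cmod ((2 * be - al ^ 2) ^ 2 * s ^ 4) <= (2 * b + a ^ 2) ^ 2 * s ^ 3)%R.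
    rewrite (Cmod_mult ((2 * be - al ^ 2) ^ 2)) !Cmod_pow ms.
    apply: Rmult_le_compat => //; [apply: pow_le; exact: Cmod_ge_0|apply: pow_le; lra|].
    apply: pow_incr; split; first exact: Cmod_ge_0.
    apply: Rle_trans (Cmod_triangle _ _) _; rewrite Cmod_opp (Cmod_mult 2) Cmod_pow Cmod_R Rabs_right -/a -/b; lra.
  apply: Rle_trans (Cmod_triangle _ _) _; rewrite Cmod_opp.
  apply: Rle_trans (Rplus_le_compat_r _ _ _ (Cmod_triangle _ _)) _.
  rewrite /Q; lra.
move=> HP.
have {}HP : (Cmod (Pi - 1) <= Q * s ^ 3)%R.
  have -> : Pi - 1 = (Pi - Pz) + (Pz - 1) by ring.
  apply: Rle_trans (Cmod_triangle _ _) _; lra.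
have Pm : (Rabs (Cmod Pi - 1) <= Q * s ^ 3)%R.
  have := Cmod_rev_triangle Pi 1; have := Cmod_rev_triangle 1 Pi.
  rewrite Cmod_1 Cmod_sub_sym => A B; apply: Rabs_le; lra.
have Qs : (Q * s ^ 3 <= / 2)%R.
  have : (Q * s ^ 3 <= Q * s)%R by apply: Rmult_le_compat_l; lra.
  lra.
have L := ln_near1 (Rle_trans _ _ _ Pm Qs).
have Pi0 : Pi <> 0.
  by move=> Pi0; move: Pm; rewrite Pi0 Cmod_0 => /Rabs_le_between; lra.
have F4 (w x y z : C) : w * x * y * z <> 0 -> [/\ w <> 0, x <> 0, y <> 0 & z <> 0].
  by move=> nz0; split=> w0; apply: nz0; rewrite w0; ring.
have [f1 f2 f3 f4] := F4 _ _ _ _ Pi0.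
rewrite k1 k2 k3 k4; split; try by apply: Cmult_neq_0.
have LP : ln (Cmod Pi) = (ln (Cmod (1 + al * s + be * s ^ 2 + e1)%C) +
   ln (Cmod (1 + al * (Ci * s) + be * (Ci * s) ^ 2 + e2)%C) +
   ln (Cmod (1 + al * (- s) + be * (- s) ^ 2 + e3)%C) +
   ln (Cmod (1 + al * (- (Ci * s)) + be * (- (Ci * s)) ^ 2 + e4)%C))%R.
  by rewrite /Pi !ln_Cmod_mult //; do ?apply: Cmult_neq_0.
rewrite !ln_Cmod_mult //.
set x1 := ln _; set x2 := ln _; set x3 := ln _; set x4 := ln _; set x5 := ln _ => /=.
rewrite -/x2 -/x3 -/x4 -/x5 in LP.
have -> : (x1 + x2 + (x1 + x3) + (x1 + x4) + (x1 + x5) - 4 * x1 = ln (Cmod Pi))%R by rewrite LP; ring.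
apply: Rle_trans L _; lra.
Qed.

(** Here k is the polynomial z + u itself, with remainder 0. *)
Lemma flat4_ln (z : C) : z <> 0 -> flat4 (fun u => ln (Cmod u)) z.
Proof.
move=> z0.
have [||M [r [r0 H]]] := @ln_fourpt (fun u => z + u) z 1 0 0%R 1%R z0.
- lra.
- move=> u _ _; have -> : z + u - (z + 1 * u + 0 * u ^ 2) = 0 by ring.
  by rewrite Cmod_0; lra.
by exists M, r; split=> // s /H [].
Qed.

Lemma fourpt_sqr z s : fourpt (fun u => (Cmod u ^ 2)%R) z s = (4 * s ^ 2)%R.
Proof. by rewrite /fourpt !Cmod2_alt /Re /Im /=; ring. Qed.

Lemma rcont_Cmod_sqr z : rcont (fun u => (Cmod u ^ 2)%R) z.
Proof.
move=> eps eps0; set K := (2 * Cmod z + 1)%R.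
have z0 := Cmod_ge_0 z; have K0 : (0 < K)%R by rewrite /K; lra.
exists (Rmin 1 (eps / K)); first by apply: Rmin_pos; [lra|exact: Rdiv_lt_0_compat].
move=> z' Hz'; have d1 := Rmin_l 1 (eps / K); have d2 := Rmin_r 1 (eps / K).
have -> : (Cmod z' ^ 2 - Cmod z ^ 2 = (Cmod z' - Cmod z) * (Cmod z' + Cmod z))%R by ring.
have A : (Rabs (Cmod z' - Cmod z) <= Cmod (z' - z))%R.
  have := Cmod_rev_triangle z' z; have := Cmod_rev_triangle z z'.
  rewrite (Cmod_sub_sym z z') => ? ?; apply: Rabs_le; lra.
have B : (Cmod z' + Cmod z <= K)%R by have := Cmod_rev_triangle z' z; rewrite /K; lra.
have z'0 := Cmod_ge_0 z'.
rewrite Rabs_mult [Rabs (_ + _)]Rabs_right; last lra.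
apply: (@Rle_lt_trans _ (Cmod (z' - z) * K)%R).
  by apply: Rmult_le_compat => //; [exact: Rabs_pos|lra].
have -> : eps = (eps / K * K)%R by field; lra.
by apply: Rmult_lt_compat_r => //; lra.
Qed.

Lemma rcont_Cmod z : rcont Cmod z.
Proof.
move=> eps eps0; exists eps => // z' H.
have := Cmod_rev_triangle z' z; have := Cmod_rev_triangle z z'.
rewrite (Cmod_sub_sym z z') => ? ?; apply: Rabs_def1; lra.
Qed.

Lemma rcont_comp (g : R -> R) f z : continuity_pt g (f z) -> rcont f z -> rcont (fun u => g (f u)) z.
Proof.
move=> Hg Hf eps eps0; have [a [a0 Ha]] := Hg eps eps0.
have [d d0 Hd] := Hf a a0; exists d => // z' /Hd H.
have [->|ne] := Req_dec (f z') (f z); first by rewrite Rminus_diag Rabs_R0.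
by apply: (Ha (f z')); split=> //; split=> // /esym.
Qed.

Lemma rcont_ln (z : C) : z <> 0 -> rcont (fun u => ln (Cmod u)) z.
Proof.
move=> /Cmod_gt_0 z0; apply: rcont_comp (rcont_Cmod z).
by apply: derivable_continuous_pt; exists (/ Cmod z)%R; apply: derivable_pt_lim_ln.
Qed.

Lemma rcont_plus f g z : rcont f z -> rcont g z -> rcont (fun u => (f u + g u)%R) z.
Proof.
move=> Hf Hg eps eps0; have e2 : (0 < eps / 2)%R by lra.
have [d1 d10 H1] := Hf _ e2; have [d2 d20 H2] := Hg _ e2.
exists (Rmin d1 d2) => [|z' Hz']; first exact: Rmin_pos.
have A := Rmin_l d1 d2; have B := Rmin_r d1 d2.
have {}H1 := H1 z' ltac:(lra); have {}H2 := H2 z' ltac:(lra).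
have -> : (f z' + g z' - (f z + g z) = (f z' - f z) + (g z' - g z))%R by ring.
by apply: Rle_lt_trans (Rabs_triang _ _) _; lra.
Qed.

Lemma rcont_scal c f z : rcont f z -> rcont (fun u => (c * f u)%R) z.
Proof.
move=> Hf eps eps0; set K := (Rabs c + 1)%R.
have c0 := Rabs_pos c; have K0 : (0 < K)%R by rewrite /K; lra.
have [d d0 H] := Hf (eps / K)%R ltac:(exact: Rdiv_lt_0_compat).
exists d => // z' /H {}H.
rewrite -Rmult_minus_distr_l Rabs_mult.
have f0 := Rabs_pos (f z' - f z).
apply: (@Rle_lt_trans _ (K * Rabs (f z' - f z))%R).
  by apply: Rmult_le_compat_r => //; rewrite /K; lra.
have -> : eps = (K * (eps / K))%R by field; lra.
exact: Rmult_lt_compat_l.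
Qed.

(* If h z > h 0, then h - ep ln |u| + de |u|^2 would have an interior maximum
   on a large annulus, against its four-point sums at that maximum. *)
Lemma bounded_flat4_le0 (h : C -> R) (B : R) :
  (forall z, (Rabs (h z) <= B)%R) -> (forall z, rcont h z) -> (forall z, flat4 h z) ->
  forall z, (h z <= h 0)%R.
Proof.
move=> hB hc hf z; apply: Rnot_lt_le => hz.
set et := ((h z - h 0) / 4)%R; have et0 : (0 < et)%R by rewrite /et; lra.
have hz4 : (h z = h 0 + 4 * et)%R by rewrite /et; field.
have B0 : (0 <= B)%R by apply: Rle_trans (hB 0); apply: Rabs_pos.
have [r1 r10 Hr1] := hc 0 et et0.
set r0 := (r1 / 2)%R; have r00 : (0 < r0)%R by rewrite /r0; lra.
have small p : (Cmod p <= r0)%R -> (h p < h 0 + et)%R.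
  move=> pr; have : (Cmod (p - 0) < r1)%R.
    have -> : p - 0 = p by ring.
    by rewrite /r0 in pr; lra.
  by move/Hr1/Rabs_def2; lra.
have zr0 : (r0 < Cmod z)%R.
  by apply: Rnot_le_lt => /small; lra.
set l := (ln (Cmod z) - ln r0)%R.
have l0 : (0 < l)%R by rewrite /l; have := ln_increasing _ _ r00 zr0; lra.
(* Since ep l = et, the logarithm costs only et at z compared with the inner circle |u| = r0. There
   h is below h 0 + et and de |u|^2 is at most et, while h z = h 0 + 4 et: the maximum is not on
   that circle. *)
set ep := (et / l)%R; have ep0 : (0 < ep)%R by apply: Rdiv_lt_0_compat.
(* On the outer circle the logarithm costs 2 B + et more than at z, which the variation of h and the
   term de |u|^2 cannot make up. *)
set R1 := exp (ln (Cmod z) + (2 * B + et) / ep).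
have z0 : (0 < Cmod z)%R by lra.
have q0 : (0 < (2 * B + et) / ep)%R by apply: Rdiv_lt_0_compat => //; lra.
have zR1 : (Cmod z < R1)%R.
  rewrite -{1}(exp_ln _ z0); apply: exp_increasing; lra.
have R10 : (0 < R1)%R by lra.
set de := (et / R1 ^ 2)%R; have R20 : (0 < R1 ^ 2)%R by apply: pow_lt.
have de0 : (0 < de)%R by apply: Rdiv_lt_0_compat.
pose Phi u := (h u + (- ep * ln (Cmod u) + de * (Cmod u ^ 2)))%R.
pose S u := (r0 <= Cmod u <= R1)%R.
have [p []|p pS|p [pr pR]||p [pr pR] pmax] := @compact_max S Phi R1.
- by [].
- have [Q|Q] : (Cmod p < r0)%R \/ (R1 < Cmod p)%R.
    have [A|A] := Rlt_le_dec (Cmod p) r0; first by left.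
    by have [A'|A'] := Rlt_le_dec R1 (Cmod p); [right|case: pS].
  + exists (r0 - Cmod p)%R; first lra.
    by move=> q; have := Cmod_rev_triangle q p; rewrite /S; lra.
  + exists (Cmod p - R1)%R; first lra.
    by move=> q; rewrite Cmod_sub_sym; have := Cmod_rev_triangle p q; rewrite /S; lra.
- have p0 : p <> 0 by apply/Cmod_gt_0; lra.
  apply: rcont_plus => //; apply: rcont_plus; apply: rcont_scal; first exact: rcont_ln.
  exact: rcont_Cmod_sqr.
- by exists z; rewrite /S; lra.
have zS : S z by rewrite /S; lra.
have epl : (ep * l = et)%R by rewrite /ep; field; lra.
have deR : (de * R1 ^ 2 = et)%R by rewrite /de; field; lra.
have dep : (de * Cmod p ^ 2 <= et)%R.
  by rewrite -deR; apply: Rmult_le_compat_l; [lra|apply: pow_incr; lra].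
have dez : (0 <= de * Cmod z ^ 2)%R by apply: Rmult_le_pos; [lra|exact: pow2_ge_0].
have := pmax z zS; rewrite /Phi => Phz.
have hp := hB p; have h00 := hB 0; move: hp h00 => /Rabs_le_between hp /Rabs_le_between h00.
have [pr0|pr0] := Rle_lt_or_eq_dec _ _ pr; last first.
  have := small p; rewrite -pr0 => /(_ (Rle_refl _)) hp1.
  by move: Phz; rewrite -pr0 => Phz; rewrite -pr0 in dep; rewrite /l in epl; lra.
have [pR1|pR1] := Rle_lt_or_eq_dec _ _ pR; last first.
  have L : (ep * ln (Cmod p) = ep * ln (Cmod z) + (2 * B + et))%R.
    by rewrite pR1 /R1 ln_exp; field; lra.
  by lra.
have p0 : p <> 0 by apply/Cmod_gt_0; lra.
have [M1 [s1 [s10 H1]]] := hf p; have [M2 [s2 [s20 H2]]] := flat4_ln p0.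
set W := (Rabs M1 + ep * Rabs M2 + 1)%R.
have W0 : (0 < W)%R.
  rewrite /W; have := Rabs_pos M1; have := Rmult_le_pos _ _ (Rlt_le _ _ ep0) (Rabs_pos M2); lra.
have dW : (0 < 4 * de / W)%R by apply: Rdiv_lt_0_compat; lra.
(* For s below 4 de / W the term 4 de s^2 outweighs the O(s^3) terms; the last two entries keep the
   four points in the annulus. *)
set m := Rmin (Rmin s1 s2) (Rmin (4 * de / W) (Rmin (Cmod p - r0) (R1 - Cmod p))).
have m0 : (0 < m)%R by repeat apply: Rmin_pos; lra.
have m1 := Rmin_l (Rmin s1 s2) (Rmin (4 * de / W) (Rmin (Cmod p - r0) (R1 - Cmod p))).
have m2 := Rmin_r (Rmin s1 s2) (Rmin (4 * de / W) (Rmin (Cmod p - r0) (R1 - Cmod p))).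
have m3 := Rmin_l s1 s2; have m4 := Rmin_r s1 s2.
have m5 := Rmin_l (4 * de / W) (Rmin (Cmod p - r0) (R1 - Cmod p)).
have m6 := Rmin_r (4 * de / W) (Rmin (Cmod p - r0) (R1 - Cmod p)).
have m7 := Rmin_l (Cmod p - r0) (R1 - Cmod p); have m8 := Rmin_r (Cmod p - r0) (R1 - Cmod p).
rewrite -/m in m1 m2.
set s := (m / 2)%R; have s0 : (0 < s)%R by rewrite /s; lra.
have sm : (s < m)%R by rewrite /s; lra.
have ms : Cmod s = s by rewrite Cmod_R Rabs_right //; lra.
have mis : Cmod (Ci * s) = s by rewrite Cmod_mult Cmod_Ci ms Rmult_1_l.
have near u : Cmod u = s -> (Phi (p + u)%C <= Phi p)%R.
  move=> us; apply: pmax; rewrite /S.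
  have := Cmod_rev_triangle (p + u) p; have := Cmod_rev_triangle p (p + u).
  rewrite (Cmod_sub_sym p).
  have -> : p + u - p = u by ring.
  by rewrite us; lra.
have F : (fourpt Phi p s = fourpt h p s + (- ep * fourpt (fun u => ln (Cmod u)) p s
    + de * (4 * s ^ 2)))%R.
  by rewrite -(fourpt_sqr p s) /fourpt /Phi; ring.
have F0 : (fourpt Phi p s <= 0)%R.
  rewrite /fourpt /Cminus.
  have := near _ ms; have := near _ mis.
  have := near (- s); have := near (- (Ci * s)); rewrite !Cmod_opp => /(_ mis) ? /(_ ms) ? ? ?.
  lra.
have {}H1 := H1 s ltac:(lra); have {}H2 := H2 s ltac:(lra).
have s30 : (0 < s ^ 3)%R by apply: pow_lt. have s20' : (0 < s ^ 2)%R by apply: pow_lt.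
have B1 : (- (Rabs M1 * s ^ 3) <= fourpt h p s)%R.
  have : (M1 * s ^ 3 <= Rabs M1 * s ^ 3)%R by apply: Rmult_le_compat_r; [lra|exact: Rle_abs].
  by move/Rabs_le_between: H1; lra.
have B2 : (ep * fourpt (fun u => ln (Cmod u)) p s <= ep * (Rabs M2 * s ^ 3))%R.
  apply: Rmult_le_compat_l; first lra.
  have : (M2 * s ^ 3 <= Rabs M2 * s ^ 3)%R by apply: Rmult_le_compat_r; [lra|exact: Rle_abs].
  by move/Rabs_le_between: H2; lra.
have B3 : (W * s ^ 3 < 4 * de * s ^ 2)%R.
  have -> : (W * s ^ 3 = (W * s) * s ^ 2)%R by ring.
  apply: Rmult_lt_compat_r => //.
  have -> : (4 * de = W * (4 * de / W))%R by field; lra.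
  by apply: Rmult_lt_compat_l; lra.
have B4 : (W * s ^ 3 = Rabs M1 * s ^ 3 + ep * (Rabs M2 * s ^ 3) + s ^ 3)%R by rewrite /W; ring.
lra.
Qed.

Lemma flat4_shift h a z : flat4 h (z + a) -> flat4 (fun u => h (u + a)) z.
Proof.
move=> [M [r [r0 H]]]; exists M, r; split=> // s /H; congr (Rle (Rabs _) _).
rewrite /fourpt; do ?congr Rplus; do ?congr h; try ring.
Qed.

(** The reverse inequality is the one-sided lemma for the translate of h by z, taken at - z. *)
Lemma bounded_flat4_const (h : C -> R) (B : R) :
  (forall z, (Rabs (h z) <= B)%R) -> (forall z, rcont h z) -> (forall z, flat4 h z) ->
  forall z, h z = h 0.
Proof.
move=> hB hc hf z; apply: Rle_antisym; first exact: bounded_flat4_le0 hB hc hf z.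
have := @bounded_flat4_le0 (fun u => h (u + z)) B _ _ _ (- z).
have -> : - z + z = 0 by ring.
have -> : 0 + z = z by ring.
apply=> [u|u eps eps0|u]; [exact: hB| |exact/flat4_shift/hf].
have [d d0 Hd] := hc (u + z) eps eps0; exists d => // z' Hz'; apply: Hd.
by have -> : z' + z - (u + z) = z' - u by ring.
Qed.

(** * Taylor expansions at 0 *)

(** The point u = 0 is left out because the kernel takes a default value there. *)
Definition bigO (N : nat) (f : C -> C) : Prop :=
  exists M r : R, (0 < r)%R /\ forall u : C, u <> 0 -> (Cmod u < r)%R ->
    (Cmod (f u) <= M * Cmod u ^ N)%R.

(** Partial sums in Horner form, so that removing the constant term is a shift of the sequence. *)
Fixpoint psum (c : nat -> C) (N : nat) (u : C) : C :=
  if N is m.+1 then c 0%N + u * psum (fun n => c n.+1) m u else 0.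

(** An asymptotic expansion to all orders, without convergence: it determines the coefficients, and
    products and rescalings only require estimates of remainders. *)
Definition tay (k : C -> C) (c : nat -> C) : Prop :=
  forall N, bigO N (fun u => k u - psum c N u).

Lemma bigO_ext_loc N f g (d : R) : (0 < d)%R ->
  (forall u : C, u <> 0 -> (Cmod u < d)%R -> f u = g u) -> bigO N f -> bigO N g.
Proof.
move=> d0 fg [M [r [r0 H]]]; exists M, (Rmin d r); split; first exact: Rmin_pos.
move=> u u0 ur; have A := Rmin_l d r; have B := Rmin_r d r.
by rewrite -fg //; [apply: H => //; lra|lra].
Qed.

Lemma bigO_ext N f g : f =1 g -> bigO N f -> bigO N g.
Proof. by move=> fg; apply: (@bigO_ext_loc N f g 1%R) => //; lra. Qed.

Lemma bigO_plus N f g : bigO N f -> bigO N g -> bigO N (fun u => f u + g u).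
Proof.
move=> [M1 [r1 [r10 H1]]] [M2 [r2 [r20 H2]]].
exists (M1 + M2)%R, (Rmin r1 r2); split; first exact: Rmin_pos.
move=> u u0 ur; have A := Rmin_l r1 r2; have B := Rmin_r r1 r2.
have {}H1 := H1 u u0 ltac:(lra); have {}H2 := H2 u u0 ltac:(lra).
by apply: Rle_trans (Cmod_triangle _ _) _; lra.
Qed.

Lemma bigO_mult N N' f g : bigO N f -> bigO N' g -> bigO (N + N') (fun u => f u * g u).
Proof.
move=> [M1 [r1 [r10 H1]]] [M2 [r2 [r20 H2]]].
exists (M1 * M2)%R, (Rmin r1 r2); split; first exact: Rmin_pos.
move=> u u0 ur; have A := Rmin_l r1 r2; have B := Rmin_r r1 r2.
have {}H1 := H1 u u0 ltac:(lra); have {}H2 := H2 u u0 ltac:(lra).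
rewrite Cmod_mult -plusE pow_add.
have -> : (M1 * M2 * (Cmod u ^ N * Cmod u ^ N') = (M1 * Cmod u ^ N) * (M2 * Cmod u ^ N'))%R by ring.
by apply: Rmult_le_compat => //; apply: Cmod_ge_0.
Qed.

Lemma bigO_const c : bigO 0 (fun=> c).
Proof. by exists (Cmod c), 1%R; split=> [|u _ _ /=]; lra. Qed.

Lemma bigO_scal c N f : bigO N f -> bigO N (fun u => c * f u).
Proof. by move=> H; have := bigO_mult (bigO_const c) H; rewrite add0n. Qed.

Lemma bigO_id : bigO 1 id.
Proof. by exists 1%R, 1%R; split=> [|u _ _ /=]; lra. Qed.

Lemma bigO_divu N f : bigO N.+1 f -> bigO N (fun u => f u / u).
Proof.
move=> [M [r [r0 H]]]; exists M, r; split=> // u u0 /(H u u0) {}H.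
have m0 : (0 < Cmod u)%R by apply/Cmod_gt_0.
rewrite Cmod_div //; apply: (Rmult_le_reg_r (Cmod u)) => //.
rewrite /Rdiv Rmult_assoc Rinv_l ?Rmult_1_r; last lra.
by apply: Rle_trans H _; rewrite /=; lra.
Qed.

Lemma bigO_const_eq0 c : bigO 1 (fun=> c) -> c = 0.
Proof.
move=> [M [r [r0 H]]]; apply: contrapT => c0.
have m0 : (0 < Cmod c)%R by apply/Cmod_gt_0.
set W := (Rabs M + 1)%R; have W0 : (0 < W)%R by rewrite /W; have := Rabs_pos M; lra.
set s := (Rmin r (Cmod c / W) / 2)%R.
have cW : (0 < Cmod c / W)%R by exact: Rdiv_lt_0_compat.
have s0 : (0 < s)%R by rewrite /s; have := Rmin_pos _ _ r0 cW; lra.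
have sr : (s < r)%R by rewrite /s; have := Rmin_l r (Cmod c / W); rewrite /s in s0; lra.
have sc : (s < Cmod c / W)%R by rewrite /s; have := Rmin_r r (Cmod c / W); rewrite /s in s0; lra.
have ms : Cmod s = s by rewrite Cmod_R Rabs_right //; lra.
have := H s ltac:(by move=> [] ?; lra) ltac:(lra); rewrite ms pow_1 => K.
have : (W * s < Cmod c)%R.
  have -> : (Cmod c = W * (Cmod c / W))%R by field; lra.
  exact: Rmult_lt_compat_l.
have : (M * s <= Rabs M * s)%R by apply: Rmult_le_compat_r; [lra|exact: Rle_abs].
by rewrite /W; lra.
Qed.

Lemma tay_ext_loc k k' c (d : R) : (0 < d)%R ->
  (forall u : C, u <> 0 -> (Cmod u < d)%R -> k u = k' u) -> tay k c -> tay k' c.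
Proof. by move=> d0 H T N; apply: bigO_ext_loc (T N) => [|u u0 /(H u u0) ->]. Qed.

Lemma tay_shift k c : tay k c -> tay (fun u => (k u - c 0%N) / u) (fun n => c n.+1).
Proof.
move=> T N; apply: bigO_ext_loc (bigO_divu (T N.+1)); first exact: Rlt_0_1.
by move=> u u0 _ /=; field.
Qed.

Lemma tay_bounded k c : tay k c -> bigO 0 k.
Proof. by move/(_ 0%N); apply: bigO_ext => u /=; ring. Qed.

Lemma tay_coef0 k c : tay k c -> bigO 1 (fun u => k u - c 0%N).
Proof. by move/(_ 1%N); apply: bigO_ext => u /=; ring. Qed.

(** A constant that is O(u) is 0, which settles the first coefficient; then (k - c 0) / u carries
    the induction. *)
Lemma tay_unique k c d : tay k c -> tay k d -> c =1 d.
Proof.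
move=> Tc Td n; elim: n k c d Tc Td => [|n IH] k c d Tc Td.
  have := bigO_plus (tay_coef0 Td) (bigO_scal (-(1)) (tay_coef0 Tc)).
  move=> H; have /bigO_const_eq0 E : bigO 1 (fun=> c 0%N - d 0%N).
    by apply: bigO_ext H => u; ring.
  by rewrite -[c 0%N](Csub_add _ (d 0%N)) E; ring.
have cd0 : c 0%N = d 0%N.
  have := bigO_plus (tay_coef0 Td) (bigO_scal (-(1)) (tay_coef0 Tc)).
  move=> H; have /bigO_const_eq0 E : bigO 1 (fun=> c 0%N - d 0%N).
    by apply: bigO_ext H => u; ring.
  by rewrite -[c 0%N](Csub_add _ (d 0%N)) E; ring.
have T1 := tay_shift Tc; rewrite cd0 in T1.
exact: (IH _ (fun n => c n.+1) (fun n => d n.+1) T1 (tay_shift Td)).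
Qed.

(** The Cauchy product, unfolded along the first sequence to match [psum]. *)
Fixpoint conv (c d : nat -> C) (n : nat) : C :=
  if n is m.+1 then c 0%N * d m.+1 + conv (fun n => c n.+1) d m else c 0%N * d 0%N.

Lemma psum_lin a c d N u :
  psum (fun n => a * c n + d n) N u = a * psum c N u + psum d N u.
Proof.
elim: N c d => [|N IH] c d /=; first ring.
by rewrite (IH (fun n => c n.+1) (fun n => d n.+1)); ring.
Qed.

(** With k = c 0 + u k1 and l = d 0 + u l1 the product is c 0 d 0 + u (k1 l + c 0 l1), and the
    induction applies to k1. *)
Lemma tay_mult k l c d : tay k c -> tay l d -> tay (fun u => k u * l u) (conv c d).
Proof.
move=> Tc Td N; elim: N k c Tc => [|N IH] k c Tc.
  apply: bigO_ext (bigO_mult (tay_bounded Tc) (tay_bounded Td)) => u /=; ring.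
have H1 := IH _ _ (tay_shift Tc).
have H2 := bigO_scal (c 0%N) (tay_shift Td N).
apply: bigO_ext_loc (bigO_mult bigO_id (bigO_plus H1 H2)); first exact: Rlt_0_1.
move=> u u0 _ /=.
rewrite (psum_lin _ (fun n => d n.+1)).
by field.
Qed.

Lemma psum_geom j c N u : psum (fun n => j ^ n * c n) N u = psum c N (j * u).
Proof.
elim: N c => [|N IH] c //=.
have -> : psum (fun n => j * j ^ n * c n.+1) N u = j * psum (fun n => j ^ n * c n.+1) N u.
  have := psum_lin j (fun n => j ^ n * c n.+1) (fun=> 0) N u.
  have -> : psum (fun=> 0) N u = 0 by elim: (N) => [|m IHm] //=; rewrite IHm; ring.
  rewrite Cplus_0_r => <-; congr psum; apply: funext => n; ring.
by rewrite (IH (fun n => c n.+1)); ring.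
Qed.

Lemma tay_scale (j : C) k c : j <> 0 -> tay k c -> tay (fun u => k (j * u)) (fun n => j ^ n * c n).
Proof.
move=> j0 T N; have [M [r [r0 H]]] := T N.
have m0 : (0 < Cmod j)%R by apply/Cmod_gt_0.
exists (M * Cmod j ^ N)%R, (r / Cmod j)%R; split; first exact: Rdiv_lt_0_compat.
move=> u u0 ur; rewrite psum_geom.
have -> : (M * Cmod j ^ N * Cmod u ^ N = M * Cmod (j * u) ^ N)%R.
  by rewrite Cmod_mult Rpow_mult_distr; ring.
apply: H; first exact: Cmult_neq_0.
rewrite Cmod_mult; have -> : (r = Cmod j * (r / Cmod j))%R by field; lra.
exact: Rmult_lt_compat_l.
Qed.

Lemma psum_recr c N u : psum c N.+1 u = psum c N u + c N * u ^ N.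
Proof.
elim: N c => [|N IH] c; first by rewrite /=; ring.
by rewrite [LHS]/= -/(psum (fun n => c n.+1) N.+1 u) IH /=; ring.
Qed.

Definition expcoef (n : nat) : C := RtoC (/ INR (Factorial.fact n)).

Lemma cderiv_pow n z : cderiv (fun u => u ^ n.+1) z (RtoC (INR n.+1) * z ^ n).
Proof.
elim: n => [|n IH].
  have -> : INR 1 * z ^ 0 = 1 by rewrite /=; ring.
  by apply: cderiv_ext (cderiv_id z) => u /=; ring.
have := cderiv_mult (cderiv_id z) IH.
have -> : 1 * z ^ n.+1 + id z * (INR n.+1 * z ^ n) = RtoC (INR n.+2) * z ^ n.+1.
  by rewrite (S_INR n.+1) RtoC_plus /=; ring.
exact: cderiv_ext.
Qed.

Lemma cderiv_psum_exp N z : cderiv (psum expcoef N.+1) z (psum expcoef N z).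
Proof.
elim: N => [|N IH].
  have := cderiv_const 1 z; apply: cderiv_ext => u /=.
  by rewrite /expcoef /= Rinv_1; ring.
rewrite psum_recr.
have -> : psum expcoef N z + expcoef N * z ^ N =
   psum expcoef N z + expcoef N.+1 * (RtoC (INR N.+1) * z ^ N).
  rewrite /expcoef fact_simpl mult_INR Cmult_assoc -RtoC_mult; congr (_ + RtoC _ * _).
  by field; split; [exact: INR_fact_neq_0|exact: not_0_INR].
apply: cderiv_ext (cderiv_plus IH (cderiv_scal (expcoef N.+1) (cderiv_pow N z))) => u.
by rewrite -psum_recr.
Qed.

(** The remainder of order N + 1 vanishes at 0 and has the remainder of order N as derivative, so
    the mean value inequality raises the order by one. The constant exp 1 bounds the exponential on
    the unit disc. *)
Lemma cexp_psum N z : (Cmod z <= 1)%R ->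
  (Cmod (cexp z - psum expcoef N z) <= exp 1 * Cmod z ^ N)%R.
Proof.
elim: N z => [|N IH] z z1.
  have -> : cexp z - psum expcoef 0 z = cexp z by rewrite /=; ring.
  rewrite Cmod_cexp /= Rmult_1_r; apply: Rnot_lt_le => /exp_lt_inv.
  by have := Rle_abs z.1; have := abs_fst_le z; lra.
pose f u := cexp u - psum expcoef N.+1 u.
have f0 : f 0 = 0.
  by rewrite /f cexp0 /= /expcoef /= Rinv_1; ring.
have := @cderiv_mvt f (fun t => cexp (0 + RtoC t * (z - 0)) - psum expcoef N (0 + RtoC t * (z - 0)))
  0 z (exp 1 * Cmod z ^ N)%R.
rewrite f0; have E (a : C) : a - 0 = a by ring.
rewrite !E -/(f z) => H; apply: Rle_trans (H _) _; last by rewrite /=; lra.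
move=> t Ht; split.
  exact: cderiv_minus (cderiv_cexp _) (cderiv_psum_exp _ _).
have mt : (Cmod (0 + t * z) <= Cmod z)%R.
  have -> : 0 + t * z = t * z by ring.
  rewrite Cmod_mult Cmod_R Rabs_right; last lra.
  by rewrite -{2}(Rmult_1_l (Cmod z)); apply: Rmult_le_compat_r; [exact: Cmod_ge_0|lra].
apply: Rle_trans (IH _ _) _; first lra.
apply: Rmult_le_compat_l; first exact/Rlt_le/exp_pos.
by apply: pow_incr; split; [exact: Cmod_ge_0|].
Qed.

Lemma tay_cexp_lin ze : tay (fun u => cexp (ze * u)) (fun n => ze ^ n * expcoef n).
Proof.
move=> N; set W := (Cmod ze + 1)%R; have := Cmod_ge_0 ze => m0.
exists (exp 1 * Cmod ze ^ N)%R, (/ W)%R; split; first by apply: Rinv_0_lt_compat; rewrite /W; lra.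
move=> u u0 ur; rewrite psum_geom.
have -> : (exp 1 * Cmod ze ^ N * Cmod u ^ N = exp 1 * Cmod (ze * u) ^ N)%R.
  by rewrite Cmod_mult Rpow_mult_distr; ring.
apply: cexp_psum; rewrite Cmod_mult.
have : (W * Cmod u <= W * / W)%R by apply: Rmult_le_compat_l; rewrite /W in ur *; lra.
rewrite Rinv_r; last by rewrite /W; lra.
by have := Cmod_ge_0 u; rewrite /W; lra.
Qed.

Lemma pow_n_Cpow (u : C) n : @pow_n C_Ring u n = u ^ n.
Proof. by elim: n => [|n IH] //=; rewrite IH. Qed.

Lemma sum_n_psum c u n :
  @sum_n C_AbelianMonoid (fun k => @scal C_Ring C_ModuleSpace (@pow_n C_Ring u k) (c k)) n = psum c n.+1 u.
Proof.
elim: n => [|n IH]; first by rewrite sum_O /scal /= /mult /= /one /=; ring.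
by rewrite sum_Sn IH (psum_recr _ n.+1) pow_n_Cpow /plus /scal /= /mult /=; ring.
Qed.

Lemma is_pseries_lim c u l : @is_pseries C_AbsRing C_NormedModule c u l ->
  forall eps : R, (0 < eps)%R -> exists N, forall n, (N <= n)%coq_nat ->
    (Cmod (psum c n u - l) < eps)%R.
Proof.
move=> H eps eps0.
have [|N HN] := H (fun z => Cmod (z - l) < eps)%R.
  apply: (@locally_le_locally_norm C_AbsRing C_NormedModule).
  by exists (mkposreal _ eps0) => y.
exists N.+1 => -[|n] Hn; first by lia.
by rewrite -sum_n_psum; apply: HN; lia.
Qed.

(** Convergence at the radius rho bounds |c n| rho^n; for |u| < rho / 2 a geometric series of ratio
    1 / 2 dominates the tail. *)
Lemma taylor_tay k c : taylor_at0 k c -> tay k c.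
Proof.
move=> [r H].
have r0 := cond_pos r; set rho := (r / 2)%R.
have rho0 : (0 < rho)%R by rewrite /rho; lra.
have mr : Cmod rho = rho by rewrite Cmod_R Rabs_right //; lra.
have rho1 : RtoC rho <> 0 by move=> [] ?; lra.
have [B0 HB0] := is_pseries_lim (H rho rho1 ltac:(rewrite mr /rho; lra)) Rlt_0_1.
have [K [K0 HK]] : exists K, (0 < K)%R /\ forall n, (Cmod (c n) * rho ^ n <= K)%R.
  have [K1 [K10 HK1]] : exists K, (0 < K)%R /\ forall n, (n < B0)%coq_nat -> (Cmod (c n) * rho ^ n <= K)%R.
    elim: (B0) => [|m [K [K0 HK]]]; first by exists 1%R; split; [lra|move=> n; lia].
    exists (K + Cmod (c m) * rho ^ m)%R.
    have P : (0 <= Cmod (c m) * rho ^ m)%R.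
      by apply: Rmult_le_pos; [exact: Cmod_ge_0|apply: pow_le; lra].
    split; first lra.
    move=> n nm; have [->|ne] := PeanoNat.Nat.eq_dec n m; first lra.
    by have := HK n ltac:(lia); lra.
  exists (K1 + 2)%R; split; first lra.
  (* From B0 on, two consecutive partial sums are within 1 of the limit, so the term between them is
     less than 2. *)
  move=> n; case: (Compare_dec.le_lt_dec B0 n) => [Bn|/HK1]; last lra.
  have A1 := HB0 n Bn; have A2 := HB0 n.+1 ltac:(lia).
  have -> : (Cmod (c n) * rho ^ n = Cmod (c n * RtoC rho ^ n))%R.
    by rewrite Cmod_mult Cmod_pow mr.
  have -> : c n * RtoC rho ^ n = (psum c n.+1 rho - k rho) - (psum c n rho - k rho).
    by rewrite psum_recr; ring.
  by apply: Rle_trans (Cmod_triangle _ _) _; rewrite Cmod_opp; lra.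
move=> N; exists (2 * K / rho ^ N)%R, (rho / 2)%R; split; first lra.
move=> u u0 ur.
have ur' : (Cmod u < r)%R by rewrite /rho in ur; lra.
have rN : (0 < rho ^ N)%R by apply: pow_lt.
set q := (Cmod u / rho)%R.
have q0 : (0 <= q)%R by apply: Rdiv_le_0_compat => //; apply: Cmod_ge_0.
have q1 : (q <= / 2)%R.
  apply: (Rmult_le_reg_r rho) => //; rewrite /q /Rdiv Rmult_assoc Rinv_l; lra.
have E : (Cmod u = q * rho)%R by rewrite /q; field; lra.
have -> : (2 * K / rho ^ N * Cmod u ^ N = 2 * K * q ^ N)%R.
  by rewrite E Rpow_mult_distr; field; apply: pow_nonzero; lra.
have term n : (Cmod (c n * u ^ n) <= K * q ^ n)%R.
  rewrite Cmod_mult Cmod_pow E Rpow_mult_distr.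
  have -> : (Cmod (c n) * (q ^ n * rho ^ n) = Cmod (c n) * rho ^ n * q ^ n)%R by ring.
  by apply: Rmult_le_compat_r (HK n); apply: pow_le.
have qN : (0 <= q ^ N)%R by apply: pow_le.
(* 2 - 2 (1 / 2)^j is the sum of the first j powers of 1 / 2. *)
have part j : (Cmod (psum c (N + j)%coq_nat u - psum c N u) <= K * q ^ N * (2 - 2 * (/ 2) ^ j))%R.
  elim: j => [|j IHj].
    have -> : psum c (N + 0)%coq_nat u - psum c N u = 0.
      by rewrite PeanoNat.Nat.add_0_r; ring.
    by rewrite Cmod_0 /=; lra.
  have -> : (N + j.+1)%coq_nat = (N + j)%coq_nat.+1 by lia.
  rewrite psum_recr.
  have -> : psum c (N + j)%coq_nat u + c (N + j)%coq_nat * u ^ (N + j)%coq_nat - psum c N u =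
    (psum c (N + j)%coq_nat u - psum c N u) + c (N + j)%coq_nat * u ^ (N + j)%coq_nat by ring.
  apply: Rle_trans (Cmod_triangle _ _) _.
  have T := term (N + j)%coq_nat; rewrite pow_add in T.
  have : (K * (q ^ N * q ^ j) <= K * q ^ N * (/ 2) ^ j)%R.
    rewrite -Rmult_assoc; apply: Rmult_le_compat_l; first by apply: Rmult_le_pos; lra.
    by apply: pow_incr; lra.
  by rewrite /=; lra.
apply: Rnot_lt_le => bad.
set d := (Cmod (k u - psum c N u) - 2 * K * q ^ N)%R in bad.
have d0 : (0 < d)%R by rewrite /d; lra.
have [N1 HN1] := is_pseries_lim (H u u0 ur') d0.
have A := HN1 (N + N1)%coq_nat ltac:(lia); have B := part N1.
have : (Cmod (k u - psum c N u) <= Cmod (psum c (N + N1)%coq_nat u - k u) + Cmod (psum c (N + N1)%coq_nat u - psum c N u))%R.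
  rewrite (Cmod_sub_sym _ (k u)); exact: Cmod_triangle3.
have : (0 <= K * q ^ N * (2 * (/ 2) ^ N1))%R.
  by apply: Rmult_le_pos; [apply: Rmult_le_pos; lra|have := pow_le (/ 2) N1; lra].
by rewrite /d in A; lra.
Qed.

(** * Uniqueness of theta *)

Definition lattice (tau z : C) : Prop :=
  exists m n : Z, z = RtoC (IZR m) + RtoC (IZR n) * tau.

(** u times the Kronecker function theta(z + u) / (theta(z) theta(u)). At u = ad x, applied to y, it
    is up to sign the coefficient in the equation for F. *)
Definition kernel (phi : C -> C) (z u : C) : C := phi (z + u) * u / (phi z * phi u).

(** Properties of theta at one fixed tau that are stable under the modular transformations;
    [tl_kernel] takes the place of analyticity. *)
Record theta_like (phi : C -> C) (tau : C) : Prop := ThetaLike {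
  tl_diff : forall z, exists l, cderiv phi z l;
  tl_add1 : forall z, phi (z + 1) = - phi z;
  tl_addtau : forall z, phi (z + tau) = - cexp (- (twopii * z) - RtoC PI * Ci * tau) * phi z;
  tl_zeros : forall z, phi z = 0 <-> lattice tau z;
  tl_derive0 : cderiv phi 0 1;
  tl_kernel : forall z, phi z <> 0 -> exists c, tay (kernel phi z) c
}.

Lemma lattice_coords (tau z : C) : upper_half_plane tau ->
  exists a b : R, z = RtoC a + RtoC b * tau.
Proof.
move=> tau0; have t0 : (0 < snd tau)%R by [].
exists (fst z - snd z / snd tau * fst tau)%R, (snd z / snd tau)%R.
by case: z tau t0 {tau0} => x y [p q] /= q0; rewrite /Cplus /Cmult /=; congr pair; field; lra.
Qed.

(** Off the lattice, one of the two fractional parts is nonzero, which puts the reduced point in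
    [F_domain]. *)
Lemma lattice_reduce (tau z : C) : upper_half_plane tau ->
  exists (a b : R) (m n : Z), [/\ (0 <= a < 1)%R, (0 <= b < 1)%R,
    z = RtoC a + RtoC b * tau + (RtoC (IZR m) + RtoC (IZR n) * tau) &
    lattice tau z \/ F_domain tau (RtoC a + RtoC b * tau)].
Proof.
move=> /(lattice_coords z) [a [b zE]].
have [a1 a2] := base_Int_part a; have [b1 b2] := base_Int_part b.
set m := Int_part a in a1 a2; set n := Int_part b in b1 b2.
exists (a - IZR m)%R, (b - IZR n)%R, m, n; split; try lra.
  by rewrite zE !RtoC_minus; ring.
have [a0|a0] := Req_dec a (IZR m); last first.
  by right; exists (a - IZR m)%R, (b - IZR n)%R; split=> //; left; lra.
have [b0|b0] := Req_dec b (IZR n); last first.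
  by right; exists (a - IZR m)%R, (b - IZR n)%R; split=> //; right; lra.
by left; exists m, n; rewrite zE -a0 -b0.
Qed.

Lemma Zshift_iff (P : C -> Prop) (w : C) : (forall z, P z <-> P (z + w)) ->
  forall (n : Z) z, P z <-> P (z + RtoC (IZR n) * w).
Proof.
move=> H; elim/Z.peano_ind => [z|n IH z|n IH z].
- by have -> : z + 0 * w = z by ring.
- rewrite succ_IZR RtoC_plus (IH z) H.
  by have -> : z + RtoC (IZR n) * w + w = z + (RtoC (IZR n) + 1) * w by ring.
- rewrite -Z.sub_1_r minus_IZR RtoC_minus (IH z) (H (z + (RtoC (IZR n) - 1) * w)).
  by have -> : z + (RtoC (IZR n) - 1) * w + w = z + RtoC (IZR n) * w by ring.
Qed.

Lemma lattice_shift_iff (P : C -> Prop) (tau : C) :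
  (forall z, P z <-> P (z + 1)) -> (forall z, P z <-> P (z + tau)) ->
  forall l z, lattice tau l -> (P z <-> P (z + l)).
Proof.
move=> H1 Ht l z [m [n ->]].
rewrite (Zshift_iff H1 m) (Zshift_iff Ht n).
by have -> : z + IZR m * 1 + IZR n * tau = z + (IZR m + IZR n * tau) by ring.
Qed.

Lemma lattice_shift_eq (T : Type) (f : C -> T) (tau : C) :
  (forall z, f (z + 1) = f z) -> (forall z, f (z + tau) = f z) ->
  forall l z, lattice tau l -> f (z + l) = f z.
Proof.
move=> H1 Ht l z ll.
by apply/(@lattice_shift_iff (fun w => f w = f z) tau _ _ l z ll) => // w; rewrite ?H1 ?Ht.
Qed.

(** Facts about theta that are available on [F_domain] only, such as the expansions in [F_ode],
    extend in this way to the whole plane. *)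
Lemma lattice_shift_ind (P : C -> Prop) (tau : C) : upper_half_plane tau ->
  (forall z, P z <-> P (z + 1)) -> (forall z, P z <-> P (z + tau)) ->
  (forall z, lattice tau z -> P z) -> (forall z, F_domain tau z -> P z) ->
  forall z, P z.
Proof.
move=> t0 H1 Ht HL HF z.
have [a [b [m [n [_ _ zE [/HL //|Fz]]]]]] := lattice_reduce z t0.
by rewrite zE -(@lattice_shift_iff P tau) //; [exact: HF|exists m, n].
Qed.

Lemma lattice0 tau : lattice tau 0.
Proof. by exists Z0, Z0; ring. Qed.

Lemma deriv1_near (phi : C -> C) : phi 0 = 0 -> cderiv phi 0 1 ->
  exists2 d : R, (0 < d)%R & forall u : C, u <> 0 -> (Cmod u < d)%R ->
    phi u <> 0 /\ (Cmod (phi u) <= 2 * Cmod u)%R.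
Proof.
move=> p0 H; have [d d0 Hd] := H (/ 2)%R ltac:(lra).
exists d => // u u0 ud; have E (v : C) : v - 0 = v by ring.
have := Hd u; rewrite p0 !E Cmult_1_l => /(_ ud) K.
have m0 : (0 < Cmod u)%R by apply/Cmod_gt_0.
split.
  move=> pu; move: K; rewrite pu.
  have -> : 0 - u = - u by ring.
  by rewrite Cmod_opp; lra.
by have := Cmod_rev_triangle (phi u) u; lra.
Qed.

Lemma bigO_deriv (D : C -> C) l : D 0 = 0 -> cderiv D 0 l -> bigO 2 D -> l = 0.
Proof.
move=> D0 HD [M [r [r0 H]]]; apply: contrapT => l0.
have m0 : (0 < Cmod l)%R by apply/Cmod_gt_0.
have [d d0 Hd] := HD (Cmod l / 2)%R ltac:(lra).
set W := (Rabs M + 1)%R; have W0 : (0 < W)%R by rewrite /W; have := Rabs_pos M; lra.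
have lW : (0 < Cmod l / 2 / W)%R by apply: Rdiv_lt_0_compat; lra.
set m := Rmin (Rmin r d) (Cmod l / 2 / W).
have m1 := Rmin_l (Rmin r d) (Cmod l / 2 / W); have m2 := Rmin_r (Rmin r d) (Cmod l / 2 / W).
have m3 := Rmin_l r d; have m4 := Rmin_r r d; rewrite -/m in m1 m2.
have mp : (0 < m)%R by repeat apply: Rmin_pos.
set s := (m / 2)%R; have s0 : (0 < s)%R by rewrite /s; lra.
have sm : (s < m)%R by rewrite /s; lra.
have ms : Cmod s = s by rewrite Cmod_R Rabs_right //; lra.
have E (v : C) : v - 0 = v by ring.
have := Hd s; rewrite D0 !E ms => /(_ ltac:(lra)) A.
have := H s ltac:(by move=> [] ?; lra) ltac:(lra); rewrite ms => B.
have : (Cmod (l * s) <= Cmod (D s) + Cmod (D s - l * s))%R.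
  have E2 : l * s = D s - (D s - l * s) by ring.
  by rewrite {1}E2; apply: Rle_trans (Cmod_triangle _ _) _; rewrite Cmod_opp; lra.
rewrite Cmod_mult ms.
have : (M * s ^ 2 <= W * s * s)%R.
  have -> : (W * s * s = W * s ^ 2)%R by ring.
  by apply: Rmult_le_compat_r; [exact: pow2_ge_0|rewrite /W; have := Rle_abs M; lra].
have : (W * s * s < Cmod l / 2 * s)%R.
  apply: Rmult_lt_compat_r => //.
  have -> : (Cmod l / 2 = W * (Cmod l / 2 / W))%R by field; lra.
  by apply: Rmult_lt_compat_l; lra.
lra.
Qed.

Lemma kernel_coef0 (phi : C -> C) (z : C) (c : nat -> C) : phi 0 = 0 -> cderiv phi 0 1 -> phi z <> 0 ->
  (exists l, cderiv phi z l) -> tay (kernel phi z) c -> c 0%N = 1.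
Proof.
move=> p0 p1 pz [l Hl] T; have [d d0 Hd] := deriv1_near p0 p1.
have B1 : bigO 1 phi by exists 2%R, d; split=> // u u0 /(Hd u u0) []; rewrite pow_1.
(* Near 0, [D u] is - phi(z) phi(u) times the difference of the kernel and c 0, a product of two
   O(u) terms; so its derivative at 0, which is c 0 phi(z) - phi(z), vanishes. *)
pose D u := c 0%N * phi z * phi u - phi (z + u) * u.
have D2 : bigO 2 D.
  apply: bigO_ext_loc (bigO_mult (bigO_scal (- phi z) (tay_coef0 T)) B1); first exact: d0.
  move=> u u0 ud; have [pu _] := Hd u u0 ud.
  by rewrite /D /kernel; field; split.
have DD : cderiv D 0 (c 0%N * phi z - phi z).
  have H1 := cderiv_scal (c 0%N * phi z) p1.
  have H2 : cderiv (fun u => phi (z + u)) 0 l.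
    have := @cderiv_comp_affine phi 1 z 0 l.
    have -> : 1 * 0 + z = z by ring.
    move=> /(_ Hl); rewrite Cmult_1_l; apply: cderiv_ext => u.
    by congr phi; ring.
  have H3 := cderiv_minus H1 (cderiv_mult H2 (cderiv_id 0)).
  have E : c 0%N * phi z * 1 - (l * id 0 + phi (z + 0) * 1) = c 0%N * phi z - phi z.
    have -> : z + 0 = z by ring.
    by rewrite /id /=; ring.
  by rewrite E in H3; apply: cderiv_ext H3.
have D00 : D 0 = 0 by rewrite /D p0; ring.
have E := bigO_deriv D00 DD D2.
have -> : c 0%N = (c 0%N * phi z - phi z + phi z) / phi z by field.
by rewrite E; field.
Qed.

Lemma Cinv0 : / 0 = 0 :> C.
Proof. by rewrite /Cinv /=; congr pair; rewrite /Rdiv ?Ropp_0 Rmult_0_l. Qed.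

(** Where no factor vanishes, this is the sum of ln |kernel phi z u| over u = s, i s, -s, -i s. The
    part that involves phi(u) and s alone is the same for all z. *)
Definition kersum (phi : C -> C) (z : C) (s : R) : R :=
  (fourpt (fun u => ln (Cmod (phi u))) z s
   - (ln (Cmod (phi s)) + ln (Cmod (phi (Ci * s)%C)) + ln (Cmod (phi (- s)%C))
     + ln (Cmod (phi (- (Ci * s))%C)) - 4 * ln s))%R.

Lemma kersum_small phi tau z : theta_like phi tau -> phi z <> 0 ->
  exists M r : R, (0 < r)%R /\ forall s, (0 < s < r)%R -> (Rabs (kersum phi z s) <= M * s ^ 3)%R.
Proof.
move=> H pz; have p0 : phi 0 = 0 by apply/(tl_zeros H)/lattice0.
have [c T] := tl_kernel H pz.
have c1 := kernel_coef0 p0 (tl_derive0 H) pz (tl_diff H z) T.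
have [M [r [r0 B]]] := T 3%N.
have [||M' [r' [r'0 K]]] := @ln_fourpt (kernel phi z) 1 (c 1%N) (c 2%N) M r _ r0.
- by move=> []; lra.
- move=> u u0 ur; have := B u u0 ur; rewrite /= c1.
  by congr (Rle (Cmod _) _); ring.
exists M', r'; split=> // s sr; have [n1 n2 n3 n4] := K s sr.
congr (Rle (Rabs _) _); rewrite Cmod_1 ln_1 Rmult_0_r Rminus_0_r.
have ms : Cmod s = s by rewrite Cmod_R Rabs_right //; lra.
have mis : Cmod (Ci * s) = s by rewrite Cmod_mult Cmod_Ci ms Rmult_1_l.
have L (u : C) : Cmod u = s -> kernel phi z u <> 0 -> ln (Cmod (kernel phi z u)) =
    (ln (Cmod (phi (z + u)%C)) + ln s - (ln (Cmod (phi z)) + ln (Cmod (phi u))))%R.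
  move=> us; rewrite /kernel => k0.
  have u0 : u <> 0 by apply/Cmod_gt_0; lra.
  (* A zero of phi at u would make the kernel 0, by the convention 1 / 0 = 0. *)
  have pu : phi u <> 0 by move=> pu; apply: k0; rewrite pu Cmult_0_r /Cdiv Cinv0; ring.
  have pzu : phi (z + u) <> 0 by move=> pzu; apply: k0; rewrite pzu /Cdiv; ring.
  have pp := Cmult_neq_0 _ _ pz pu.
  rewrite Cmod_div // ln_div; last first.
  - by apply/Cmod_gt_0.
  - by apply/Cmod_gt_0/Cmult_neq_0.
  by rewrite !ln_Cmod_mult // us.
rewrite !L ?Cmod_opp //.
rewrite /kersum /fourpt /Cminus; ring.
Qed.

Lemma Copp_opp (z : C) : - - z = z.
Proof. ring. Qed.

Lemma ccont_neq0 f z : ccont f z -> f z <> 0 ->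
  exists2 d : R, (0 < d)%R & forall z', (Cmod (z' - z) < d)%R -> f z' <> 0.
Proof.
move=> Hf /Cmod_gt_0 z0; have [d d0 Hd] := Hf _ z0; exists d => // z' /Hd K E.
by move: K; rewrite E Cmod_sub_sym; have -> : f z - 0 = f z by [ring]; lra.
Qed.

Lemma cderiv_inv (z : C) : z <> 0 -> cderiv Cinv z (- / (z * z)).
Proof.
move=> z0 eps eps0; have m0 : (0 < Cmod z)%R by apply/Cmod_gt_0.
set W := (2 / (Cmod z ^ 3))%R.
have z3 : (0 < Cmod z ^ 3)%R by apply: pow_lt.
have W0 : (0 < W)%R by apply: Rdiv_lt_0_compat; lra.
have eW : (0 < eps / W)%R by apply: Rdiv_lt_0_compat.
exists (Rmin (Cmod z / 2) (eps / W)); first by apply: Rmin_pos; lra.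
move=> z' Hz'; have m1 := Rmin_l (Cmod z / 2) (eps / W); have m2 := Rmin_r (Cmod z / 2) (eps / W).
have zz : (Cmod z / 2 <= Cmod z')%R by have := Cmod_rev_triangle z z'; rewrite Cmod_sub_sym; lra.
have z'0 : z' <> 0 by apply/Cmod_gt_0; lra.
have -> : / z' - / z - - / (z * z) * (z' - z) = (z' - z) * (z' - z) * / (z * z * z').
  by field; split.
have n3 : z * z * z' <> 0 by do ?apply: Cmult_neq_0.
rewrite !Cmod_mult Cmod_inv // !Cmod_mult.
set h := Cmod (z' - z) in Hz' *; have h0 : (0 <= h)%R := Cmod_ge_0 _.
have -> : (h * h * / (Cmod z * Cmod z * Cmod z') = h * / (Cmod z * Cmod z * Cmod z') * h)%R by ring.
apply: Rmult_le_compat_r => //.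
have A : (/ (Cmod z * Cmod z * Cmod z') <= W)%R.
  have -> : W = (/ (Cmod z * Cmod z * (Cmod z / 2)))%R by rewrite /W; field; lra.
  apply: Rinv_le_contravar; first by do ?apply: Rmult_lt_0_compat; lra.
  by apply: Rmult_le_compat_l => //; apply: Rmult_le_pos; lra.
apply: (@Rle_trans _ (eps / W * W)%R); last by right; field; lra.
apply: Rmult_le_compat => //; last lra.
by apply/Rlt_le/Rinv_0_lt_compat; do ?apply: Rmult_lt_0_compat; lra.
Qed.

(* If l <> 0, moving in the direction conj(l) f(z) increases |f| to first
   order. *)
Lemma cderiv_unimod f z l : (exists2 d : R, (0 < d)%R & forall z', (Cmod (z' - z) < d)%R -> Cmod (f z') = 1%R) ->
  cderiv f z l -> l = 0.
Proof.
move=> [d d0 Hd] Hf; apply: contrapT => l0.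
have m0 : (0 < Cmod l)%R by apply/Cmod_gt_0.
have [d1 d10 Hd1] := Hf (Cmod l / 2)%R ltac:(lra).
set s := (Rmin d d1 * Cmod l / 2)%R.
have dm := Rmin_pos _ _ d0 d10; have m1 := Rmin_l d d1; have m2 := Rmin_r d d1.
have s0 : (0 < s)%R by rewrite /s; have := Rmult_lt_0_compat _ _ dm m0; lra.
have f1 : Cmod (f z) = 1%R by apply: Hd; have -> : z - z = 0 by [ring]; rewrite Cmod_0.
set h := RtoC s * f z / l.
have mh : Cmod h = (Rmin d d1 / 2)%R.
  rewrite /h Cmod_div // Cmod_mult f1 Cmod_R Rabs_right; last lra.
  by rewrite /s; field; lra.
have E : z + h - z = h by ring.
have := Hd (z + h); rewrite E mh => /(_ ltac:(lra)) g1.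
have := Hd1 (z + h); rewrite E mh => /(_ ltac:(lra)).
have -> : f (z + h) - f z - l * h = f (z + h) - RtoC (1 + s) * f z.
  by rewrite /h RtoC_plus; field.
rewrite Cmod_sub_sym; have := Cmod_rev_triangle (RtoC (1 + s) * f z) (f (z + h)).
rewrite Cmod_mult f1 g1 Cmod_R Rabs_right; last lra.
have -> : (Cmod l / 2 * (Rmin d d1 / 2) = s / 2)%R by rewrite /s; field.
lra.
Qed.

Lemma coords_inj (tau : C) (a b a' b' : R) : upper_half_plane tau ->
  RtoC a + RtoC b * tau = RtoC a' + RtoC b' * tau -> a = a' /\ b = b'.
Proof.
case: tau => x y; rewrite /upper_half_plane /Im /= => y0 [] E1 E2.
have E3 : (b * y = b' * y)%R by lra.
have E4 : b = b' by apply: (Rmult_eq_reg_r y) => //; lra.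
by rewrite E4 in E1 *; split; lra.
Qed.

Lemma F_domain_lattice tau z : upper_half_plane tau -> F_domain tau z -> ~ lattice tau z.
Proof.
move=> t0 [a [b [-> ab]]] [m [n /(coords_inj t0) [am bn]]].
have P (k : Z) : ~ (0 < IZR k < 1)%R.
  by move=> [/lt_IZR k0 /(lt_IZR _ 1)]; lia.
by case: ab; rewrite ?am ?bn => /P.
Qed.

Section ThetaUnique.
Variables (phi psi : C -> C) (tau : C).
Hypotheses (tau0 : upper_half_plane tau) (Hphi : theta_like phi tau) (Hpsi : theta_like psi tau).

(* At the lattice points both terms are the same junk value [ln 0], so L
   vanishes there. *)
Let L (z : C) : R := (ln (Cmod (phi z)) - ln (Cmod (psi z)))%R.

Lemma theta_like_zeros z : phi z = 0 <-> psi z = 0.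
Proof. by rewrite (tl_zeros Hphi) (tl_zeros Hpsi). Qed.

Let L_zero z : lattice tau z -> L z = 0%R.
Proof.
move=> lz; have /(tl_zeros Hphi) p := lz; have /(tl_zeros Hpsi) q := lz.
by rewrite /L p q Rminus_diag.
Qed.

Let L_add1 z : L (z + 1) = L z.
Proof. by rewrite /L (tl_add1 Hphi) (tl_add1 Hpsi) !Cmod_opp. Qed.

Let L_addtau z : L (z + tau) = L z.
Proof.
have [p0|p0] := EM (phi z = 0).
  have /theta_like_zeros q0 := p0.
  by rewrite /L (tl_addtau Hphi) (tl_addtau Hpsi) p0 q0 !Cmult_0_r !Rminus_diag.
have q0 : psi z <> 0 by move/theta_like_zeros.
have e0 : - cexp (- (twopii * z) - PI * Ci * tau) <> 0.
  by apply/Cmod_gt_0; rewrite Cmod_opp; apply/Cmod_gt_0/cexp_neq0.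
by rewrite /L (tl_addtau Hphi) (tl_addtau Hpsi) !ln_Cmod_mult //; ring.
Qed.

Let L_lattice l z : lattice tau l -> L (z + l) = L z.
Proof. exact: lattice_shift_eq L_add1 L_addtau l z. Qed.

Lemma rcont_Cmod_comp f z : ccont f z -> rcont (fun u => Cmod (f u)) z.
Proof.
move=> Hf eps /Hf [d d0 Hd]; exists d => // z' /Hd H.
have := Cmod_rev_triangle (f z') (f z); have := Cmod_rev_triangle (f z) (f z').
rewrite (Cmod_sub_sym (f z) (f z')) => ? ?; apply: Rabs_def1; lra.
Qed.

Lemma rcont_ln_comp f z : ccont f z -> f z <> 0 -> rcont (fun u => ln (Cmod (f u))) z.
Proof.
move=> Hf /Cmod_gt_0 z0; apply: rcont_comp (rcont_Cmod_comp Hf).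
by apply: derivable_continuous_pt; exists (/ Cmod (f z))%R; apply: derivable_pt_lim_ln.
Qed.

(** f(u) / u tends to 1. Applied to phi and psi, this makes L tend to 0 at the lattice points and so
    matches its default value there. *)
Lemma ln_deriv1 (f : C -> C) : f 0 = 0 -> cderiv f 0 1 -> forall eps : R, (0 < eps)%R ->
  exists2 d : R, (0 < d)%R & forall u : C, u <> 0 -> (Cmod u < d)%R ->
  (Rabs (ln (Cmod (f u)) - ln (Cmod u)) <= eps)%R.
Proof.
move=> f0 Hf eps eps0; set e := Rmin (/ 2) (eps / 2).
have e0 : (0 < e)%R by apply: Rmin_pos; lra.
have e1 := Rmin_l (/ 2) (eps / 2); have e2 := Rmin_r (/ 2) (eps / 2); rewrite -/e in e1 e2.
have [d d0 Hd] := Hf e e0; have [d1 d10 Hd1] := deriv1_near f0 Hf.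
exists (Rmin d d1); first exact: Rmin_pos.
move=> u u0 ud; have m1 := Rmin_l d d1; have m2 := Rmin_r d d1.
have [fu _] := Hd1 u u0 ltac:(lra).
have E (v : C) : v - 0 = v by ring.
have := Hd u; rewrite f0 !E Cmult_1_l => /(_ ltac:(lra)) K.
have u1 : (0 < Cmod u)%R by apply/Cmod_gt_0.
have fu1 : (0 < Cmod (f u))%R by apply/Cmod_gt_0.
rewrite -ln_div //.
have Q : (Rabs (Cmod (f u) / Cmod u - 1) <= e)%R.
  have -> : (Cmod (f u) / Cmod u - 1 = (Cmod (f u) - Cmod u) / Cmod u)%R by field; lra.
  rewrite Rabs_div; last lra.
  rewrite (Rabs_right (Cmod u)); last lra.
  apply: (Rmult_le_reg_r (Cmod u)) => //.
  rewrite /Rdiv Rmult_assoc Rinv_l ?Rmult_1_r; last lra.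
  apply: Rle_trans K.
  have := Cmod_rev_triangle (f u) u; have := Cmod_rev_triangle u (f u).
  by rewrite (Cmod_sub_sym u) => ? ?; apply: Rabs_le; lra.
by apply: Rle_trans (ln_near1 _) _; lra.
Qed.

Let phi0 : phi 0 = 0. Proof. by apply/(tl_zeros Hphi)/lattice0. Qed.
Let psi0 : psi 0 = 0. Proof. by apply/(tl_zeros Hpsi)/lattice0. Qed.
Let L0 : L 0 = 0%R. Proof. by apply: L_zero; apply: lattice0. Qed.

Let L_cont z : rcont L z.
Proof.
have cphi : ccont phi z by have [l Hl] := tl_diff Hphi z; exact: cderiv_ccont Hl.
have cpsi : ccont psi z by have [l Hl] := tl_diff Hpsi z; exact: cderiv_ccont Hl.
have [p0|p0] := EM (phi z = 0); last first.
  have q0 : psi z <> 0 by move/theta_like_zeros.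
  have := rcont_plus (rcont_ln_comp cphi p0) (rcont_scal (-1) (rcont_ln_comp cpsi q0)).
  move=> H eps /H [d d0 Hd]; exists d => // z' /Hd; congr (Rlt (Rabs _) _).
  by rewrite /L; ring.
have lz : lattice tau z by apply/(tl_zeros Hphi).
move=> eps eps0; have e3 : (0 < eps / 3)%R by lra.
have [d1 d10 H1] := ln_deriv1 phi0 (tl_derive0 Hphi) e3.
have [d2 d20 H2] := ln_deriv1 psi0 (tl_derive0 Hpsi) e3.
exists (Rmin d1 d2); first exact: Rmin_pos.
move=> z' Hz'; have m1 := Rmin_l d1 d2; have m2 := Rmin_r d1 d2.
rewrite (L_zero lz) Rminus_0_r.
have -> : L z' = L (z' - z) by rewrite -(L_lattice (z' - z) lz); congr L; ring.
have [->|u0] := EM (z' - z = 0); first by rewrite L0 Rabs_R0.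
have {}H1 := H1 _ u0 ltac:(lra); have {}H2 := H2 _ u0 ltac:(lra).
rewrite /L; move/Rabs_le_between: H1 => H1; move/Rabs_le_between: H2 => H2.
by apply: Rabs_def1; lra.
Qed.

Let L_bounded : exists B : R, forall z, (Rabs (L z) <= B)%R.
Proof.
pose S (z : C) := exists a b : R, [/\ (0 <= a < 1)%R, (0 <= b < 1)%R & z = RtoC a + RtoC b * tau].
have SK z : S z -> (Cmod z <= 1 + Cmod tau)%R.
  move=> [a [b [a1 b1 ->]]]; apply: Rle_trans (Cmod_triangle _ _) _.
  rewrite Cmod_mult !Cmod_R !Rabs_right; try lra.
  have : (b * Cmod tau <= 1 * Cmod tau)%R by apply: Rmult_le_compat_r; [exact: Cmod_ge_0|lra].
  lra.
have [B1 HB1] := compact_bounded SK L_cont.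
have [B2 HB2] := compact_bounded SK (fun z => rcont_scal (-1) (L_cont z)).
exists (Rmax B1 B2) => z.
have [a [b [m [n [a1 b1 -> _]]]]] := lattice_reduce z tau0.
rewrite L_lattice; last by exists m, n.
have Sz : S (RtoC a + RtoC b * tau) by exists a, b.
have := HB1 _ Sz; have := HB2 _ Sz; have := Rmax_l B1 B2; have := Rmax_r B1 B2.
by move=> ? ? ? ?; apply: Rabs_le; lra.
Qed.

(** Off the lattice the difference is that of the two kernel sums: as L 0 = 0, their parts
    independent of z differ by exactly [fourpt L 0 s]. At lattice points it is 0 by periodicity. *)
Let L_fourpt z : exists M r : R, (0 < r)%R /\ forall s, (0 < s < r)%R ->
  (Rabs (fourpt L z s - fourpt L 0 s) <= M * s ^ 3)%R.
Proof.
have [p0|p0] := EM (phi z = 0).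
  exists 0%R, 1%R; split=> [|s _]; first lra.
  have lz : lattice tau z by apply/(tl_zeros Hphi).
  have E u : L (z + u) = L (0 + u).
    by rewrite -(L_lattice (0 + u) lz); congr L; ring.
  have -> : (fourpt L z s - fourpt L 0 s = 0)%R.
    by rewrite /fourpt /Cminus !E (L_zero lz) L0; ring.
  by rewrite Rabs_R0; lra.
have q0 : psi z <> 0 by move/theta_like_zeros.
have [M1 [r1 [r10 H1]]] := kersum_small Hphi p0.
have [M2 [r2 [r20 H2]]] := kersum_small Hpsi q0.
exists (M1 + M2)%R, (Rmin r1 r2); split; first exact: Rmin_pos.
move=> s sr; have m1 := Rmin_l r1 r2; have m2 := Rmin_r r1 r2.
have {}H1 := H1 s ltac:(lra); have {}H2 := H2 s ltac:(lra).
have -> : (fourpt L z s - fourpt L 0 s = kersum phi z s - kersum psi z s)%R.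
  rewrite /kersum /fourpt L0 /L /Cminus !Cplus_0_l; ring.
move/Rabs_le_between: H1 => H1; move/Rabs_le_between: H2 => H2.
by apply: Rabs_le; lra.
Qed.

Let L_additive z w : L (z + w) = (L z + L w)%R.
Proof.
have [B HB] := L_bounded.
pose h z := (L (z + w) - L z)%R.
have : h z = h 0.
  apply: (@bounded_flat4_const h (2 * B)) => [u|u eps eps0|u].
  - have := HB (u + w); have := HB u => /Rabs_le_between ? /Rabs_le_between ?.
    by apply: Rabs_le; rewrite /h; lra.
  - have [d1 d10 H1] := @L_cont (u + w) (eps / 2)%R ltac:(lra).
    have [d2 d20 H2] := @L_cont u (eps / 2)%R ltac:(lra).
    exists (Rmin d1 d2); first exact: Rmin_pos.
    move=> u' Hu'; have m1 := Rmin_l d1 d2; have m2 := Rmin_r d1 d2.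
    have {}H2 := H2 u' ltac:(lra); have := H1 (u' + w).
    have -> : u' + w - (u + w) = u' - u by ring.
    move=> /(_ ltac:(lra)) /Rabs_def2 ?; move/Rabs_def2: H2 => ?.
    by rewrite /h; apply: Rabs_def1; lra.
  - have [M1 [r1 [r10 H1]]] := L_fourpt (u + w).
    have [M2 [r2 [r20 H2]]] := L_fourpt u.
    exists (M1 + M2)%R, (Rmin r1 r2); split; first exact: Rmin_pos.
    move=> s sr; have m1 := Rmin_l r1 r2; have m2 := Rmin_r r1 r2.
    have {}H1 := H1 s ltac:(lra); have {}H2 := H2 s ltac:(lra).
    have -> : (fourpt h u s = (fourpt L (u + w) s - fourpt L 0 s) - (fourpt L u s - fourpt L 0 s))%R.
      have E v : u + v + w = u + w + v by ring.
      by rewrite /fourpt /h /Cminus !E; ring.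
    move/Rabs_le_between: H1 => H1; move/Rabs_le_between: H2 => H2.
    by apply: Rabs_le; lra.
by rewrite /h Cplus_0_l L0; lra.
Qed.

Let L_eq0 z : L z = 0%R.
Proof.
have [B HB] := L_bounded.
have Ln n : L (RtoC (INR n) * z) = (INR n * L z)%R.
  elim: n => [|n IH]; first by rewrite /= Cmult_0_l L0; ring.
  rewrite S_INR RtoC_plus.
  have -> : (RtoC (INR n) + 1) * z = RtoC (INR n) * z + z by ring.
  by rewrite L_additive IH; ring.
apply: contrapT => Lz0; have p := Rabs_pos_lt _ Lz0.
have [n Hn] := INR_unbounded (B / Rabs (L z)).
have := HB (RtoC (INR n) * z); rewrite Ln Rabs_mult Rabs_right; last exact/Rle_ge/pos_INR.
have -> : (B = B / Rabs (L z) * Rabs (L z))%R by field; lra.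
have := Rmult_lt_compat_r _ _ _ p Hn; lra.
Qed.

Let mod_eq z : Cmod (phi z) = Cmod (psi z).
Proof.
have [p0|p0] := EM (phi z = 0).
  by have /theta_like_zeros q0 := p0; rewrite p0 q0.
have q0 : psi z <> 0 by move/theta_like_zeros.
by apply: ln_inv; [exact/Cmod_gt_0|exact/Cmod_gt_0|have := L_eq0 z; rewrite /L; lra].
Qed.

Let ratio_deriv0 z : phi z <> 0 -> cderiv (fun u => phi u * / psi u) z 0.
Proof.
move=> p0; have q0 : psi z <> 0 by move/theta_like_zeros.
have [l Hl] := tl_diff Hphi z; have [m Hm] := tl_diff Hpsi z.
have H := cderiv_mult Hl (cderiv_comp (cderiv_inv q0) Hm).
suff E : l * / psi z + phi z * (- / (psi z * psi z) * m) = 0 by rewrite E in H.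
apply: (cderiv_unimod _ H); have [d d0 Hd] := ccont_neq0 (cderiv_ccont Hm) q0.
exists d => // z' /Hd q; rewrite Cmod_mult Cmod_inv // mod_eq Rinv_r //.
by have /Cmod_gt_0 := q; lra.
Qed.

Let phi_F z : F_domain tau z -> phi z = psi z.
Proof.
move=> [a [b [zE ab]]].
(* The coordinate of z in ]0, 1[ stays there after scaling by t, so ]0, z] avoids the lattice and
   phi / psi is constant on it. *)
have zt (t : R) : (0 < t <= 1)%R -> phi (RtoC t * z) <> 0.
  move=> t1 /(tl_zeros Hphi); apply: (@F_domain_lattice tau) => //.
  exists (t * a)%R, (t * b)%R; split; first by rewrite zE !RtoC_mult; ring.
  have P (x : R) : (0 < x < 1 -> 0 < t * x < 1)%R.
    move=> x01; split; first by apply: Rmult_lt_0_compat; lra.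
    by have : (t * x <= 1 * x)%R by [apply: Rmult_le_compat_r; lra]; lra.
  by case: ab => /P; auto.
have p1 : phi z <> 0 by have := zt 1%R; rewrite Cmult_1_l; apply; lra.
have q1 : psi z <> 0 by move/theta_like_zeros.
set c := phi z * / psi z.
have Hc (t : R) : (0 < t <= 1)%R -> phi (RtoC t * z) = c * psi (RtoC t * z).
  move=> t1; have E : phi (RtoC t * z) * / psi (RtoC t * z) = c.
    rewrite /c; apply/esym; apply: (@cderiv_zero (fun u => phi u * / psi u)) => s s1.
    apply: ratio_deriv0.
    have -> : RtoC t * z + s * (z - RtoC t * z) = RtoC (t + s * (1 - t)) * z.
      by rewrite RtoC_plus RtoC_mult RtoC_minus; ring.
    apply: zt; have : (0 <= s * (1 - t))%R by apply: Rmult_le_pos; lra.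
    have : (s * (1 - t) <= 1 * (1 - t))%R by apply: Rmult_le_compat_r; lra.
    lra.
  rewrite -E; field; move/theta_like_zeros; exact: zt.
suff c1 : c = 1 by have := Hc 1%R ltac:(lra); rewrite c1 !Cmult_1_l.
(* phi - c psi vanishes on ]0, z], while its derivative at 0 is 1 - c. *)
have HD := cderiv_minus (tl_derive0 Hphi) (cderiv_scal c (tl_derive0 Hpsi)).
apply: contrapT => cn1.
have k0 : (0 < Cmod (1 - c * 1))%R.
  apply/Cmod_gt_0 => E; apply: cn1.
  have -> : c = 1 - (1 - c * 1) by ring.
  by rewrite E; ring.
have [d d0 Hd] := HD (Cmod (1 - c * 1) / 2)%R ltac:(lra).
have z0 : (0 < Cmod z)%R by apply/Cmod_gt_0 => E; apply: p1; rewrite E.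
set t := Rmin 1 (d / Cmod z / 2).
have dz : (0 < d / Cmod z / 2)%R by have := Rdiv_lt_0_compat _ _ d0 z0; lra.
have t0 : (0 < t)%R by apply: Rmin_pos; lra.
have t1 : (t <= 1)%R by exact: Rmin_l.
have mt : Cmod (RtoC t * z) = (t * Cmod z)%R.
  by rewrite Cmod_mult Cmod_R Rabs_right //; lra.
have td : (t * Cmod z < d)%R.
  have : (t * Cmod z <= d / Cmod z / 2 * Cmod z)%R.
    by apply: Rmult_le_compat_r; [lra|exact: Rmin_r].
  have -> : (d / Cmod z / 2 * Cmod z = d / 2)%R by field; lra.
  lra.
have := Hd (RtoC t * z); have E (v : C) : v - 0 = v by ring.
rewrite phi0 psi0 !E mt => /(_ td).
rewrite (Hc t ltac:(lra)).
have -> : c * psi (t * z) - c * psi (t * z) - (0 - c * 0) - (1 - c * 1) * (t * z) =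
   - ((1 - c * 1) * (t * z)) by ring.
rewrite Cmod_opp (Cmod_mult (1 - c * 1)) mt.
have : (0 < Cmod (1 - c * 1) * (t * Cmod z))%R.
  by apply: Rmult_lt_0_compat => //; apply: Rmult_lt_0_compat.
lra.
Qed.

Lemma theta_like_unique z : phi z = psi z.
Proof.
move: z; apply: (@lattice_shift_ind _ tau tau0).
- move=> z; rewrite (tl_add1 Hphi) (tl_add1 Hpsi); split=> [->//|E].
  by rewrite -[phi z]Copp_opp E Copp_opp.
- move=> z; rewrite (tl_addtau Hphi) (tl_addtau Hpsi); split=> [->//|E].
  have e0 := @cexp_neq0 (- (twopii * z) - PI * Ci * tau).
  set e := cexp _ in E e0.
  have -> : phi z = (- e * phi z) / (- e) by field.
  by rewrite E; field.
- by move=> z lz; have /(tl_zeros Hphi) -> := lz; have /(tl_zeros Hpsi) -> := lz.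
- exact: phi_F.
Qed.

End ThetaUnique.

(** * Modular transformations of theta *)

Lemma Cmod_ball (x y : C) (d : R) : (Cmod (y - x) < d)%R -> ball x d y.
Proof.
move=> H; split; apply: Rle_lt_trans H.
  exact: (abs_fst_le (y - x)).
exact: (abs_snd_le (y - x)).
Qed.

Lemma norm_scal_pair (w : C) :
  norm (scal (w : C_AbsRing) (RtoC 1, RtoC 0) :
    prod_NormedModule C_AbsRing C_NormedModule C_NormedModule) = Cmod w.
Proof.
rewrite /norm /= /prod_norm /= /norm /= /scal /= /mult /=.
have -> : w * 0 = 0 by ring.
have -> : w * 1 = w by ring.
rewrite Cmod_0.
have -> : (Cmod w * (Cmod w * 1) + 0 * (0 * 1) = Rsqr (Cmod w))%R by rewrite /Rsqr; ring.
exact/sqrt_Rsqr/Cmod_ge_0.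
Qed.

Lemma holomorphic2_cderiv theta z tau : holomorphic2_at theta z tau ->
  exists l, cderiv (fun z' => theta z' tau) z l.
Proof.
move=> [l [Hl H]]; exists (l (RtoC 1, RtoC 0)) => eps eps0.
have [d Hd] := H (z, tau) (fun P HP => HP) (mkposreal _ eps0).
exists d; first exact: cond_pos.
move=> z' Hz'; have := Hd (z', tau).
have -> : minus (z', tau) (z, tau) = scal (z' - z : C_AbsRing) (RtoC 1, RtoC 0)
    :> prod_NormedModule C_AbsRing C_NormedModule C_NormedModule.
  by rewrite /minus /plus /opp /scal /= /prod_plus /prod_opp /prod_scal /plus /opp /scal /= /mult /=; congr pair; ring.
rewrite (linear_scal _ Hl) norm_scal_pair => H1.
have -> : l (RtoC 1, RtoC 0) * (z' - z) = scal (z' - z : C_AbsRing) (l (RtoC 1, RtoC 0)).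
  exact: Cmult_comm.
apply: H1; split; apply: Cmod_ball => //=.
by have -> : tau - tau = 0 by [ring]; rewrite Cmod_0; apply: cond_pos.
Qed.

Lemma cexp_PI : cexp (PI * Ci) = - (1).
Proof.
have -> : PI * Ci = (0, PI)%R by rewrite /Cmult /=; congr pair; ring.
by rewrite /cexp /= exp_0 cos_PI sin_PI /Copp /=; congr pair; ring.
Qed.

Lemma theta_kernel_addtau (phi : C -> C) (tau z : C) : phi z <> 0 ->
  (forall z, phi (z + tau) = - cexp (- (twopii * z) - RtoC PI * Ci * tau) * phi z) ->
  forall u, phi u <> 0 -> kernel phi (z + tau) u = cexp (- twopii * u) * kernel phi z u.
Proof.
move=> p0 H u pu; rewrite /kernel.
have -> : z + tau + u = z + u + tau by ring.
rewrite !H.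
have -> : - (twopii * (z + u)) - PI * Ci * tau = - twopii * u + (- (twopii * z) - PI * Ci * tau) by ring.
rewrite cexp_add; have e0 := @cexp_neq0 (- (twopii * z) - PI * Ci * tau).
by field; do !split.
Qed.

Lemma theta_kernel_add1 (phi : C -> C) (z u : C) : phi z <> 0 -> phi u <> 0 ->
  (forall z, phi (z + 1) = - phi z) -> kernel phi (z + 1) u = kernel phi z u.
Proof.
move=> p0 pu H; rewrite /kernel.
have -> : z + 1 + u = z + u + 1 by ring.
by rewrite !H; field; split.
Qed.

(** [F_ode] gives the expansion of the kernel on [F_domain]. The two periods multiply the kernel by
    1 and by exp(-2 pi i u), which carries the expansion to all z off the lattice. *)
Lemma is_theta_theta_like theta F tau : is_theta theta -> is_F theta F ->
  upper_half_plane tau -> theta_like (fun z => theta z tau) tau.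
Proof.
move=> Ht HF t0; set phi := fun z => theta z tau.
have p1 : cderiv phi 0 1 by apply/cderiv_is/(theta_derive0 Ht).
have A1 z : phi (z + 1) = - phi z by exact: (theta_add1 Ht).
have At z : phi (z + tau) = - cexp (- (twopii * z) - RtoC PI * Ci * tau) * phi z.
  exact: (theta_addtau Ht).
have Z z : phi z = 0 <-> lattice tau z by exact: (theta_zeros Ht).
have [d d0 Hd] := deriv1_near (proj2 (Z 0) (lattice0 tau)) p1.
split=> //.
  by move=> z; apply: holomorphic2_cderiv; apply: (theta_holomorphic Ht).
apply: (@lattice_shift_ind _ tau t0) => [z|z|z /Z //|z Fz _].
- have E : phi (z + 1) <> 0 <-> phi z <> 0.
    by rewrite A1; split=> H K; apply: H; [rewrite K|rewrite -[phi z]Copp_opp K]; ring.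
  rewrite E; split=> H p0; have [c T] := H p0; exists c; apply: tay_ext_loc T; try exact: d0;
    by move=> u u0 /(Hd u u0) [pu _]; rewrite theta_kernel_add1.
- have e0 := @cexp_neq0 (- (twopii * z) - PI * Ci * tau).
  have E : phi (z + tau) <> 0 <-> phi z <> 0.
    rewrite At; split=> H K; apply: H; first by rewrite K; ring.
    have -> : phi z = (- cexp (- (twopii * z) - PI * Ci * tau) * phi z) / (- cexp (- (twopii * z) - PI * Ci * tau)) by field.
    by rewrite K; field.
  rewrite E; split=> H p0; have [c T] := H p0; eexists.
    apply: tay_ext_loc (tay_mult (tay_cexp_lin (- twopii)) T); first exact: d0.
    by move=> u u0 /(Hd u u0) [pu _]; rewrite theta_kernel_addtau.
  apply: tay_ext_loc (tay_mult (tay_cexp_lin twopii) T); first exact: d0.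
  move=> u u0 /(Hd u u0) [pu _]; rewrite theta_kernel_addtau // Cmult_assoc -cexp_add.
  have -> : twopii * u + - twopii * u = 0 by ring.
  by rewrite cexp0; ring.
- have [c /taylor_tay T _] := F_ode HF t0 Fz.
  by exists c.
Qed.

(** Together with 1, tau and tau + 1 span the same lattice; the sign from [tl_add1] is absorbed by
    exp(- pi i) = -1. *)
Lemma theta_like_T phi tau : theta_like phi (tau + 1) -> theta_like phi tau.
Proof.
move=> H; split; try by case: H.
- move=> z; have E : phi (z + tau) = - phi (z + (tau + 1)).
    have -> : z + (tau + 1) = z + tau + 1 by ring.
    by rewrite (tl_add1 H) Copp_opp.
  rewrite E (tl_addtau H).
  have -> : - (twopii * z) - PI * Ci * (tau + 1) = (- (twopii * z) - PI * Ci * tau) + - (PI * Ci) by ring.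
  have := cexp_opp (PI * Ci); rewrite cexp_PI => K.
  have {}K : cexp (- (PI * Ci)) = - (1).
    have -> : cexp (- (PI * Ci)) = - (cexp (- (PI * Ci)) * - (1)) by ring.
    by rewrite K.
  by rewrite cexp_add K; ring.
- move=> z; rewrite (tl_zeros H); split=> -[m [n ->]].
    by exists (Z.add m n), n; rewrite plus_IZR RtoC_plus; ring.
  by exists (Z.sub m n), n; rewrite minus_IZR RtoC_minus; ring.
Qed.

(** The Gaussian corrects the multipliers of the rescaled periods, and the factor 1 - tau restores
    the derivative 1 at 0. *)
Lemma theta_like_S phi tau : upper_half_plane tau -> theta_like phi (tau / (1 - tau)) ->
  theta_like (fun z => (1 - tau) * cexp (PI * Ci / (1 - tau) * (z * z)) * phi (z / (1 - tau))) tau.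
Proof.
move=> t0 H; set j := 1 - tau in H *.
have j0 : j <> 0.
  rewrite /j => E; have : Im (1 - tau) = 0%R by rewrite E.
  by move: t0; rewrite /upper_half_plane; case: (tau) => x y; rewrite /Im /=; lra.
set a := PI * Ci / j; set psi := fun z => _.
have tj : tau = 1 - j by rewrite /j; ring.
have ne z : cexp (a * (z * z)) <> 0 by exact: cexp_neq0.
have psi0 z : psi z = 0 <-> phi (z / j) = 0.
  rewrite /psi; split=> [E|->]; last by ring.
  have -> : phi (z / j) = (j * cexp (a * (z * z)) * phi (z / j)) / (j * cexp (a * (z * z))).
    by field; split.
  by rewrite E; field; split.
have dgauss z : cderiv (fun z => cexp (a * (z * z))) z (cexp (a * (z * z)) * (a * (1 * z + z * 1))).
  exact: (cderiv_comp (g := fun z => a * (z * z)) (cderiv_cexp _) (cderiv_scal a (cderiv_mult (cderiv_id z) (cderiv_id z)))).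
have dphi z l : cderiv phi (z / j) l -> cderiv (fun z => phi (z / j)) z (/ j * l).
  move=> Hl; have := @cderiv_comp_affine phi (/ j) 0 z l.
  have -> : / j * z + 0 = z / j by field.
  by move=> /(_ Hl); apply: cderiv_ext => x; congr phi; field.
have psiD : cderiv psi 0 1.
  have z0 : 0 / j = 0 by field.
  have := tl_derive0 H; rewrite -z0 => /dphi D.
  have := cderiv_mult (cderiv_scal j (dgauss 0)) D; 
  have e1 : cexp (a * (0 * 0)) = 1 by have -> : a * (0 * 0) = 0 by [ring]; exact: cexp0.
  have f0 : phi (0 / j) = 0 by rewrite z0; apply/(tl_zeros H)/lattice0.
  rewrite ?z0; suff -> : j * (cexp (a * (0 * 0)) * (a * (1 * 0 + 0 * 1))) * phi 0 + j * cexp (a * (0 * 0)) * (/ j * 1) = 1 by [].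
  by rewrite z0 in f0; rewrite e1 f0; field.
split.
- move=> z; have [l /dphi Hl] := tl_diff H (z / j); eexists.
  exact: (cderiv_mult (cderiv_scal j (dgauss z)) Hl).
- move=> z; rewrite /psi.
  (* As 1 = tau + j, the period 1 becomes the sum of the two periods tau / j and 1. *)
  have -> : (z + 1) / j = z / j + tau / j + 1 by rewrite tj; field.
  rewrite (tl_add1 H) (tl_addtau H) -/j.
  have -> : cexp (a * ((z + 1) * (z + 1))) = cexp (a * (z * z)) * (cexp (twopii * (z / j) + PI * Ci * (tau / j)) * cexp (PI * Ci)).
    rewrite -!cexp_add; congr cexp; rewrite /a /twopii tj RtoC_mult.
    by have -> : RtoC 2 = 1 + 1 by [rewrite -RtoC_plus]; field.
  rewrite cexp_PI.
  have -> : - (twopii * (z / j)) - PI * Ci * (tau / j) = - (twopii * (z / j) + PI * Ci * (tau / j)) by ring.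
  set w := twopii * _ + _; have := cexp_opp w; set e1 := cexp (- w); set e2 := cexp w => K.
  have -> : j * (cexp (a * (z * z)) * (e2 * - (1))) * - (- e1 * phi (z / j)) =
     - (j * cexp (a * (z * z)) * phi (z / j)) * (e1 * e2) by ring.
  by rewrite K; ring.
- move=> z; rewrite /psi.
  have -> : (z + tau) / j = z / j + tau / j by field.
  rewrite (tl_addtau H) -/j.
  have E : a * ((z + tau) * (z + tau)) + (- (twopii * (z / j)) - PI * Ci * (tau / j)) =
    a * (z * z) + (- (twopii * z) - PI * Ci * tau).
    rewrite /a /twopii tj RtoC_mult.
    by have -> : RtoC 2 = 1 + 1 by [rewrite -RtoC_plus]; field.
  have {}E : cexp (a * ((z + tau) * (z + tau))) * cexp (- (twopii * (z / j)) - PI * Ci * (tau / j)) =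
    cexp (a * (z * z)) * cexp (- (twopii * z) - PI * Ci * tau) by rewrite -!cexp_add E.
  have -> : forall A B D P : C, j * A * (- B * P) = - (j * (A * B) * P) by move=> A B D P; ring.
    by rewrite E; ring.
  exact: RtoC 0.
- move=> z; rewrite psi0 (tl_zeros H); split=> -[m [n E]].
    exists m, (Z.sub n m); rewrite minus_IZR RtoC_minus.
    have -> : z = (z / j) * j by field.
    by rewrite E tj; field.
  exists m, (Z.add n m); rewrite plus_IZR RtoC_plus E tj; by field.
- exact: psiD.
- move=> z /[dup] pz0; rewrite psi0 => p0; have [c T] := tl_kernel H p0.
  have ji : / j <> 0 by move=> E; have : j * / j = 1 by [field]; rewrite E Cmult_0_r => -[]; lra.
  (* The kernel of psi at (z, u) is exp(2 a z u) times that of phi at (z / j, u / j), because (z +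
     u)^2 - z^2 - u^2 = 2 z u. *)
  have T' := tay_mult (tay_cexp_lin (2 * a * z)) (tay_scale ji T).
  have psi00 : psi 0 = 0.
    by apply/psi0; have -> : 0 / j = 0 by [field]; apply/(tl_zeros H)/lattice0.
  have [d d0 Hd] := deriv1_near psi00 psiD.
  eexists; apply: tay_ext_loc T'; first exact: d0.
  move=> u u0 /(Hd u u0) [pu _]; rewrite /kernel.
  have pu' : phi (u / j) <> 0 by rewrite -psi0.
  rewrite /psi.
  have -> : (z + u) / j = z / j + / j * u by field.
  have -> : a * ((z + u) * (z + u)) = 2 * a * z * u + (a * (z * z) + a * (u * u)).
    by have -> : RtoC 2 = 1 + 1 by [rewrite -RtoC_plus]; ring.
  have -> : u / j = / j * u by field.
  rewrite !cexp_add; have n1 := ne z; have n2 := ne u.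
  have pu2 : phi (/ j * u) <> 0 by have -> : / j * u = u / j by field.
  by field; do !split.
Qed.

Lemma theta_T theta F tau z : is_theta theta -> is_F theta F ->
  upper_half_plane tau -> theta z (tau + 1) = theta z tau.
Proof.
move=> Ht HF t0; have t1 : upper_half_plane (tau + 1).
  by move: t0; rewrite /upper_half_plane; case: (tau) => x y; rewrite /Im /=; lra.
exact: (theta_like_unique t0 (theta_like_T (is_theta_theta_like Ht HF t1)) (is_theta_theta_like Ht HF t0)).
Qed.

Lemma uhp_S tau : upper_half_plane tau -> upper_half_plane (tau / (1 - tau)).
Proof.
case: tau => x y; rewrite /upper_half_plane /Im /= => y0.
set n := ((1 + - x) * ((1 + - x) * 1) + (0 + - y) * ((0 + - y) * 1))%R; have n0 : (0 < n)%R.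
  rewrite /n; have := pow2_ge_0 (1 + - x); have : (0 < (0 + - y) ^ 2)%R by have -> : ((0 + - y) ^ 2 = y * y)%R by [ring]; apply: Rmult_lt_0_compat.
  by rewrite /=; lra.
have -> : (x * (- (0 + - y) / n) + y * ((1 + - x) / n) = y / n)%R by field; lra.
exact: Rdiv_lt_0_compat.
Qed.

Lemma theta_S theta F tau z : is_theta theta -> is_F theta F ->
  upper_half_plane tau -> theta z tau =
   (1 - tau) * cexp (PI * Ci / (1 - tau) * (z * z)) * theta (z / (1 - tau)) (tau / (1 - tau)).
Proof.
move=> Ht HF t0.
exact: (theta_like_unique t0 (is_theta_theta_like Ht HF t0)
  (theta_like_S t0 (is_theta_theta_like Ht HF (uhp_S t0)))).
Qed.

(** * Noncommutative series *)

Lemma Csub_eq0 (a b : C) : a - b = 0 -> a = b.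
Proof. by move=> E; rewrite -[a](Csub_add _ b) E; ring. Qed.

Definition nc_zero : ncseries := fun=> 0.

Lemma nc_mulZr c A B : nc_mul A (nc_scale c B) = nc_scale c (nc_mul A B).
Proof.
apply: nc_ext => w; rewrite /nc_scale; elim: w A => [|l w IH] A.
  by rewrite !nc_mul_nil; ring.
by rewrite !nc_mul_cons IH; ring.
Qed.

Lemma nc_subE A B : nc_sub A B = nc_add A (nc_scale (-(1)) B).
Proof. by apply: nc_ext => v; rewrite /nc_sub /nc_add /nc_scale; ring. Qed.

Lemma nc_mulBl A B D : nc_mul (nc_sub A B) D = nc_sub (nc_mul A D) (nc_mul B D).
Proof. by rewrite nc_subE nc_mulDl nc_mulZl -nc_subE. Qed.

Lemma nc_mulBr A B D : nc_mul A (nc_sub B D) = nc_sub (nc_mul A B) (nc_mul A D).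
Proof. by rewrite nc_subE nc_mulDr nc_mulZr -nc_subE. Qed.

Lemma nc_mul0r A : nc_mul A nc_zero = nc_zero.
Proof.
apply: nc_ext => w; elim: w A => [|l w IH] A; first by rewrite nc_mul_nil /nc_zero; ring.
by rewrite nc_mul_cons IH /nc_zero; ring.
Qed.

Lemma nc_mul_congr2 (A A' B B' : ncseries) (w : ncword) : (forall v, (size v <= size w)%N -> A v = A' v) ->
  (forall v, (size v <= size w)%N -> B v = B' v) -> nc_mul A B w = nc_mul A' B' w.
Proof.
move=> + BB'; elim: w A A' BB' => [|l w IH] A A' BB' AA'.
  by rewrite !nc_mul_nil AA' ?BB'.
rewrite !nc_mul_cons AA' // BB' // (IH _ (fun v => A' (l :: v))) // => v vw.
  by apply: BB'; apply: leqW.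
exact: AA'.
Qed.

Lemma nc_mul_lowr (A B : ncseries) (w : ncword) : (forall v, (size v < size w)%N -> B v = 0) ->
  nc_mul A B w = A [::] * B w.
Proof.
case: w => [|l w] H; first by rewrite nc_mul_nil.
rewrite nc_mul_cons (@nc_mul_congr _ B nc_zero) => [|v vw]; last exact: H.
by rewrite nc_mul0r /nc_zero; ring.
Qed.

Lemma nc_mul_lowl (A B : ncseries) (w : ncword) : (forall v, (size v < size w)%N -> A v = 0) ->
  nc_mul A B w = A w * B [::].
Proof.
elim: w A => [|l w IH] A H; first by rewrite nc_mul_nil.
by rewrite nc_mul_cons IH => [|v vw]; [rewrite H //; ring|exact: H].
Qed.

(** * Series-valued linear differential equations *)

Definition sderiv (F : C -> ncseries) (z : C) (D : ncseries) : Prop :=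
  forall w, cderiv (fun z' => F z' w) z (D w).

Lemma sderiv_ext F G z D : F =1 G -> sderiv F z D -> sderiv G z D.
Proof. by move=> FG H w; apply: cderiv_ext (H w) => x; rewrite FG. Qed.

Lemma sderiv_const A z : sderiv (fun=> A) z nc_zero.
Proof. by move=> w; apply: cderiv_const. Qed.

Lemma sderiv_sub F G z D E : sderiv F z D -> sderiv G z E ->
  sderiv (fun u => nc_sub (F u) (G u)) z (nc_sub D E).
Proof. by move=> HF HG w; apply: cderiv_minus. Qed.

Lemma sderiv_mul F G z D E : sderiv F z D -> sderiv G z E ->
  sderiv (fun u => nc_mul (F u) (G u)) z (nc_add (nc_mul D (G z)) (nc_mul (F z) E)).
Proof.
move=> HF HG w; elim: w F D HF => [|l w IH] F D HF.
  have := cderiv_mult (HF [::]) (HG [::]); rewrite /nc_add !nc_mul_nil.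
  by apply: cderiv_ext => u; rewrite nc_mul_nil.
have H1 := cderiv_mult (HF [::]) (HG (l :: w)).
have H2 := IH (fun u v => F u (l :: v)) (fun v => D (l :: v)) (fun v => HF (l :: v)).
have := cderiv_plus H1 H2.
have -> : D [::] * G z (l :: w) + F z [::] * E (l :: w) +
    nc_add (nc_mul (fun v => D (l :: v)) (G z)) (nc_mul (fun v => F z (l :: v)) E) w =
  nc_add (nc_mul D (G z)) (nc_mul (F z) E) (l :: w).
  by rewrite /nc_add !nc_mul_cons; ring.
by apply: cderiv_ext => u; rewrite nc_mul_cons.
Qed.

Lemma sderiv_mulr F z D A : sderiv F z D -> sderiv (fun u => nc_mul (F u) A) z (nc_mul D A).
Proof.
move=> HF; have := sderiv_mul HF (sderiv_const A z).
have -> // : nc_add (nc_mul D A) (nc_mul (F z) nc_zero) = nc_mul D A.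
by rewrite nc_mul0r; apply: nc_ext => w; rewrite /nc_add /nc_zero; ring.
Qed.

Lemma sderiv_mull F z D A : sderiv F z D -> sderiv (fun u => nc_mul A (F u)) z (nc_mul A D).
Proof.
move=> HF; have := sderiv_mul (sderiv_const A z) HF.
have -> // : nc_add (nc_mul nc_zero (F z)) (nc_mul A D) = nc_mul A D.
by rewrite nc_mul0l; apply: nc_ext => w; rewrite /nc_add; ring.
Qed.

Lemma sderiv_comp_affine F a b z D : sderiv F (a * z + b) D ->
  sderiv (fun u => F (a * u + b)) z (nc_scale a D).
Proof. by move=> H w; apply: (@cderiv_comp_affine (fun u => F u w)). Qed.

Definition convex (U : C -> Prop) : Prop :=
  forall z0 z1 (t : R), U z0 -> U z1 -> (0 <= t <= 1)%R -> U (z0 + t * (z1 - z0)).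

(* The coefficient of w in K D only involves the coefficients of D at words
   shorter than w, since K has constant term 0. *)
Lemma ode_zero (U : C -> Prop) (D : C -> ncseries) z0 : convex U -> U z0 ->
  (forall z, U z -> exists2 K : ncseries, K [::] = 0 &
     sderiv D z (nc_scale (-(1)) (nc_mul K (D z)))) ->
  D z0 = nc_zero -> forall z, U z -> D z = nc_zero.
Proof.
move=> Ucv U0 HD D0.
suff H n : forall w, (size w < n)%N -> forall z, U z -> D z w = 0.
  by move=> z Uz; apply: nc_ext => w; apply: (H (size w).+1).
elim: n => [//|n IH] w wn z Uz.
have -> : RtoC 0 = D z0 w by rewrite D0.
apply: (@cderiv_zero (fun u => D u w)) => t t1.
have Ut := Ucv z0 z t U0 Uz t1.
have [K K0 HK] := HD _ Ut.
have -> : RtoC 0 = nc_scale (-(1)) (nc_mul K (D (z0 + t * (z - z0)))) w; last exact: HK.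
rewrite /nc_scale (@nc_mul_small _ _ n K0) //; first ring.
by move=> v vn; apply: IH.
Qed.

(** The coefficient K multiplies from the left, so solutions may be multiplied by constants on the
    right; G - F A with A = (F z0)^-1 G z0 solves the equation and vanishes at z0. *)
Lemma ode_unique (U : C -> Prop) (F G : C -> useries) z0 : convex U -> U z0 ->
  (forall z, U z -> exists K : ncseries, [/\ K [::] = 0,
     sderiv F z (nc_scale (-(1)) (nc_mul K (F z))) &
     sderiv G z (nc_scale (-(1)) (nc_mul K (G z)))]) ->
  forall z, U z -> G z = (F z * ((F z0)^-1 * G z0))%g.
Proof.
move=> Ucv U0 HFG z Uz; set A := ((F z0)^-1 * G z0)%g; apply: useriesP.
have H : nc_sub (G z) (nc_mul (F z) A) = nc_zero.
  apply: (@ode_zero U (fun z => nc_sub (G z) (nc_mul (F z) A)) z0) => //.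
    move=> u /HFG [K [K0 HF HG]]; exists K => //.
    have := sderiv_sub HG (sderiv_mulr A HF).
    by congr sderiv; rewrite nc_mulZl -nc_mulA nc_mulBr;
      apply: nc_ext => w; rewrite /nc_sub /nc_scale; ring.
  have -> : nc_mul (F z0) A = (F z0 * A)%g by [].
  by rewrite /A mulVKg; apply: nc_ext => w; rewrite /nc_sub /nc_zero; ring.
have -> : ucoef (F z * A)%g = nc_mul (F z) A by [].
by apply: nc_ext => w; apply: Csub_eq0; exact: (f_equal (fun S : ncseries => S w) H).
Qed.

(** * Locally finite sums: exponentials and power series in ad x *)

Fixpoint nclin (c : nat -> C) (P : nat -> ncseries) (N : nat) : ncseries :=
  if N is m.+1 then nc_add (nclin c P m) (nc_scale (c m) (P m)) else nc_zero.

Definition nc_ser (c : nat -> C) (P : nat -> ncseries) : ncseries :=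
  fun w => nclin c P (size w).+1 w.

(** Only the terms with n <= size w then reach the coefficient of w, so that the truncation in
    [nc_ser] is the full infinite sum. *)
Definition raising (P : nat -> ncseries) : Prop :=
  forall n w, (size w < n)%N -> P n w = 0.

Lemma nclinS c P N : nclin c P N.+1 = nc_add (nclin c P N) (nc_scale (c N) (P N)).
Proof. by []. Qed.

Lemma nc_serE c P N w : raising P -> (size w < N)%N -> nclin c P N w = nc_ser c P w.
Proof.
move=> HP /subnKC <-; elim: (_ - _)%N => [|k IH]; first by rewrite addn0.
rewrite addnS nclinS /nc_add IH /nc_scale HP; first by ring.
by rewrite addSn ltnS leq_addr.
Qed.

Lemma sum_n_nclin c P N w : sum_n (fun n => c n * P n w) N = nclin c P N.+1 w.
Proof.
elim: N => [|N IH]; first by rewrite sum_O /= /nc_add /nc_zero /nc_scale; ring.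
by rewrite sum_Sn IH.
Qed.

Lemma nc_ser_ext c d P Q : c =1 d -> (forall n, P n = Q n) -> nc_ser c P = nc_ser d Q.
Proof.
move=> cd PQ; apply: nc_ext => w; rewrite /nc_ser; elim: _.+1 => [//|N IH] /=.
by rewrite /nc_add IH cd PQ.
Qed.

Lemma nclin_mull A c P N : nc_mul A (nclin c P N) = nclin c (fun n => nc_mul A (P n)) N.
Proof. by elim: N => [|N IH] /=; rewrite ?nc_mul0r // nc_mulDr IH nc_mulZr. Qed.

Lemma nclin_mulr A c P N : nc_mul (nclin c P N) A = nclin c (fun n => nc_mul (P n) A) N.
Proof.
elim: N => [|N IH] /=; first exact: nc_mul0l.
by rewrite nc_mulDl IH nc_mulZl.
Qed.

Lemma nc_ser_mull A c P : raising P -> nc_mul A (nc_ser c P) = nc_ser c (fun n => nc_mul A (P n)).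
Proof.
move=> HP; apply: nc_ext => w; rewrite {2}/nc_ser -nclin_mull.
by apply: nc_mul_congr => v vw; rewrite nc_serE.
Qed.

Lemma nc_ser_mulr A c P : raising P -> nc_mul (nc_ser c P) A = nc_ser c (fun n => nc_mul (P n) A).
Proof.
move=> HP; apply: nc_ext => w; rewrite {2}/nc_ser -nclin_mulr.
by apply: nc_mul_congr2 => v vw //; rewrite nc_serE.
Qed.

Lemma nc_ser_sub c P Q : nc_ser c (fun n => nc_sub (P n) (Q n)) = nc_sub (nc_ser c P) (nc_ser c Q).
Proof.
apply: nc_ext => w; rewrite /nc_sub /nc_ser; elim: _.+1 => [|N IH] /=.
  by rewrite /nc_zero; ring.
by rewrite /nc_add IH /nc_scale; ring.
Qed.

(** The coefficients of u times the power series with coefficients c. *)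
Definition shiftc (c : nat -> C) (n : nat) : C := if n is m.+1 then c m else 0.

Lemma nc_ser_shift c P : raising P -> nc_ser (shiftc c) P = nc_ser c (fun n => P n.+1).
Proof.
move=> HP; apply: nc_ext => w; rewrite -(@nc_serE (shiftc c) P (size w).+2) // /nc_ser.
elim: (size w).+1 => [|N IH]; first by rewrite /= /nc_add /nc_scale /nc_zero; ring.
by rewrite nclinS /nc_add IH.
Qed.

Lemma sderiv_nc_ser (c : C -> nat -> C) c' P z : (forall n, cderiv (fun u => c u n) z (c' n)) ->
  sderiv (fun u => nc_ser (c u) P) z (nc_ser c' P).
Proof.
move=> H w; rewrite /nc_ser; elim: _.+1 => [|N IH] /=; first exact: cderiv_const.
apply: cderiv_plus IH _; have := cderiv_scal (P N w) (H N).
rewrite /nc_scale Cmult_comm; apply: cderiv_ext => u; ring.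
Qed.

Lemma raising_pow (A : ncseries) : A [::] = 0 -> raising (nc_pow A).
Proof. by move=> A0 n w; apply: nc_pow_small. Qed.

Lemma nc_powZ c A n : nc_pow (nc_scale c A) n = nc_scale (c ^ n) (nc_pow A n).
Proof.
elim: n => [|n IH]; first by apply: nc_ext => w; rewrite /nc_scale /=; ring.
rewrite /nc_pow /= -!/(nc_pow _ _) IH nc_mulZl nc_mulZr.
by apply: nc_ext => w; rewrite /nc_scale; ring.
Qed.

(** The coefficients of exp(ze u) as a power series in u. *)
Definition expc (ze : C) (n : nat) : C := ze ^ n * expcoef n.

Lemma nc_expZ ze A : nc_exp (nc_scale ze A) = nc_ser (expc ze) (nc_pow A).
Proof.
apply: nc_ext => w; rewrite /nc_ser -sum_n_nclin /nc_exp; apply: sum_n_ext => n.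
rewrite nc_powZ /nc_scale /expc /expcoef RtoC_inv; last exact: INR_fact_neq_0.
rewrite /Cdiv; set X := nc_pow _ _ _; set Y := / _; set Z := _ ^ _.
by rewrite -Cmult_assoc (Cmult_comm X Y) Cmult_assoc.
Qed.

Lemma expc_deriv ze n : cderiv (fun u => expc u n) ze (shiftc (expc ze) n).
Proof.
case: n => [|n].
  by have := cderiv_const (expc 0 0) ze; apply: cderiv_ext => u; rewrite /expc /=; ring.
have := cderiv_scal (expcoef n.+1) (cderiv_pow n ze).
have -> : expcoef n.+1 * (INR n.+1 * ze ^ n) = shiftc (expc ze) n.+1.
  rewrite /shiftc /expc.
  have -> : expcoef n = expcoef n.+1 * INR n.+1; last by ring.
  rewrite /expcoef fact_simpl mult_INR -RtoC_mult; congr RtoC.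
  by field; split; [exact: INR_fact_neq_0|exact: not_0_INR].
by apply: cderiv_ext => u; rewrite /expc; ring.
Qed.

Lemma sderiv_exp (A : ncseries) (ze : C) : A [::] = 0 ->
  sderiv (fun u => nc_exp (nc_scale u A)) ze (nc_mul A (nc_exp (nc_scale ze A))).
Proof.
move=> A0; rewrite nc_expZ nc_ser_mull; last exact: raising_pow.
rewrite -[nc_ser _ _](nc_ser_shift _ (raising_pow A0)).
apply: sderiv_ext (sderiv_nc_ser _ (fun n => expc_deriv ze n)) => u.
by rewrite nc_expZ.
Qed.

Lemma nc_exp_scale0 A : nc_exp (nc_scale 0 A) = nc_one.
Proof.
apply: nc_ext => w; rewrite nc_expZ /nc_ser.
elim: (size w) => [|n IH]; first by rewrite /= /nc_add /nc_scale /expc /expcoef /nc_zero /= Rinv_1; ring.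
by rewrite nclinS /nc_add IH /nc_scale /expc /=; ring.
Qed.

Lemma convexT : convex (fun=> True).
Proof. by []. Qed.

(** As functions of a, both sides solve F' = A F and agree at a = 0; the sign in [ode_unique] calls
    for K = - A. *)
Lemma uexpD (A : ncseries) (a b : C) : A [::] = 0 ->
  uexp (nc_scale (a + b) A) = (uexp (nc_scale a A) * uexp (nc_scale b A))%g.
Proof.
move=> A0.
have H := @ode_unique (fun=> True) (fun u => uexp (nc_scale u A))
  (fun u => uexp (nc_scale (u + b) A)) 0 convexT I.
rewrite H => // [|z _].
  have -> : uexp (nc_scale 0 A) = 1%g by apply: useriesP; exact: nc_exp_scale0.
  by rewrite invg1 mul1g Cplus_0_l.
exists (nc_scale (-(1)) A); split.
- by rewrite /nc_scale A0; ring.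
- have := sderiv_exp z A0; congr sderiv.
  by rewrite nc_mulZl; apply: nc_ext => w; rewrite /nc_scale /=; ring.
- have := @sderiv_comp_affine (fun u => nc_exp (nc_scale u A)) 1 b z _ (sderiv_exp _ A0).
  have -> : 1 * z + b = z + b by ring.
  move=> K; have {}K := sderiv_ext (G := fun u => uexp (nc_scale (u + b) A)) _ K.
  have {}K := K ltac:(by move=> u /=; rewrite Cmult_1_l); move: K; congr sderiv.
  by rewrite nc_mulZl; apply: nc_ext => w; rewrite /nc_scale /=; ring.
Qed.

Lemma uexp0 (A : ncseries) : uexp (nc_scale 0 A) = 1%g.
Proof. exact/useriesP/nc_exp_scale0. Qed.

Lemma uexpN (A : ncseries) (a : C) : A [::] = 0 -> (uexp (nc_scale a A))^-1%g = uexp (nc_scale (- a) A).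
Proof.
move=> A0; have E : (uexp (nc_scale (- a) A) * uexp (nc_scale a A) = 1)%g.
  by rewrite -uexpD // -(uexp0 A); congr (uexp (nc_scale _ A)); ring.
by rewrite -[LHS]mul1g -E mulgK.
Qed.

Lemma nc_adE c A B : nc_ad_series c A B = nc_ser c (fun n => iter n (nc_bracket A) B).
Proof. by apply: nc_ext => w; rewrite /nc_ser -sum_n_nclin. Qed.

Lemma raising_ad (A B : ncseries) : A [::] = 0 -> raising (fun n => iter n (nc_bracket A) B).
Proof.
move=> A0 n; elim: n => [//|n IH] w wn /=.
rewrite /nc_bracket /nc_sub (nc_mul_small A0 IH) //.
have [wn'|] := boolP (size w == n); last first.
  move=> ne; rewrite (@nc_mul_congr2 _ nc_zero _ A) ?nc_mul0l //; first by rewrite /nc_zero; ring.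
  move=> v vw; apply: IH; apply: leq_ltn_trans vw _.
  by rewrite ltn_neqAle ne -ltnS.
rewrite nc_mul_lowl; first by rewrite A0; ring.
by move=> v; rewrite (eqP wn') => /IH.
Qed.

(** With [expc_deriv] and [conv_deriv] this says that the derivative in ze of exp(ze u) d(u) is u
    times it. *)
Lemma conv_shiftc c d n : conv (shiftc c) d n = shiftc (conv c d) n.
Proof.
case: n => [|n] /=; first ring.
have -> : (fun n => c n) = c by [].
ring.
Qed.

Lemma conv_deriv (c : C -> nat -> C) c' d z n : (forall n, cderiv (fun u => c u n) z (c' n)) ->
  cderiv (fun u => conv (c u) d n) z (conv c' d n).
Proof.
elim: n c c' => [|n IH] c c' H /=.
  by have := cderiv_scal (d 0%N) (H 0%N); rewrite Cmult_comm; apply: cderiv_ext => u; ring.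
apply: cderiv_plus; last exact: (IH (fun u n => c u n.+1)).
by have := cderiv_scal (d n.+1) (H 0%N); rewrite Cmult_comm; apply: cderiv_ext => u; ring.
Qed.

Lemma conv_expc0 d n : conv (expc 0) d n = d n.
Proof.
have E : expc 0 0 = 1 by rewrite /expc /expcoef /= Rinv_1; ring.
have Z (c : nat -> C) : (forall n, c n = 0) -> forall n, conv c d n = 0.
  by move=> c0 m; elim: m c c0 => [|m IH] c c0 /=; rewrite c0 ?IH //; ring.
case: n => [|n] /=; rewrite E; first ring.
rewrite Z; first ring.
by move=> m; rewrite /expc /=; ring.
Qed.

(** The computation of D' = A D for D = B E - E S, when B' = [A, B], E' = A E and S is constant. *)
Lemma ad_exp_algebra (A B E S : ncseries) :
  nc_sub (nc_add (nc_mul (nc_sub (nc_mul A B) (nc_mul B A)) E) (nc_mul B (nc_mul A E)))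
    (nc_mul (nc_mul A E) S) = nc_mul A (nc_sub (nc_mul B E) (nc_mul E S)).
Proof.
rewrite nc_mulBl (nc_mulBr A) (nc_mulA B) (nc_mulA A B) (nc_mulA A E).
by apply: nc_ext => w; rewrite /nc_sub /nc_add; ring.
Qed.

(* exp (ze ad A) = Ad (exp (ze A)): both sides solve the same linear
   differential equation in ze. *)
Lemma ad_series_exp (A B : ncseries) (d : nat -> C) (ze : C) : A [::] = 0 ->
  nc_mul (nc_ad_series (conv (expc ze) d) A B) (nc_exp (nc_scale ze A)) =
  nc_mul (nc_exp (nc_scale ze A)) (nc_ad_series d A B).
Proof.
move=> A0; set P := fun n => iter n (nc_bracket A) B.
have HP : raising P by exact: raising_ad.
pose Bz u := nc_ser (conv (expc u) d) P; pose E u := nc_exp (nc_scale u A).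
pose D u := nc_sub (nc_mul (Bz u) (E u)) (nc_mul (E u) (nc_ser d P)).
have dB u : sderiv Bz u (nc_bracket A (Bz u)).
  have -> : nc_bracket A (Bz u) = nc_ser (shiftc (conv (expc u) d)) P.
    by rewrite nc_ser_shift // /nc_bracket /Bz nc_ser_mull // nc_ser_mulr // -nc_ser_sub.
  apply: sderiv_nc_ser => n; rewrite -conv_shiftc; apply: conv_deriv => m.
  exact: expc_deriv.
have H : D ze = nc_zero.
  apply: (@ode_zero (fun=> True) D 0) => //.
  - move=> u _; exists (nc_scale (-(1)) A); first by rewrite /nc_scale A0; ring.
    have := sderiv_sub (sderiv_mul (dB u) (sderiv_exp u A0))
      (sderiv_mulr (nc_ser d P) (sderiv_exp u A0)).
    congr sderiv; rewrite -/(E u) nc_mulZl /D.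
    by rewrite /nc_bracket ad_exp_algebra; apply: nc_ext => w; rewrite /nc_scale; ring.
  - rewrite /D /Bz /E nc_exp_scale0 nc_mul1l nc_mul1r.
    rewrite (nc_ser_ext (d := d) (Q := P)) //; last exact: conv_expc0.
    by apply: nc_ext => w; rewrite /nc_sub /nc_zero; ring.
rewrite !nc_adE; apply: nc_ext => w; have := f_equal (fun S : ncseries => S w) H.
rewrite /D /nc_sub /nc_zero; exact: Csub_eq0.
Qed.

Lemma ord2P (i : 'I_2) : i = ord0 \/ i = ord_max.
Proof. by case: i => -[|[|k]] // Hk; [left|right]; apply: val_inj. Qed.

(** * Linear substitutions of the letters *)

Section Subst.
Variable a : 'M[C]_2.

Lemma nc_substD A B : nc_subst a (nc_add A B) = nc_add (nc_subst a A) (nc_subst a B).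
Proof.
apply: nc_ext => w; rewrite /nc_add; elim: w A B => [|l w IH] A B //=.
by rewrite !(IH (fun v => A (_ :: v)) (fun v => B (_ :: v))); ring.
Qed.

Lemma nc_substZ c A : nc_subst a (nc_scale c A) = nc_scale c (nc_subst a A).
Proof.
apply: nc_ext => w; rewrite /nc_scale; elim: w A => [|l w IH] A //=.
by rewrite !(IH (fun v => A (_ :: v))); ring.
Qed.

Lemma nc_substB A B : nc_subst a (nc_sub A B) = nc_sub (nc_subst a A) (nc_subst a B).
Proof. by rewrite !nc_subE nc_substD nc_substZ. Qed.

Lemma nc_subst_bracket A B :
  nc_subst a (nc_bracket A B) = nc_bracket (nc_subst a A) (nc_subst a B).
Proof. by rewrite /nc_bracket nc_substB !nc_substM. Qed.

Lemma nc_subst_congr A B w : (forall v, size v = size w -> A v = B v) ->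
  nc_subst a A w = nc_subst a B w.
Proof.
elim: w A B => [|l w IH] A B AB; first exact: AB.
have S k v : size v = size w -> A (k :: v) = B (k :: v) by move=> vw; apply: AB; rewrite /= vw.
by rewrite /= (IH _ _ (S ord0)) (IH _ _ (S ord_max)).
Qed.

Lemma nc_subst0 : nc_subst a nc_zero = nc_zero.
Proof.
apply: nc_ext => w; rewrite -[nc_zero in LHS](_ : nc_scale 0 nc_zero = _).
  by rewrite nc_substZ /nc_scale /nc_zero; ring.
by apply: nc_ext => v; rewrite /nc_scale /nc_zero; ring.
Qed.

Lemma nc_subst1 : nc_subst a nc_one = nc_one.
Proof.
apply: nc_ext => -[|l w] //=.
have E k : (fun v => nc_one (k :: v)) = nc_zero by [].
by rewrite !E nc_subst0 /nc_zero /nc_one /=; ring.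
Qed.

Lemma nc_subst_ser c P : nc_subst a (nc_ser c P) = nc_ser c (fun n => nc_subst a (P n)).
Proof.
apply: nc_ext => w.
rewrite (@nc_subst_congr _ (nclin c P (size w).+1)) => [|v vw]; last by rewrite /nc_ser vw.
rewrite /nc_ser; elim: (size w).+1 => [|N IH]; first by rewrite nc_subst0.
by rewrite !nclinS nc_substD nc_substZ /nc_add IH.
Qed.

Lemma nc_subst_pow A n : nc_subst a (nc_pow A n) = nc_pow (nc_subst a A) n.
Proof.
elim: n => [|n IH]; first exact: nc_subst1.
by rewrite /nc_pow /= nc_substM -!/(nc_pow _ _) IH.
Qed.

Lemma nc_subst_exp ze A :
  nc_subst a (nc_exp (nc_scale ze A)) = nc_exp (nc_scale ze (nc_subst a A)).
Proof.
by rewrite !nc_expZ nc_subst_ser; apply: nc_ser_ext => // n; apply: nc_subst_pow.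
Qed.

Lemma nc_subst_ad c A B :
  nc_subst a (nc_ad_series c A B) = nc_ad_series c (nc_subst a A) (nc_subst a B).
Proof.
rewrite !nc_adE nc_subst_ser; apply: nc_ser_ext => // n.
by elim: n => [//|n IH] /=; rewrite nc_subst_bracket IH.
Qed.

Lemma sderiv_subst F z D : sderiv F z D ->
  sderiv (fun u => nc_subst a (F u)) z (nc_subst a D).
Proof.
move=> HF w; elim: w F D HF => [|l w IH] F D HF; first exact: HF.
apply: cderiv_plus; apply: cderiv_scal.
  exact: (IH (fun u v => F u (ord0 :: v)) (fun v => D (ord0 :: v)) (fun v => HF _)).
exact: (IH (fun u v => F u (ord_max :: v)) (fun v => D (ord_max :: v)) (fun v => HF _)).
Qed.

Lemma usubstM A B : usubst a (A * B)%g = (usubst a A * usubst a B)%g.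
Proof. exact/useriesP/nc_substM. Qed.

Lemma usubst1 : usubst a 1%g = 1%g.
Proof. exact/useriesP/nc_subst1. Qed.

Lemma usubstV A : usubst a A^-1%g = (usubst a A)^-1%g.
Proof. by rewrite -[LHS](mulgK (usubst a A)) -usubstM mulVg usubst1 mul1g. Qed.

End Subst.

(** c is the matrix product b a: the rows are the images of the letters, so composition reverses the
    order of the matrices. *)
Lemma nc_subst_comp (a b c : 'M[C]_2) A :
  (forall k l, c k l = b k ord0 * a ord0 l + b k ord_max * a ord_max l) ->
  nc_subst a (nc_subst b A) = nc_subst c A.
Proof.
move=> H; apply: nc_ext => w; elim: w A => [//|l w IH] A.
rewrite /= !H -!IH.
have E i : (fun v => nc_subst b A (i :: v)) =
   nc_add (nc_scale (b ord0 i) (nc_subst b (fun v => A (ord0 :: v))))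
          (nc_scale (b ord_max i) (nc_subst b (fun v => A (ord_max :: v)))) by [].
by rewrite !E !nc_substD !nc_substZ /nc_add /nc_scale; ring.
Qed.

Lemma nc_subst_id (a : 'M[C]_2) A : a ord0 ord0 = 1 -> a ord0 ord_max = 0 -> a ord_max ord0 = 0 ->
  a ord_max ord_max = 1 -> nc_subst a A = A.
Proof.
move=> h1 h2 h3 h4; apply: nc_ext => w; elim: w A => [//|l w IH] A.
by rewrite /= !IH; case: (ord2P l) => ->; rewrite ?h1 ?h2 ?h3 ?h4; ring.
Qed.

Lemma ncX_nil : ncX [::] = 0. Proof. by []. Qed.

Lemma nc_t_nil : nc_t [::] = 0.
Proof. by rewrite /nc_t /nc_scale /nc_bracket /nc_sub !nc_mul_nil ncX_nil; ring. Qed.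

Lemma nc_bracketDr A B D : nc_bracket A (nc_add B D) = nc_add (nc_bracket A B) (nc_bracket A D).
Proof.
rewrite /nc_bracket nc_mulDl nc_mulDr; apply: nc_ext => w.
by rewrite /nc_sub /nc_add; ring.
Qed.

Lemma nc_bracketZr c A B : nc_bracket A (nc_scale c B) = nc_scale c (nc_bracket A B).
Proof.
rewrite /nc_bracket nc_mulZl nc_mulZr; apply: nc_ext => w.
by rewrite /nc_sub /nc_scale; ring.
Qed.

Lemma nc_bracketZl c A B : nc_bracket (nc_scale c A) B = nc_scale c (nc_bracket A B).
Proof.
rewrite /nc_bracket nc_mulZl nc_mulZr; apply: nc_ext => w.
by rewrite /nc_sub /nc_scale; ring.
Qed.

Lemma nc_bracketAA A : nc_bracket A A = nc_zero.
Proof. by apply: nc_ext => w; rewrite /nc_bracket /nc_sub /nc_zero; ring. Qed.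

Section AutFactor.
Variables (j mu : C).
Hypothesis j0 : j <> 0.
Let a := mx2 j 0 mu (/ j).

Lemma subst_X : nc_subst a ncX = nc_scale j ncX.
Proof.
rewrite /ncX nc_subst_letter !mxE /=.
by apply: nc_ext => w; rewrite /ncX /nc_add /nc_scale; ring.
Qed.

Lemma subst_Y : nc_subst a ncY = nc_add (nc_scale mu ncX) (nc_scale (/ j) ncY).
Proof. by rewrite /ncY nc_subst_letter !mxE. Qed.

(** [j x, mu x + y / j] = [x, y], the determinant being 1. *)
Lemma subst_t : nc_subst a nc_t = nc_t.
Proof.
rewrite /nc_t nc_substZ nc_subst_bracket subst_X subst_Y.
rewrite nc_bracketZl nc_bracketDr !nc_bracketZr nc_bracketAA.
apply: nc_ext => w; rewrite /nc_scale /nc_add /nc_zero; field.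
exact: j0.
Qed.

Lemma subst_uexp_t al : usubst a (uexp (nc_scale al nc_t)) = uexp (nc_scale al nc_t).
Proof. by apply: useriesP; rewrite /= nc_subst_exp subst_t. Qed.

Lemma subst_uexp_X al : usubst a (uexp (nc_scale al ncX)) = uexp (nc_scale (al * j) ncX).
Proof.
apply: useriesP; rewrite /= nc_subst_exp subst_X; congr nc_exp.
by apply: nc_ext => w; rewrite /nc_scale; ring.
Qed.

(* The linear map sum_n c_n (ad x)^n sends x to c_0 x. *)
Lemma subst_ad_series (c : nat -> C) : c 0%N = 1 ->
  nc_subst a (nc_ad_series c ncX ncY) =
  nc_add (nc_scale mu ncX) (nc_scale (/ j) (nc_ad_series (fun n => j ^ n * c n) ncX ncY)).
Proof.
move=> c0; rewrite nc_subst_ad subst_X subst_Y !nc_adE.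
have E n : iter n (nc_bracket (nc_scale j ncX)) (nc_add (nc_scale mu ncX) (nc_scale (/ j) ncY)) =
   nc_add (if n is 0 then nc_scale mu ncX else nc_zero)
     (nc_scale (/ j * j ^ n) (iter n (nc_bracket ncX) ncY)).
  elim: n => [|n IH] /=.
    by apply: nc_ext => w; rewrite /nc_add /nc_scale; ring.
  rewrite IH nc_bracketZl nc_bracketDr nc_bracketZr.
  have -> : nc_bracket ncX (if n is 0 then nc_scale mu ncX else nc_zero) = nc_zero.
    case: n {IH} => [|n]; first by rewrite nc_bracketZr nc_bracketAA; apply: nc_ext => w; rewrite /nc_scale /nc_zero; ring.
    by rewrite /nc_bracket nc_mul0l nc_mul0r; apply: nc_ext => w; rewrite /nc_sub /nc_zero; ring.
  by apply: nc_ext => w; rewrite /nc_add /nc_scale /nc_zero; ring.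
rewrite (nc_ser_ext (c := c) (d := c) _ E) //; apply: nc_ext => w.
rewrite /nc_add /nc_scale /nc_ser; elim: (size w) => [|N IH].
  by rewrite /= /nc_add /nc_scale /nc_zero c0; ring.
by rewrite nclinS /nc_add IH (nclinS _ _ N.+1) /nc_add /nc_scale /nc_zero; ring.
Qed.

End AutFactor.

(** * Modular transformations of F *)

Definition rlim (f : R -> C) (l : C) : Prop :=
  forall eps : R, (0 < eps)%R -> exists2 d : R, (0 < d)%R &
  forall s : R, (0 < s < d)%R -> (Cmod (f s - l) < eps)%R.

Lemma rlim_ext_loc f g l (d : R) : (0 < d)%R -> (forall s, (0 < s < d)%R -> f s = g s) ->
  rlim f l -> rlim g l.
Proof.
move=> d0 fg H eps eps0; have [d1 d10 H1] := H eps eps0.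
exists (Rmin d d1); first exact: Rmin_pos.
by move=> s sd; have m1 := Rmin_l d d1; have m2 := Rmin_r d d1; rewrite -fg; [apply: H1|]; lra.
Qed.

Lemma rlim_unique f l m : rlim f l -> rlim f m -> l = m.
Proof.
move=> Hl Hm; apply: contrapT => lm.
have lm0 : l - m <> 0 by move/Csub_eq0.
have p : (0 < Cmod (l - m))%R by apply/Cmod_gt_0.
have [d d0 Hd] := Hl (Cmod (l - m) / 2)%R ltac:(lra).
have [d1 d10 Hd1] := Hm (Cmod (l - m) / 2)%R ltac:(lra).
have m0 := Rmin_pos _ _ d0 d10; have m1 := Rmin_l d d1; have m2 := Rmin_r d d1.
have {}Hd := Hd (Rmin d d1 / 2)%R ltac:(lra); have {}Hd1 := Hd1 (Rmin d d1 / 2)%R ltac:(lra).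
rewrite Cmod_sub_sym in Hd.
by have := Cmod_triangle3 l (f (Rmin d d1 / 2)%R) m; lra.
Qed.

Lemma rlim_const c : rlim (fun=> c) c.
Proof.
move=> eps eps0; exists 1%R; first lra.
by move=> s _; have -> : c - c = 0 by [ring]; rewrite Cmod_0.
Qed.

Lemma rlim_plus f g l m : rlim f l -> rlim g m -> rlim (fun s => f s + g s) (l + m).
Proof.
move=> Hf Hg eps eps0; have [d d0 Hd] := Hf (eps / 2)%R ltac:(lra).
have [d1 d10 Hd1] := Hg (eps / 2)%R ltac:(lra).
exists (Rmin d d1); first exact: Rmin_pos.
move=> s sd; have m1 := Rmin_l d d1; have m2 := Rmin_r d d1.
have {}Hd := Hd s ltac:(lra); have {}Hd1 := Hd1 s ltac:(lra).
have -> : f s + g s - (l + m) = (f s - l) + (g s - m) by ring.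
by apply: Rle_lt_trans (Cmod_triangle _ _) _; lra.
Qed.

Lemma rlim_mult f g l m : rlim f l -> rlim g m -> rlim (fun s => f s * g s) (l * m).
Proof.
move=> Hf Hg eps eps0; set A := (Cmod l + 1)%R; set B := (Cmod m + 1)%R.
have A0 : (0 < A)%R by rewrite /A; have := Cmod_ge_0 l; lra.
have B0 : (0 < B)%R by rewrite /B; have := Cmod_ge_0 m; lra.
have e1 : (0 < eps / 2 / B)%R by apply: Rdiv_lt_0_compat; lra.
have e2 : (0 < Rmin 1 (eps / 2 / A))%R by apply: Rmin_pos; [lra|apply: Rdiv_lt_0_compat; lra].
have [d d0 Hd] := Hf _ e1; have [d1 d10 Hd1] := Hg _ e2.
exists (Rmin d d1); first exact: Rmin_pos.
move=> s sd; have m1 := Rmin_l d d1; have m2 := Rmin_r d d1.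
have {}Hd := Hd s ltac:(lra); have {}Hd1 := Hd1 s ltac:(lra).
have n1 := Rmin_l 1 (eps / 2 / A); have n2 := Rmin_r 1 (eps / 2 / A).
have gB : (Cmod (g s) <= B)%R by rewrite /B; have := Cmod_rev_triangle (g s) m; lra.
have -> : f s * g s - l * m = (f s - l) * g s + l * (g s - m) by ring.
apply: Rle_lt_trans (Cmod_triangle _ _) _; rewrite !Cmod_mult.
have T1 : (Cmod (f s - l) * Cmod (g s) <= Cmod (f s - l) * B)%R.
  by apply: Rmult_le_compat_l => //; apply: Cmod_ge_0.
have T2 : (Cmod (f s - l) * B < eps / 2)%R.
  have -> : (eps / 2 = eps / 2 / B * B)%R by field; lra.
  exact: Rmult_lt_compat_r.
have T3 : (Cmod l * Cmod (g s - m) <= A * (eps / 2 / A))%R.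
  by apply: Rmult_le_compat; [exact: Cmod_ge_0|exact: Cmod_ge_0|rewrite /A; lra|lra].
have E : (A * (eps / 2 / A) = eps / 2)%R by field; lra.
lra.
Qed.

Lemma ccont_rlim f : ccont f 0 -> rlim (fun s => f (RtoC s)) (f 0).
Proof.
move=> H eps /H [d d0 Hd]; exists d => // s sd; apply: Hd.
have -> : RtoC s - 0 = RtoC s by ring.
by rewrite Cmod_R Rabs_right; lra.
Qed.

Definition slim (F : R -> ncseries) (L : ncseries) : Prop :=
  forall w, rlim (fun s => F s w) (L w).

Lemma slim_mul F G L M : slim F L -> slim G M -> slim (fun s => nc_mul (F s) (G s)) (nc_mul L M).
Proof.
move=> HF HG w; elim: w F L HF => [|l w IH] F L HF.
  rewrite nc_mul_nil; apply: rlim_ext_loc Rlt_0_1 _ (rlim_mult (HF [::]) (HG [::])) => s _.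
  by rewrite nc_mul_nil.
rewrite nc_mul_cons; apply: rlim_ext_loc Rlt_0_1 _ (rlim_plus (rlim_mult (HF [::]) (HG (l :: w)))
  (IH (fun s v => F s (l :: v)) (fun v => L (l :: v)) (fun v => HF (l :: v)))) => s _.
by rewrite nc_mul_cons.
Qed.

Lemma slim_subst a F L : slim F L -> slim (fun s => nc_subst a (F s)) (nc_subst a L).
Proof.
move=> HF w; elim: w F L HF => [|l w IH] F L HF; first exact: HF.
apply: rlim_plus; apply: rlim_mult; try exact: rlim_const.
  exact: (IH (fun s v => F s (ord0 :: v)) (fun v => L (ord0 :: v)) (fun v => HF _)).
exact: (IH (fun s v => F s (ord_max :: v)) (fun v => L (ord_max :: v)) (fun v => HF _)).
Qed.

Lemma slim_uexp (ka : C) (A : ncseries) : A [::] = 0 -> slim (fun s => uexp (nc_scale (ka * RtoC s) A)) nc_one.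
Proof.
move=> A0 w; have H := @sderiv_comp_affine (fun u => nc_exp (nc_scale u A)) ka 0 0 _
  (sderiv_exp _ A0) w.
have := ccont_rlim (cderiv_ccont H).
have -> : ka * 0 + 0 = 0 by ring.
rewrite nc_exp_scale0; apply: rlim_ext_loc Rlt_0_1 _ => s _ /=.
by rewrite Cplus_0_r.
Qed.

(* Conjugation by a unipotent series does not change the lowest order part of
   C - 1, however fast the conjugating series grows. *)
Lemma conj_limit_one (A B : R -> useries) (U : R -> useries) (Cc : useries) (d : R) :
  (0 < d)%R -> slim A nc_one -> slim B nc_one ->
  (forall s, (0 < s < d)%R -> B s = (A s * (U s * Cc * (U s)^-1))%g) -> Cc = 1%g.
Proof.
move=> d0 HA HB H; set c := nc_sub Cc nc_one.
suff P n : forall w, (size w < n)%N -> c w = 0.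
  apply: useriesP; apply: nc_ext => w; apply: Csub_eq0.
  exact: (P (size w).+1).
elim: n => [//|n IH] w wn.
(* All coefficients of c at words shorter than w vanish, so neither the conjugation nor the factor A
   s alters its coefficient at w; thus c w is a difference of two functions with the same limit. *)
have K s : (0 < s < d)%R -> c w = ucoef (B s) w - ucoef (A s) w.
  move=> /H ->.
  set X := nc_mul (nc_mul (U s) c) (U s)^-1%g.
  have low v : (size v <= size w)%N -> nc_mul (U s) c v = c v.
    move=> vw; rewrite nc_mul_lowr ?ucoef_nil; first ring.
    by move=> v' vv'; apply: IH; apply: leq_trans vv' (leq_trans vw wn).
  have Xlow v : (size v <= size w)%N -> X v = c v.
    move=> vw; rewrite /X nc_mul_lowl ?ucoef_nil; first by rewrite low //; ring.
    move=> v' vv'; rewrite low; last exact: ltnW (leq_trans vv' vw).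
    by apply: IH; apply: leq_trans vv' (leq_trans vw wn).
  have E : ucoef (U s * Cc * (U s)^-1)%g = nc_add nc_one X.
    have -> : ucoef (U s * Cc * (U s)^-1)%g = nc_mul (nc_mul (U s) Cc) (U s)^-1%g by [].
    have -> : ucoef Cc = nc_add nc_one c.
      by apply: nc_ext => v; rewrite /nc_add /c /nc_sub; ring.
    rewrite nc_mulDr nc_mul1r nc_mulDl; congr nc_add.
    exact: nc_mul_inv (ucoef_nil _).
  have -> : ucoef (A s * (U s * Cc * (U s)^-1))%g = nc_mul (A s) (U s * Cc * (U s)^-1)%g by [].
  rewrite E nc_mulDr nc_mul1r /nc_add nc_mul_lowr ?ucoef_nil.
    by rewrite Xlow //; ring.
  move=> v vw; rewrite Xlow; last exact: ltnW.
  by apply: IH; apply: leq_trans vw wn.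
have L : rlim (fun s => ucoef (B s) w + (-(1)) * ucoef (A s) w) (nc_one w + (-(1)) * nc_one w).
  exact: rlim_plus (HB w) (rlim_mult (rlim_const _) (HA w)).
have L' : rlim (fun s => ucoef (B s) w + (-(1)) * ucoef (A s) w) (c w).
  apply: rlim_ext_loc d0 _ (rlim_const (c w)) => s sd.
  by rewrite (K s sd); ring.
by rewrite (rlim_unique L' L); ring.
Qed.

Lemma F_lim theta F tau (w : ncword) : is_F theta F -> upper_half_plane tau ->
  forall eps : R, (0 < eps)%R -> exists2 d : R, (0 < d)%R &
  forall z, F_domain tau z -> (Cmod z < d)%R ->
    (Cmod (ucoef (F z tau * (uexp (nc_scale (log_m2pii z) nc_t))^-1)%g w - nc_one w) < eps)%R.
Proof.
move=> HF t0 eps eps0.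
have [|d Hd] := F_asymptotics HF t0 (w := w) (P := fun y => Cmod (y - nc_one w) < eps)%R.
  apply: (@locally_le_locally_norm C_AbsRing C_NormedModule).
  by exists (mkposreal _ eps0) => y.
exists d; first exact: cond_pos.
move=> z Fz zd; apply: Hd => //; apply: Cmod_ball.
by have -> : z - 0 = z by ring.
Qed.

Lemma carg_scale (s : R) (w : C) : (0 < s)%R -> carg (RtoC s * w) = carg w.
Proof.
move=> s0; rewrite /carg Cmod_mult Cmod_R Rabs_right; last lra.
have -> : fst (RtoC s * w) = (s * fst w)%R by rewrite /=; ring.
have -> : snd (RtoC s * w) = (s * snd w)%R by rewrite /=; ring.
have -> : (s * fst w / (s * Cmod w) = fst w / Cmod w)%R.
  have [m0|m0] := Req_dec (Cmod w) 0; last by field; lra.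
  by rewrite m0 Rmult_0_r /Rdiv Rinv_0; ring.
case: (Rlt_dec 0 (s * snd w)) => p; case: (Rlt_dec 0 (snd w)) => q //.
  by case: q; apply: (Rmult_lt_reg_l s) => //; lra.
by case: p; apply: Rmult_lt_0_compat.
Qed.

Lemma clog_pos (s : R) : (0 < s)%R -> clog s = RtoC (ln s).
Proof.
move=> s0; rewrite /clog /carg Cmod_R Rabs_right; last lra.
rewrite [snd _]/= [fst _]/=; case: (Rlt_dec 0 0) => p; first by case: (Rlt_irrefl 0 p).
rewrite [is_left _]/=.
by rewrite Rdiv_diag ?acos_1 ?Ropp_0 //; lra.
Qed.

(** Scaling by s > 0 keeps the argument, so no multiple of 2 pi i appears; with w = 1 / j this
    yields the exponent in [Q]. *)
Lemma clog_scale (s : R) (w : C) : (0 < s)%R -> w <> 0 -> clog (RtoC s * w) = clog s + clog w.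
Proof.
move=> s0 w0; rewrite (clog_pos s0) /clog carg_scale // Cmod_mult Cmod_R Rabs_right; last lra.
by rewrite ln_mult //; [rewrite /Cplus /=; congr pair; ring|apply/Cmod_gt_0].
Qed.

(** At u = ad x, the factor exp(nu u) between the two kernels becomes conjugation by exp(nu x). *)
Lemma kernel_conj (k k' : C -> C) (c c' : nat -> C) (j nu : C) (d : R) : j <> 0 -> (0 < d)%R ->
  tay k c -> tay k' c' ->
  (forall u : C, u <> 0 -> (Cmod u < d)%R -> k' u = cexp (nu * u) * k (j * u)) ->
  nc_mul (nc_exp (nc_scale (- nu) ncX)) (nc_ad_series c' ncX ncY) =
  nc_mul (nc_ad_series (fun n => j ^ n * c n) ncX ncY) (nc_exp (nc_scale (- nu) ncX)).
Proof.
move=> j0 d0 T T' H.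
have E : c' =1 conv (expc nu) (fun n => j ^ n * c n).
  apply: tay_unique T' _.
  apply: tay_ext_loc d0 _ (tay_mult (tay_cexp_lin nu) (tay_scale j0 T)) => u u0 ud.
  by rewrite H.
have -> : nc_ad_series c' ncX ncY = nc_ad_series (conv (expc nu) (fun n => j ^ n * c n)) ncX ncY.
  by rewrite !nc_adE; apply: nc_ser_ext.
have EI be : nc_mul (nc_exp (nc_scale (- be) ncX)) (nc_exp (nc_scale be ncX)) = nc_one.
  have := uexpD (A := ncX) (- be) be ncX_nil.
  have -> : - be + be = 0 by ring.
  by rewrite uexp0 => /(f_equal ucoef).
have EI' := EI (- nu); rewrite Copp_opp in EI'.
rewrite -[LHS]nc_mul1r -EI' nc_mulA -(nc_mulA (nc_exp _)) ad_series_exp //.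
by rewrite nc_mulA EI nc_mul1l.
Qed.

Lemma F_sderiv theta F tau z : is_theta theta -> is_F theta F -> upper_half_plane tau ->
  F_domain tau z -> exists c, [/\ tay (kernel (fun z => theta z tau) z) c, c 0%N = 1 &
    sderiv (fun z' => F z' tau) z (nc_scale (-(1)) (nc_mul (nc_ad_series c ncX ncY) (F z tau)))].
Proof.
move=> Ht HF t0 Fz; have [c /taylor_tay T D] := F_ode HF t0 Fz.
have TL := is_theta_theta_like Ht HF t0.
have z0 : theta z tau <> 0 by move/(tl_zeros TL); exact: F_domain_lattice.
exists c; split=> //.
  apply: kernel_coef0 (tl_derive0 TL) z0 (tl_diff TL z) T.
  exact/(tl_zeros TL)/lattice0.
move=> w; have /cderiv_is := D w; congr cderiv; rewrite /nc_scale; ring.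
Qed.

Lemma nc_ad_nil c : nc_ad_series c ncX ncY [::] = 0.
Proof. by rewrite nc_adE /nc_ser /= /nc_add /nc_scale /nc_zero /ncY /nc_letter /=; ring. Qed.

(** * Comparison of F at two related moduli *)

Section Compare.
Variables (theta : C -> C -> C) (F : C -> C -> useries).
Hypotheses (Ht : is_theta theta) (HF : is_F theta F).
Variables (tau tau' j al : C).
Hypotheses (t0 : upper_half_plane tau) (t0' : upper_half_plane tau') (j0 : j <> 0).
Hypothesis theta_rel : forall z, theta z tau = j * cexp (al * (z * z)) * theta (z / j) tau'.

(** The Gaussian contributes exp(mu z u) to the kernel. In both applications mu is the entry 2 pi i
    gamma of a(gbar, tau). *)
Let mu := - (RtoC 2 * al * j).
Let a := mx2 j 0 mu (/ j).
Let G (z : C) : useries := usubst a (F z tau).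
Let H (z : C) : useries := (uexp (nc_scale (- mu * z) ncX) * F (z / j)%C tau')%g.
Let Q : useries := uexp (nc_scale (clog (/ j)) nc_t).

Lemma kernel_rel (z u : C) : u <> 0 -> theta (z / j) tau' <> 0 -> theta u tau' <> 0 ->
  kernel (fun z => theta z tau') (z / j) u =
  cexp (mu * z * u) * kernel (fun z => theta z tau) z (j * u).
Proof.
move=> u0 tz tu; rewrite /kernel !theta_rel.
have -> : (z + j * u) / j = z / j + u by field.
have -> : j * u / j = u by field.
have -> : al * ((z + j * u) * (z + j * u)) = al * (z * z) + al * (j * u * (j * u)) - mu * z * u.
  by rewrite /mu; have -> : RtoC 2 = 1 + 1 by [rewrite -RtoC_plus]; ring.
rewrite /Cminus !cexp_add.
have n1 := @cexp_neq0 (al * (z * z)); have n2 := @cexp_neq0 (al * (j * u * (j * u))).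
have := cexp_opp (mu * z * u); set e1 := cexp (- _); set e2 := cexp (mu * z * u) => e12.
have -> : e2 * (j * (cexp (al * (z * z)) * cexp (al * (j * u * (j * u))) * e1) * theta (z / j + u) tau' * (j * u) /
   (j * cexp (al * (z * z)) * theta (z / j) tau' * (j * cexp (al * (j * u * (j * u))) * theta u tau'))) =
   (e1 * e2) * (theta (z / j + u) tau' * u / (theta (z / j) tau' * theta u tau')).
  by field; do !split.
by rewrite e12; ring.
Qed.

(** On one side the substitution adds the term mu x to the kernel series, as its constant
    coefficient is 1; on the other side the derivative of exp(- mu z x) supplies the same term. *)
Lemma compare_ode z : F_domain tau z -> F_domain tau' (z / j) ->
  exists K : ncseries, [/\ K [::] = 0,
    sderiv G z (nc_scale (-(1)) (nc_mul K (G z))) &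
    sderiv H z (nc_scale (-(1)) (nc_mul K (H z)))].
Proof.
move=> Fz Fz'.
have [c [T c0 D]] := F_sderiv Ht HF t0 Fz.
have [c' [T' _ D']] := F_sderiv Ht HF t0' Fz'.
have TL' := is_theta_theta_like Ht HF t0'.
have tz : theta (z / j) tau' <> 0 by move/(tl_zeros TL'); exact: F_domain_lattice.
have [d d0 Hd] := deriv1_near (proj2 (tl_zeros TL' 0) (lattice0 tau')) (tl_derive0 TL').
have KC := @kernel_conj _ _ c c' j (mu * z) d j0 d0 T T'
  (fun u u0 ud => kernel_rel u0 tz (proj1 (Hd u u0 ud))).
set K0 := nc_ad_series (fun n => j ^ n * c n) ncX ncY in KC.
exists (nc_add (nc_scale mu ncX) (nc_scale (/ j) K0)); split.
- by rewrite /nc_add /nc_scale /K0 nc_ad_nil ncX_nil; ring.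
- have := sderiv_subst a D; rewrite nc_substZ nc_substM subst_ad_series //.
- have DE := @sderiv_comp_affine (fun u => nc_exp (nc_scale u ncX)) (- mu) 0 z _ (sderiv_exp _ ncX_nil).
  have DF := @sderiv_comp_affine (fun u => F u tau') (/ j) 0 z
     (nc_scale (-(1)) (nc_mul (nc_ad_series c' ncX ncY) (F (z / j) tau'))).
  have zj : / j * z + 0 = z / j by rewrite /Cdiv; ring.
  rewrite zj in DF; have := sderiv_mul DE (DF D').
  have mz : - mu * z + 0 = - mu * z by ring.
  rewrite mz zj.
  set E := nc_exp (nc_scale (- mu * z) ncX); set Fz1 := F (z / j) tau'.
  have EK : nc_mul E (nc_ad_series c' ncX ncY) = nc_mul K0 E.
    by rewrite /E; have -> : - mu * z = - (mu * z) by ring.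
  have -> : nc_add (nc_mul (nc_scale (- mu) (nc_mul ncX E)) Fz1)
      (nc_mul E (nc_scale (/ j) (nc_scale (- (1)) (nc_mul (nc_ad_series c' ncX ncY) Fz1)))) =
    nc_scale (-(1)) (nc_mul (nc_add (nc_scale mu ncX) (nc_scale (/ j) K0)) (H z)).
    have -> : ucoef (H z) = nc_mul E Fz1 by [].
    rewrite nc_mulZl !(nc_mulZr _ E) (nc_mulA E) EK nc_mulDl !nc_mulZl.
    rewrite (nc_mulA ncX) (nc_mulA K0).
    by apply: nc_ext => w; rewrite /nc_add /nc_scale; ring.
  apply: sderiv_ext => u; rewrite /H /= Cplus_0_r; congr nc_mul.
  by rewrite /Cdiv Cplus_0_r Cmult_comm.
Qed.

(** Two convex pieces, as required by [ode_unique], with the common point z1. V1 reaches 0 along ]0,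
    1[, where the constant is read off; through z1 the same constant holds on V2. *)
Variables (V1 V2 : C -> Prop) (z1 : C).
Hypotheses (cv1 : convex V1) (cv2 : convex V2) (V1z : V1 z1) (V2z : V2 z1).
Hypothesis dom : forall z, V1 z \/ V2 z -> F_domain tau z /\ F_domain tau' (z / j).
Hypothesis V1_pos : forall s : R, (0 < s < 1)%R -> V1 (RtoC s).

Lemma compare_const : ((G z1)^-1 * H z1)%g = Q.
Proof.
set Cc := (_ * _)%g.
have HGC s : (0 < s < 1)%R -> H (RtoC s) = (G (RtoC s) * Cc)%g.
  move=> /V1_pos Vs; apply: (@ode_unique V1) => // z Vz.
  by have [Fz Fz'] := dom (or_introl Vz); apply: compare_ode.
pose E (z : C) := uexp (nc_scale (log_m2pii z) nc_t).
suff : (Cc * Q^-1 = 1)%g by move=> E1; rewrite -[LHS](mulgVK Q) E1 mul1g.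
have ji : / j <> 0 by move=> e; have : j * / j = 1 by [field]; rewrite e Cmult_0_r => -[]; lra.
have EQ s : (0 < s)%R -> E (RtoC s / j) = (E (RtoC s) * Q)%g.
  move=> s0; rewrite /E /Q -uexpD ?nc_t_nil //; congr (uexp (nc_scale _ _)).
  by rewrite /log_m2pii /Cdiv clog_scale //; ring.
(* Both families tend to 1 by the asymptotics of F. As a fixes t, the second one is the first times
   the conjugate of Cc Q^-1 by E s = (-2 pi i s)^t. *)
apply: (@conj_limit_one (fun s => usubst a (F (RtoC s) tau * (E (RtoC s))^-1)%g)
  (fun s => uexp (nc_scale (- mu * RtoC s) ncX) * (F (RtoC s / j)%C tau' * (E (RtoC s / j)%C)^-1))%g
  (fun s => E (RtoC s)) _ 1%R Rlt_0_1).
- rewrite -(nc_subst1 a); apply: slim_subst => w eps eps0.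
  have [d d0 Hd] := F_lim w HF t0 eps0; exists (Rmin d 1); first by apply: Rmin_pos; lra.
  move=> s sd; have m1 := Rmin_l d 1; have m2 := Rmin_r d 1.
  apply: Hd; first by case: (dom (or_introl (V1_pos (s := s) ltac:(lra)))).
  by rewrite Cmod_R Rabs_right; lra.
- rewrite -(nc_mul1l nc_one); apply: slim_mul; first exact: slim_uexp.
  move=> w eps eps0.
  have [d d0 Hd] := F_lim w HF t0' eps0.
  have j1 : (0 < Cmod j)%R by apply/Cmod_gt_0.
  exists (Rmin (d * Cmod j) 1).
    by apply: Rmin_pos; [apply: Rmult_lt_0_compat|lra].
  move=> s sd; have m1 := Rmin_l (d * Cmod j) 1; have m2 := Rmin_r (d * Cmod j) 1.
  apply: Hd; first by case: (dom (or_introl (V1_pos (s := s) ltac:(lra)))).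
  rewrite Cmod_div // Cmod_R Rabs_right; last lra.
  apply: (Rmult_lt_reg_r (Cmod j)) => //; rewrite /Rdiv Rmult_assoc Rinv_l; lra.
- move=> s s1; have := HGC s s1; rewrite /H /G => HG.
  rewrite mulgA HG EQ; last lra.
  rewrite usubstM usubstV subst_uexp_t // -/(E s) invgM !mulgA.
  by rewrite mulgVK.
Qed.

Lemma F_transform z : V1 z \/ V2 z -> F (z / j) tau' =
  (uexp (nc_scale (mu * z) ncX) * usubst a (F z tau) * uexp (nc_scale (clog (/ j)) nc_t))%g.
Proof.
move=> Vz; suff : H z = (G z * Q)%g.
  rewrite /H /G -/Q => HG; rewrite -mulgA -HG mulgA -uexpD //.
  have -> : mu * z + - mu * z = 0 by ring.
  by rewrite uexp0 mul1g.
rewrite -compare_const; case: Vz => Vz.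
  apply: (@ode_unique V1) => // u Vu.
  by have [Fz Fz'] := dom (or_introl Vu); apply: compare_ode.
apply: (@ode_unique V2) => // u Vu.
by have [Fz Fz'] := dom (or_intror Vu); apply: compare_ode.
Qed.

End Compare.

(** * The cocycle *)

Lemma Im_gt0_neq0 (z : C) : upper_half_plane z -> z <> 0.
Proof. by move=> h E; move: h; rewrite E /upper_half_plane /=; lra. Qed.

Lemma mx2_eta (S : pzRingType) (M : 'M[S]_2) :
  M = mx2 (M ord0 ord0) (M ord0 ord_max) (M ord_max ord0) (M ord_max ord_max).
Proof.
by apply/matrixP => i j; rewrite !mxE; case: (ord2P i) => ->; case: (ord2P j) => ->.
Qed.

Definition jfac (M : 'M[Z]_2) (tau : C) : C := Mgamma M * tau + Mdelta M.

Lemma IZR_ringD (x y : Z) : IZR (x + y)%ring = (IZR x + IZR y)%R.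
Proof. exact: plus_IZR. Qed.
Lemma IZR_ringM (x y : Z) : IZR (x * y)%ring = (IZR x * IZR y)%R.
Proof. exact: mult_IZR. Qed.
Lemma IZR_ringB (x y : Z) : IZR (x - y)%ring = (IZR x - IZR y)%R.
Proof. exact: minus_IZR. Qed.

Lemma det_coords (M : 'M[Z]_2) : (\det M = 1)%ring ->
  Malpha M * Mdelta M - Mbeta M * Mgamma M = 1.
Proof.
rewrite {1}[M]mx2_eta det_mx2 => /(f_equal IZR).
rewrite IZR_ringB !IZR_ringM /Malpha /Mbeta /Mgamma /Mdelta -!RtoC_mult -RtoC_minus => ->.
by [].
Qed.

Lemma mulmx2E (S : pzRingType) (M N : 'M[S]_2) i k :
  ((M *m N) i k = M i ord0 * N ord0 k + M i ord_max * N ord_max k)%ring.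
Proof.
rewrite !mxE big_ord_recl big_ord1; congr (_ + M i _ * N _ k)%ring; exact: val_inj.
Qed.

Lemma mulmx_coords (M N : 'M[Z]_2) :
  [/\ Malpha (M *m N)%ring = Malpha M * Malpha N + Mbeta M * Mgamma N,
      Mbeta (M *m N)%ring = Malpha M * Mbeta N + Mbeta M * Mdelta N,
      Mgamma (M *m N)%ring = Mgamma M * Malpha N + Mdelta M * Mgamma N &
      Mdelta (M *m N)%ring = Mgamma M * Mbeta N + Mdelta M * Mdelta N].
Proof.
by rewrite /Malpha /Mbeta /Mgamma /Mdelta !mulmx2E !IZR_ringD !IZR_ringM !RtoC_plus !RtoC_mult.
Qed.

Lemma jfac_neq0 (M : 'M[Z]_2) tau : (\det M = 1)%ring -> upper_half_plane tau -> jfac M tau <> 0.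
Proof.
move=> /det_coords; rewrite /jfac /Malpha /Mbeta /Mgamma /Mdelta.
set a := IZR _; set d := IZR _; set b := IZR _; set c := IZR _.
case: tau => x y; rewrite /upper_half_plane /Im /= => -[D _] y0 [E1 E2].
have c0 : c = 0%R by apply: (Rmult_eq_reg_r y); lra.
by move: D E1; rewrite c0; nra.
Qed.

Lemma uhp_mobius (M : 'M[Z]_2) tau : (\det M = 1)%ring -> upper_half_plane tau ->
  upper_half_plane (mobius M tau).
Proof.
move=> dM t0; have := jfac_neq0 dM t0; have := det_coords dM.
rewrite /mobius /jfac /Malpha /Mbeta /Mgamma /Mdelta.
set a := IZR _; set d := IZR _; set b := IZR _; set c := IZR _.
case: tau t0 => x y; rewrite /upper_half_plane /Im /= => y0 [D _] j0.
have D' : (a * d - b * c = 1)%R by lra.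
set n := ((c * x - 0 * y + d) * ((c * x - 0 * y + d) * 1) + (c * y + 0 * x + 0) * ((c * y + 0 * x + 0) * 1))%R.
have n0 : (0 < n)%R.
  apply: Rnot_le_lt => n0; apply: j0.
  have s1 := Rle_0_sqr (c * x - 0 * y + d); have s2 := Rle_0_sqr (c * y + 0 * x + 0).
  rewrite /n !Rmult_1_r in n0; rewrite /Rsqr in s1 s2.
  have e1 : (c * x - 0 * y + d = 0)%R by apply: Rsqr_0_uniq; rewrite /Rsqr; lra.
  have e2 : (c * y + 0 * x + 0 = 0)%R by apply: Rsqr_0_uniq; rewrite /Rsqr; lra.
  by rewrite /Cplus /Cmult /= e1 e2.
have -> : ((a * x - 0 * y + b) * (- (c * y + 0 * x + 0) / n) +
  (a * y + 0 * x + 0) * ((c * x - 0 * y + d) / n) = (a * d - b * c) * y / n)%R.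
  by field; lra.
by rewrite D'; apply: Rdiv_lt_0_compat; lra.
Qed.

Lemma mobius_comp (M N : 'M[Z]_2) tau : (\det M = 1)%ring -> (\det N = 1)%ring ->
  upper_half_plane tau -> mobius (M *m N)%ring tau = mobius M (mobius N tau).
Proof.
move=> dM dN t0; have jN := jfac_neq0 dN t0; have jM := jfac_neq0 dM (uhp_mobius dN t0).
have [e1 e2 e3 e4] := mulmx_coords M N.
move: jM jN; rewrite /jfac /mobius e1 e2 e3 e4.
set a := Malpha M; set b := Mbeta M; set c := Mgamma M; set d := Mdelta M.
set a' := Malpha N; set b' := Mbeta N; set c' := Mgamma N; set d' := Mdelta N.
move=> jM jN; have E : (c * a' + d * c') * tau + (c * b' + d * d') =
  (c * ((a' * tau + b') / (c' * tau + d')) + d) * (c' * tau + d') by field.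
have jj : (c * a' + d * c') * tau + (c * b' + d * d') <> 0.
  by rewrite E; apply: Cmult_neq_0.
have jM' : c * (a' * tau + b') + d * (c' * tau + d') <> 0.
  by move=> K; apply: jj; rewrite -K; ring.
by field; do !split.
Qed.

Lemma IZR1 : IZR (1%ring : Z) = 1%R. Proof. by []. Qed.
Lemma IZR0 : IZR (0%ring : Z) = 0%R. Proof. by []. Qed.
Lemma IZRm1 : IZR (-1 : Z)%ring = (-1)%R. Proof. by []. Qed.

Lemma mobius1 tau : mobius 1%:M%ring tau = tau.
Proof.
rewrite /mobius /Malpha /Mbeta /Mgamma /Mdelta -mx2_id !mxE /= !IZR1 !IZR0.
by field; move=> []; lra.
Qed.

Lemma mobius_T tau : mobius (mx2 1 1 0 1)%ring tau = tau + 1.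
Proof.
rewrite /mobius /Malpha /Mbeta /Mgamma /Mdelta !mxE /= !IZR1 !IZR0.
by field; move=> []; lra.
Qed.

Lemma mobius_S tau : mobius (mx2 1 0 (-1) 1)%ring tau = tau / (1 - tau).
Proof.
rewrite /mobius /Malpha /Mbeta /Mgamma /Mdelta !mxE /= !IZR1 !IZR0 !IZRm1.
have -> : RtoC 1 * tau + 0 = tau by ring.
have -> : RtoC (-1) = - RtoC 1 by rewrite -RtoC_opp.
by have -> : - RtoC 1 * tau + 1 = 1 - tau by ring.
Qed.

Lemma B3_ind (P : B3 -> Prop) : P 1%g -> P sigma1 -> P sigma2 ->
  (forall g h, P g -> P h -> P (g * h)%g) -> (forall g, P g -> P g^-1%g) -> forall g, P g.
Proof.
move=> P1 Ps1 Ps2 PM PV g; rewrite -[g]braid_class_repr.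
elim: (repr g) => [//|[b e] w IH].
have -> : braid_class ((b, e) :: w) = (braid_class [:: (b, e)] * braid_class w)%g.
  by rewrite [RHS]B3_mulE.
apply: PM IH.
suff : P (braid_class [:: (b, false)]).
  case: e => // Pb.
  have -> : braid_class [:: (b, true)] = (braid_class [:: (b, false)])^-1%g.
    rewrite -[LHS](mulgK (braid_class [:: (b, false)])).
    have -> : (braid_class [:: (b, true)] * braid_class [:: (b, false)] = 1)%g.
      by rewrite [LHS]B3_mulE; apply/braid_classP; exact: (braid_eq_cancel b true).
    by rewrite mul1g.
  exact: PV.
by case: b.
Qed.

Lemma sl2_bar_one : sl2_bar 1%g = 1%:M%ring.
Proof. exact: (sl2_bar_class [::]). Qed.

Lemma mobiusM g h tau : upper_half_plane tau ->
  mobius (sl2_bar (g * h)%g) tau = mobius (sl2_bar g) (mobius (sl2_bar h) tau).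
Proof. by move=> t0; rewrite sl2_barM mobius_comp // det_sl2_bar. Qed.

Lemma uhp_bar g tau : upper_half_plane tau -> upper_half_plane (mobius (sl2_bar g) tau).
Proof. exact/uhp_mobius/det_sl2_bar. Qed.

Lemma mobius_bar1 tau : mobius (sl2_bar 1%g) tau = tau.
Proof. by rewrite sl2_bar_one mobius1. Qed.

Lemma mobiusVK g tau : upper_half_plane tau ->
  mobius (sl2_bar g) (mobius (sl2_bar g^-1%g) tau) = tau.
Proof. by move=> t0; rewrite -mobiusM // mulgV mobius_bar1. Qed.

Lemma cocycle1 f tau : is_cocycle f -> upper_half_plane tau -> f 1%g tau = 0.
Proof.
move=> Hf t0; have := cocycle_mul Hf 1%g 1%g t0; rewrite mulg1 mobius_bar1 => E.
by have -> : f 1%g tau = (f 1%g tau + f 1%g tau) - f 1%g tau by [ring]; rewrite -E; ring.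
Qed.

Lemma cocycleV f g tau : is_cocycle f -> upper_half_plane tau ->
  f g^-1%g tau = - f g (mobius (sl2_bar g^-1%g) tau).
Proof.
move=> Hf t0; have := cocycle_mul Hf g g^-1%g t0; rewrite mulgV cocycle1 // => E.
have -> : f g^-1%g tau = (f g (mobius (sl2_bar g^-1%g) tau) + f g^-1%g tau) - f g (mobius (sl2_bar g^-1%g) tau) by ring.
by rewrite -E; ring.
Qed.

Lemma cocycle_unique f f' : is_cocycle f -> is_cocycle f' ->
  forall g tau, upper_half_plane tau -> f' g tau = f g tau.
Proof.
move=> Hf Hf'; apply: B3_ind => [tau t0|tau t0|tau t0|g h Hg Hh tau t0|g Hg tau t0].
- by rewrite !cocycle1.
- by rewrite !cocycle_sigma1.
- by rewrite !cocycle_sigma2.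
- by rewrite !cocycle_mul // Hh // Hg //; apply: uhp_bar.
- by rewrite !cocycleV // Hg //; apply: uhp_bar.
Qed.

(** * The logarithm on the upper half-plane and the construction of the cocycle *)

Lemma uhp_carg z : upper_half_plane z ->
  [/\ (0 < carg z < PI)%R, cos (carg z) = (fst z / Cmod z)%R & sin (carg z) = (snd z / Cmod z)%R].
Proof.
move=> z0; have zn0 := Im_gt0_neq0 z0; have m0 : (0 < Cmod z)%R by apply/Cmod_gt_0.
have y0 : (0 < snd z)%R := z0.
rewrite /carg; case: (Rlt_dec 0 (snd z)) => p; last by case: p.
rewrite [is_left _]/=; set q := (fst z / Cmod z)%R.
have n2 : (Cmod z ^ 2 = fst z ^ 2 + snd z ^ 2)%R := Cmod2_alt z.
have q2 : (1 - Rsqr q = Rsqr (snd z / Cmod z))%R.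
  rewrite /q !Rsqr_div'; have E : (Rsqr (Cmod z) = Rsqr (fst z) + Rsqr (snd z))%R.
    by rewrite /Rsqr; rewrite /= in n2; lra.
  have : (0 < Rsqr (Cmod z))%R by apply: Rlt_0_sqr; lra.
  by move=> r0; field_simplify_eq; [rewrite E; ring|lra].
have s0 : (0 < snd z / Cmod z)%R by apply: Rdiv_lt_0_compat.
have q1 : (-1 < q < 1)%R.
  have : (0 < Rsqr (snd z / Cmod z))%R by apply: Rlt_0_sqr; lra.
  by rewrite -q2 /Rsqr => ?; split; nra.
split.
- exact: acos_bound_lt.
- by apply: cos_acos; lra.
- rewrite sin_acos; last lra.
  by rewrite q2 sqrt_Rsqr //; lra.
Qed.

(** The arguments of u and v lie in ]0, pi[. If u v is in the half-plane too, the sine of their sum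
    is positive, which forces the sum below pi. *)
Lemma clogM u v : upper_half_plane u -> upper_half_plane v -> upper_half_plane (u * v) ->
  clog (u * v) = clog u + clog v.
Proof.
move=> u0 v0 uv0; have [[a1 a2] a3 a4] := uhp_carg u0; have [[b1 b2] b3 b4] := uhp_carg v0.
have [[c1 c2] c3 c4] := uhp_carg uv0.
have mu : (0 < Cmod u)%R by apply/Cmod_gt_0/Im_gt0_neq0.
have mv : (0 < Cmod v)%R by apply/Cmod_gt_0/Im_gt0_neq0.
have C1 : cos (carg u + carg v) = cos (carg (u * v)).
  rewrite cos_plus a3 a4 b3 b4 c3 Cmod_mult /=; field; lra.
have S1 : sin (carg u + carg v) = sin (carg (u * v)).
  rewrite sin_plus a3 a4 b3 b4 c4 Cmod_mult /=; field; lra.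
have A : carg (u * v) = (carg u + carg v)%R.
  have sp : (0 < sin (carg u + carg v))%R by rewrite S1; apply: sin_gt_0.
  have l : (carg u + carg v < PI)%R.
    apply: Rnot_le_lt => ge; have := sin_le_0 _ ge; lra.
  rewrite -(acos_cos (carg u + carg v)); last lra.
  by rewrite C1 acos_cos //; lra.
by rewrite /clog A Cmod_mult ln_mult.
Qed.

Lemma uhp_minv w : upper_half_plane w -> upper_half_plane (-(1) / w).
Proof.
case: w => x y; rewrite /upper_half_plane /Im /= => y0.
have n0 : (0 < x * (x * 1) + y * (y * 1))%R.
  have : (0 < y * y)%R by apply: Rmult_lt_0_compat.
  by have := Rle_0_sqr x; rewrite /Rsqr; lra.
have -> : (- (1) * (- y / (x * (x * 1) + y * (y * 1))) + - 0 * (x / (x * (x * 1) + y * (y * 1))) =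
  y / (x * (x * 1) + y * (y * 1)))%R by field; lra.
exact: Rdiv_lt_0_compat.
Qed.

Lemma uhp_sub1 x : upper_half_plane x -> upper_half_plane (x - 1).
Proof. by case: x => a b; rewrite /upper_half_plane /Im /=; lra. Qed.

Lemma uhp_1sub_neq0 x : upper_half_plane x -> 1 - x <> 0.
Proof.
move=> /uhp_sub1/Im_gt0_neq0 H E; apply: H.
have -> : x - 1 = - (1 - x) by ring.
by rewrite E; ring.
Qed.

(** The value on the inverse of sigma_2 is forced by the cocycle identity for sigma_2 sigma_2^-1 =
    1. *)
Definition log_letter (l : braid_letter) (x : C) : C :=
  match l with
  | (false, _) => 0
  | (true, false) => - clog (-(1) / (x - 1))
  | (true, true) => clog (-(1) / (mobius (sl2_letter (true, true)) x - 1))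
  end.

(* Words act on pairs (tau, value), the value accumulating the cocycle; the
   action is trivial off the upper half plane, so that the braid relations hold
   for all pairs. *)
Definition cocycle_act (l : braid_letter) (p : C * C) : C * C :=
  if `[< upper_half_plane p.1 >]
  then (mobius (sl2_letter l) p.1, p.2 + log_letter l p.1) else p.

Lemma det_sl2_letter l : (\det (sl2_letter l) = 1)%ring.
Proof. by case: l => -[] []; rewrite /= det_mx2. Qed.

Lemma cocycle_actE l tau v : upper_half_plane tau ->
  cocycle_act l (tau, v) = (mobius (sl2_letter l) tau, v + log_letter l tau).
Proof. by move=> t0; rewrite /cocycle_act asboolT. Qed.

Lemma mobius_letterK b e tau : upper_half_plane tau ->
  mobius (sl2_letter (b, e)) (mobius (sl2_letter (b, ~~ e)) tau) = tau.
Proof.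
move=> t0; rewrite -mobius_comp //; try exact: det_sl2_letter.
have -> : (sl2_letter (b, e) *m sl2_letter (b, ~~ e) = 1%:M)%ring.
  by case: b; case: e; rewrite /= mulmx_mx2 /= mx2_id.
exact: mobius1.
Qed.

Lemma cocycle_actK b e p : cocycle_act (b, e) (cocycle_act (b, ~~ e) p) = p.
Proof.
case: p => tau v; have [t0|t0] := EM (upper_half_plane tau); last first.
  by rewrite {2}/cocycle_act asboolF // /cocycle_act asboolF.
have t1 := uhp_mobius (det_sl2_letter (b, ~~ e)) t0.
rewrite !cocycle_actE // mobius_letterK //; congr pair.
have K := mobius_letterK true true t0; rewrite [~~ true]/= in K.
case: b {t1}; last by rewrite /=; ring.
case: e; last by rewrite /=; ring.
by rewrite -[~~ true]/false /log_letter K; ring.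
Qed.

Lemma cocycle_act_braid p :
  cocycle_act (false, false) (cocycle_act (true, false) (cocycle_act (false, false) p)) =
  cocycle_act (true, false) (cocycle_act (false, false) (cocycle_act (true, false) p)).
Proof.
case: p => x v; have [x0|x0] := EM (upper_half_plane x); last first.
  by rewrite /cocycle_act !asboolF.
have H l y : upper_half_plane y -> upper_half_plane (mobius (sl2_letter l) y).
  by apply: uhp_mobius; apply: det_sl2_letter.
rewrite !cocycle_actE; try exact: (H _ _ (H _ _ x0)); try exact: (H _ _ x0); try exact: x0.
have ET y : mobius (sl2_letter (false, false)) y = y + 1 by exact: mobius_T.
have ES y : mobius (sl2_letter (true, false)) y = y / (1 - y) by exact: mobius_S.
have n0 := Im_gt0_neq0 x0; have n1 := uhp_1sub_neq0 x0.
have n2 : x - 1 <> 0 by exact/Im_gt0_neq0/uhp_sub1.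
rewrite !ET !ES /log_letter; congr pair.
  have e1 : 1 - (x + 1) = - x by ring.
  have e2 : x / (1 - x) + 1 = / (1 - x) by field.
  have e3 : 1 - / (1 - x) = - x / (1 - x) by field.
  have nx : - x <> 0 by move=> E; apply: n0; rewrite -[x]Copp_opp E; ring.
  by rewrite e1 e2 e3; field; do ?split.
have -> : x + 1 - 1 = x by ring.
have -> : x / (1 - x) + 1 - 1 = x / (1 - x) by ring.
(* The braid relation comes down to this factorization: all three quotients lie in the upper
   half-plane, so [clogM] applies. *)
have E : -(1) / x = -(1) / (x - 1) * (-(1) / (x / (1 - x))) by field; do !split.
have u1 := uhp_minv x0; have u2 := uhp_minv (uhp_sub1 x0); have u3 := uhp_minv (uhp_S x0).
by rewrite [in LHS]E clogM -?E //; ring.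
Qed.

Definition bar_word (w : braid_word) : 'M[Z]_2 := foldr (fun l M => (sl2_letter l *m M)%ring) 1%:M%ring w.

(** The accumulated value is additive in its initial value; for a concatenation of words this is the
    cocycle identity. *)
Lemma foldr_cocycle_act w tau v : upper_half_plane tau ->
  foldr cocycle_act (tau, v) w =
  (mobius (bar_word w) tau, (foldr cocycle_act (tau, RtoC 0) w).2 + v).
Proof.
move=> t0; have dw u : (\det (bar_word u) = 1)%ring by rewrite -[bar_word u]sl2_bar_class det_sl2_bar.
have H u x : (foldr cocycle_act (tau, x) u).1 = mobius (bar_word u) tau.
  elim: u => [|l u IH] /=; first by rewrite mobius1.
  rewrite mobius_comp //; last exact: det_sl2_letter.
  case E : (foldr _ _ _) IH => [y z] /= ->.
  by rewrite cocycle_actE //; apply: uhp_mobius.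
elim: w => [|l w IH]; first by rewrite /= mobius1; congr pair; ring.
have t1 := uhp_mobius (dw w) t0.
have H0 := H w 0; rewrite [foldr _ _ (l :: w)]/= IH cocycle_actE //.
have -> : (foldr cocycle_act (tau, RtoC 0) (l :: w)).2 =
  (foldr cocycle_act (tau, RtoC 0) w).2 + log_letter l (mobius (bar_word w) tau).
  rewrite /=; case E : (foldr _ _ _) H0 => [y z] /= ->.
  by rewrite cocycle_actE.
congr pair; last by ring.
by rewrite /= mobius_comp //; apply: det_sl2_letter.
Qed.

Definition cocycle (g : B3) (tau : C) : C := (foldr cocycle_act (tau, RtoC 0) (repr g)).2.

Lemma cocycle_class w tau :
  cocycle (braid_class w) tau = (foldr cocycle_act (tau, RtoC 0) w).2.
Proof.
by rewrite /cocycle (foldr_braid_eq cocycle_actK cocycle_act_braid (braid_repr w)).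
Qed.

Lemma cocycleP : is_cocycle cocycle.
Proof.
split=> [tau t0|tau t0|g h tau t0].
- by rewrite cocycle_class /= cocycle_actE //= ; ring.
- by rewrite cocycle_class /= cocycle_actE //= ; ring.
- rewrite -[g]braid_class_repr -[h]braid_class_repr [(_ * _)%g]B3_mulE !cocycle_class.
  rewrite foldr_cat (foldr_cocycle_act (repr h)) // foldr_cocycle_act.
    have -> : sl2_bar (braid_class (repr h)) = bar_word (repr h) by exact: sl2_bar_class.
    by rewrite /=; ring.
  rewrite -[bar_word _]sl2_bar_class; exact: uhp_bar.
Qed.

(** * The map e *)

Definition region (P : R -> R -> Prop) (tau z : C) : Prop :=
  exists a b : R, z = RtoC a + RtoC b * tau /\ P a b.

Lemma convex_region (P : R -> R -> Prop) tau :
  (forall a b a' b' t, P a b -> P a' b' -> (0 <= t <= 1)%R ->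
     P (a + t * (a' - a))%R (b + t * (b' - b))%R) -> convex (region P tau).
Proof.
move=> HP z0 z1 t [a [b [-> Pab]]] [a' [b' [-> Pab']]] t1.
exists (a + t * (a' - a))%R, (b + t * (b' - b))%R; split; last exact: HP.
by rewrite !RtoC_plus !RtoC_mult !RtoC_minus; ring.
Qed.

Definition unit_itv (x : R) : Prop := (0 < x < 1)%R.

Lemma unit_itv_seg x y t : unit_itv x -> unit_itv y -> (0 <= t <= 1)%R ->
  unit_itv (x + t * (y - x)).
Proof.
move=> [x0 x1] [y0 y1] [t0 t1].
have E : (x + t * (y - x) = (1 - t) * x + t * y)%R by ring.
rewrite /unit_itv E; have [->|t0'] := Req_dec t 0; first by split; lra.
have p : (0 < t * y)%R by apply: Rmult_lt_0_compat; lra.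
have q : (0 <= (1 - t) * x)%R by apply: Rmult_le_pos; lra.
have r : (t * y < t * 1)%R by apply: Rmult_lt_compat_l; lra.
have s : ((1 - t) * x <= (1 - t) * 1)%R by apply: Rmult_le_compat_l; lra.
by split; lra.
Qed.

Lemma regionI (P : R -> R -> Prop) tau (a b : R) : P a b -> region P tau (RtoC a + RtoC b * tau).
Proof. by move=> Pab; exists a, b. Qed.

Section Periods.
Variables (theta : C -> C -> C) (F : C -> C -> useries).
Hypotheses (Ht : is_theta theta) (HF : is_F theta F).

(** Used with nu = 0 for the shift by 1 and nu = -2 pi i for the shift by tau; the latter explains
    the factor exp(2 pi i x) in B. *)
Lemma F_shift_ode tau z la nu : upper_half_plane tau ->
  F_domain tau z -> F_domain tau (z + la) ->
  (forall u, theta u tau <> 0 ->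
    kernel (fun z => theta z tau) (z + la) u = cexp (nu * u) * kernel (fun z => theta z tau) z u) ->
  exists K : ncseries, [/\ K [::] = 0,
    sderiv (fun z => F z tau) z (nc_scale (-(1)) (nc_mul K (F z tau))) &
    sderiv (fun z => (uexp (nc_scale (- nu) ncX) * F (z + la)%C tau)%g) z
      (nc_scale (-(1)) (nc_mul K (uexp (nc_scale (- nu) ncX) * F (z + la)%C tau)%g))].
Proof.
move=> t0 Fz Fz' Hk.
have [c [T _ D]] := F_sderiv Ht HF t0 Fz.
have [c' [T' _ D']] := F_sderiv Ht HF t0 Fz'.
have TL := is_theta_theta_like Ht HF t0.
have [d d0 Hd] := deriv1_near (proj2 (tl_zeros TL 0) (lattice0 tau)) (tl_derive0 TL).
have n1 : RtoC 1 <> 0 by move=> []; lra.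
have := @kernel_conj _ _ c c' 1 nu d n1 d0 T T'; set E := nc_exp _ => KC.
have {}KC : nc_mul E (nc_ad_series c' ncX ncY) = nc_mul (nc_ad_series c ncX ncY) E.
  rewrite KC; last by move=> u u0 /(Hd u u0) [tu _]; rewrite Cmult_1_l; exact: Hk.
  congr nc_mul; rewrite !nc_adE; apply: nc_ser_ext => // n.
  have -> : 1 ^ n = 1 by elim: n => [//|n IH] /=; rewrite IH; ring.
  ring.
exists (nc_ad_series c ncX ncY); split=> //; first exact: nc_ad_nil.
have DF := @sderiv_comp_affine (fun u => F u tau) 1 la z _ _.
have z1 : 1 * z + la = z + la by ring.
have {}DF := DF _; rewrite z1 in DF; have {DF} := sderiv_mull E (DF _ D').
rewrite nc_mulZr; have -> : nc_mul E (nc_scale (- (1)) (nc_mul (nc_ad_series c' ncX ncY) (F (z + la) tau))) =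
  nc_scale (- (1)) (nc_mul (nc_ad_series c ncX ncY) (nc_mul E (F (z + la) tau))).
  by rewrite nc_mulZr nc_mulA KC nc_mulA.
have one X : nc_scale 1 X = X by apply: nc_ext => w; rewrite /nc_scale; ring.
by rewrite one; apply: sderiv_ext => u; rewrite Cmult_1_l.
Qed.

(** Each base point and its translate lie in one convex strip: b = 1 / 2 for the shift by 1, a = 1 /
    2 for the shift by tau. *)
Definition e_of (tau : C) : useries * useries :=
  (((F (tau / RtoC 2)%C tau)^-1 * F (tau / RtoC 2 + RtoC 1)%C tau)%g,
   ((F (RtoC 1 / RtoC 2)%C tau)^-1 * uexp (nc_scale twopii ncX) *
    F (RtoC 1 / RtoC 2 + tau)%C tau)%g).

Lemma RtoC_half : RtoC (1 / 2) = 1 / 2.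
Proof. by rewrite RtoC_div. Qed.

Lemma e_ofP : is_e F e_of.
Proof.
split=> z tau t0 Fz Fz'; have TL := is_theta_theta_like Ht HF t0;
  have zn u : F_domain tau u -> theta u tau <> 0 by
    move=> Fu /(tl_zeros TL); exact: F_domain_lattice.
- pose U := region (fun a b => unit_itv b) tau.
  have FU u : U u -> F_domain tau u by move=> [a [b [-> ub]]]; exists a, b; split=> //; right.
  have FU1 u : U u -> F_domain tau (u + 1).
    move=> [a [b [-> ub]]]; exists (a + 1)%R, b; split; last by right.
    by rewrite RtoC_plus; ring.
  (* z and z + 1 cannot both have first coordinate in ]0, 1[, so every admissible z lies in the
     strip 0 < b < 1; the shift by tau is dual. *)
  have Uz : U z.
    have [a [b [zE ab]]] := Fz; have [a' [b' [zE' ab']]] := Fz'.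
    have [aa bb] : (a + 1 = a' /\ b = b')%R.
      by apply: (coords_inj t0); rewrite -zE' zE RtoC_plus; ring.
    exists a, b; split=> //; case: ab => // ua; case: ab' => [ua'|]; last by rewrite -bb.
    by rewrite -aa in ua'; lra.
  have U0 : U (tau / 2).
    exists 0%R, (1 / 2)%R; split; last by rewrite /unit_itv; lra.
    by rewrite RtoC_half; field; move=> []; lra.
  have cU : convex U by apply: convex_region => a b a' b' t; exact: unit_itv_seg.
  have := @ode_unique U (fun z => F z tau) (fun z => (uexp (nc_scale (- 0) ncX) * F (z + RtoC 1)%C tau)%g)
    (tau / 2) cU U0 _ z Uz.
  have -> : - 0 = RtoC 0 by ring.
  rewrite uexp0 !mul1g => -> //; first by rewrite mulKg.
  move=> u Uu; have := @F_shift_ode tau u 1 0 t0 (FU u Uu) (FU1 u Uu).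
  have -> : - 0 = RtoC 0 by ring.
  rewrite uexp0; apply=> v tv.
  rewrite (theta_kernel_add1 (zn _ (FU u Uu)) tv (tl_add1 TL)).
  by rewrite Cmult_0_l cexp0; ring.
- pose U := region (fun a b => unit_itv a) tau.
  have FU u : U u -> F_domain tau u by move=> [a [b [-> ub]]]; exists a, b; split=> //; left.
  have FU1 u : U u -> F_domain tau (u + tau).
    move=> [a [b [-> ub]]]; exists a, (b + 1)%R; split; last by left.
    by rewrite RtoC_plus; ring.
  have Uz : U z.
    have [a [b [zE ab]]] := Fz; have [a' [b' [zE' ab']]] := Fz'.
    have [aa bb] : (a = a' /\ b + 1 = b')%R.
      by apply: (coords_inj t0); rewrite -zE' zE RtoC_plus; ring.
    exists a, b; split=> //; case: ab => // ub; case: ab' => [|ub']; first by rewrite -aa.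
    by rewrite -bb in ub'; lra.
  have U0 : U (1 / 2).
    exists (1 / 2)%R, 0%R; split; last by rewrite /unit_itv; lra.
    by rewrite RtoC_half; ring.
  have cU : convex U by apply: convex_region => a b a' b' t; exact: unit_itv_seg.
  have := @ode_unique U (fun z => F z tau) (fun z => (uexp (nc_scale (- - twopii) ncX) * F (z + tau)%C tau)%g)
    (1 / 2) cU U0 _ z Uz.
  rewrite Copp_opp => EQ; rewrite -[RHS]mulgA EQ //; first by rewrite mulKg mulgA.
  move=> u Uu; have := @F_shift_ode tau u tau (- twopii) t0 (FU u Uu) (FU1 u Uu).
  rewrite Copp_opp; apply=> v tv.
  exact: (theta_kernel_addtau (zn _ (FU u Uu)) (tl_addtau TL) tv).
Qed.

Variable e : C -> useries * useries.
Hypothesis He : is_e F e.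

(** From a + b tau = (a - b) + b (tau + 1), the first region has both first coordinates in ]0, 1[,
    the second the common second coordinate. All factors are trivial, as j = 1 and al = 0. *)
Lemma F_T tau z : upper_half_plane tau ->
  region (fun a b => unit_itv a /\ unit_itv (a - b)) tau z \/ region (fun _ b => unit_itv b) tau z ->
  F z (tau + 1) = F z tau.
Proof.
move=> t0 Vz; set V1 := region _ tau in Vz; set V2 := region _ tau in Vz.
have t1 : upper_half_plane (tau + 1).
  by move: t0; rewrite /upper_half_plane; case: (tau) => x y; rewrite /Im /=; lra.
have n1 : RtoC 1 <> 0 by move=> []; lra.
have rel w : theta w tau = 1 * cexp (0 * (w * w)) * theta (w / 1) (tau + 1).
  have -> : w / 1 = w by field.
  by rewrite (theta_T w Ht HF t0) Cmult_0_l cexp0; ring.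
have := @F_transform theta F Ht HF tau (tau + 1) 1 0 t0 t1 n1 rel V1 V2
  (RtoC (1 / 2) + RtoC (1 / 4) * tau) _ _ _ _ _ _ z Vz.
have -> : z / 1 = z by field.
have -> : - (2 * 0 * 1) = RtoC 0 by ring.
have -> : / 1 = RtoC 1 by field.
rewrite clog_pos ?ln_1; last lra.
rewrite !Cmult_0_l !uexp0 mul1g mulg1 => ->.
- by apply: useriesP; apply: nc_subst_id; rewrite !mxE.
- apply: convex_region => a b a' b' t [u1 u2] [v1 v2] tt; split; first exact: unit_itv_seg.
  have := unit_itv_seg u2 v2 tt; congr unit_itv; ring.
- by apply: convex_region => a b a' b' t; exact: unit_itv_seg.
- by apply: regionI; rewrite /unit_itv; lra.
- by apply: regionI; rewrite /unit_itv; lra.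
- move=> w; have -> : w / 1 = w by field.
  case=> [[a [b [-> [ua uab]]]]|[a [b [-> ub]]]]; split.
  + by exists a, b; split=> //; left.
  + by exists (a - b)%R, b; split; [rewrite RtoC_minus; ring|left].
  + by exists a, b; split=> //; right.
  + by exists (a - b)%R, b; split; [rewrite RtoC_minus; ring|right].
- move=> s s1; exists s, 0%R; split; first by ring.
  by rewrite /unit_itv; lra.
Qed.

Lemma e_T tau : upper_half_plane tau -> e (tau + 1) = ((e tau).1, (e tau).2 * (e tau).1)%g.
Proof.
move=> t0.
have t1 : upper_half_plane (tau + 1).
  by move: t0; rewrite /upper_half_plane; case: (tau) => x y; rewrite /Im /=; lra.
rewrite [LHS]surjective_pairing; congr pair.
  set z := RtoC 0 + RtoC (1 / 2) * tau.
  have z1 : z + RtoC 1 = RtoC 1 + RtoC (1 / 2) * tau by rewrite /z; ring.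
  have h (a : R) : F_domain tau (RtoC a + RtoC (1 / 2) * tau).
    by exists a, (1 / 2)%R; split=> //; right; lra.
  have h' (a : R) : F_domain (tau + 1) (RtoC a + RtoC (1 / 2) * tau).
    by exists (a - 1 / 2)%R, (1 / 2)%R; split; [rewrite RtoC_minus; ring|right; lra].
  have V (a : R) : region (fun _ b => unit_itv b) tau (RtoC a + RtoC (1 / 2) * tau).
    by apply: regionI; rewrite /unit_itv; lra.
  rewrite (e_A He (z := z) t1); [|exact: h'|by rewrite z1; exact: h'].
  rewrite (e_A He (z := z) t0); [|exact: h|by rewrite z1; exact: h].
  by rewrite z1 !(F_T t0) //; right; exact: V.
(* The shift by tau + 1 is one by tau followed by one by 1, so A(tau) is taken at the base point z +
   tau. The point z lies in the first region of [F_T] and z + tau + 1 in the second. *)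
set z := RtoC (1 / 4) + RtoC (- (1 / 4)) * tau.
have zt : z + tau = RtoC (1 / 4) + RtoC (3 / 4) * tau.
  rewrite /z; have -> : (3 / 4 = - (1 / 4) + 1)%R by field.
  by rewrite RtoC_plus; ring.
have zt1 : z + (tau + 1) = RtoC (5 / 4) + RtoC (3 / 4) * tau.
  have -> : (5 / 4 = 1 / 4 + 1)%R by field.
  by rewrite RtoC_plus Cplus_assoc zt; ring.
have zt1' : z + tau + 1 = RtoC (5 / 4) + RtoC (3 / 4) * tau by rewrite -zt1; ring.
have f1 : F_domain tau z by exists (1 / 4)%R, (- (1 / 4))%R; split=> //; left; lra.
have f2 : F_domain tau (z + tau) by rewrite zt; exists (1 / 4)%R, (3 / 4)%R; split=> //; left; lra.
have f3 : F_domain tau (z + tau + 1) by rewrite zt1'; exists (5 / 4)%R, (3 / 4)%R; split=> //; right; lra.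
have f4 : F_domain (tau + 1) z.
  exists (1 / 4 - - (1 / 4))%R, (- (1 / 4))%R; split; last by left; lra.
  by rewrite /z RtoC_minus; ring.
have f5 : F_domain (tau + 1) (z + (tau + 1)).
  rewrite zt1; exists (5 / 4 - 3 / 4)%R, (3 / 4)%R; split; last by left; lra.
  by rewrite RtoC_minus; ring.
rewrite (e_B He t1 f4 f5) (e_B He t0 f1 f2) (e_A He t0 f2 f3).
rewrite !mulgA mulgK zt1' zt1 !(F_T t0) //.
  by right; apply: regionI; rewrite /unit_itv; lra.
by left; apply: regionI; rewrite /unit_itv; lra.
Qed.

(** As 1 / j = 1 + tau / j for j = 1 - tau, one has (a + b tau) / j = a + (a + b) (tau / j): the
    first region has the common first coordinate in ]0, 1[, the second both second coordinates. *)
Lemma F_S tau z : upper_half_plane tau ->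
  region (fun a _ => unit_itv a) tau z \/ region (fun a b => unit_itv b /\ unit_itv (a + b)) tau z ->
  F (z / (1 - tau)) (tau / (1 - tau)) =
  (uexp (nc_scale (- twopii * z)%C ncX) *
   usubst (mx2 (RtoC 1 - tau)%C (RtoC 0) (- twopii)%C (/ (RtoC 1 - tau))%C) (F z tau) *
   uexp (nc_scale (clog (/ (RtoC 1 - tau))%C) nc_t))%g.
Proof.
move=> t0 Vz; set V1 := region _ tau in Vz; set V2 := region _ tau in Vz.
have j0 := uhp_1sub_neq0 t0; set j := 1 - tau in j0 *.
have := @F_transform theta F Ht HF tau (tau / j) j (PI * Ci / j) t0 (uhp_S t0) j0
  (fun w => theta_S w Ht HF t0) V1 V2 (RtoC (1 / 4) + RtoC (1 / 4) * tau) _ _ _ _ _ _ z Vz.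
have -> : - (2 * (PI * Ci / j) * j) = - twopii.
  by rewrite /twopii RtoC_mult; field.
apply.
- by apply: convex_region => a b a' b' t; exact: unit_itv_seg.
- apply: convex_region => a b a' b' t [u1 u2] [v1 v2] tt; split; first exact: unit_itv_seg.
  have := unit_itv_seg u2 v2 tt; congr unit_itv; ring.
- by apply: regionI; rewrite /unit_itv; lra.
- by apply: regionI; rewrite /unit_itv; lra.
- have E (a b : R) : (RtoC a + RtoC b * tau) / j = RtoC a + RtoC (a + b) * (tau / j).
    by rewrite RtoC_plus /j; field.
  move=> w; case=> [[a [b [-> ua]]]|[a [b [-> [ub uab]]]]]; rewrite E; split.
  + by exists a, b; split=> //; left.
  + by exists a, (a + b)%R; split=> //; left.
  + by exists a, b; split=> //; right.
  + by exists a, (a + b)%R; split=> //; right.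
- by move=> s s1; exists s, 0%R; split; [ring|].
Qed.

Lemma e_S tau : upper_half_plane tau ->
  e (tau / (1 - tau)) = Ad_exp_t (- clog (/ (1 - tau)))
    (braid_act sigma2 (sl2_act (mx2 (1 - tau) 0 (- twopii) (/ (1 - tau))) (e tau))).
Proof.
move=> t0; have j0 := uhp_1sub_neq0 t0; have t1 := uhp_S t0.
have FS := fun z => @F_S tau z t0.
have E (a b : R) : (RtoC a + RtoC b * tau) / (1 - tau) = RtoC a + RtoC (a + b) * (tau / (1 - tau)).
  by rewrite RtoC_plus; field.
set j := 1 - tau in j0 t1 FS E *; set mu := - twopii in FS *.
set a := mx2 j 0 mu (/ j) in FS *; set Q := uexp _ in FS.
have QE : uexp (nc_scale (- clog (/ j)) nc_t) = Q^-1%g by rewrite uexpN ?nc_t_nil.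
rewrite [e tau]surjective_pairing /sl2_act [(_, _).1]/= [(_, _).2]/= braid_act_sigma2.
rewrite /Ad_exp_t QE invgK [(_, _).1]/= [(_, _).2]/=.
rewrite [LHS]surjective_pairing; congr pair.
(* For w = z + 1 - tau, w / j is z / j + 1, and w + tau = z + 1. Hence A(tau) based at z times
   B(tau)^-1 based at w is F(z)^-1 exp(-2 pi i x) F(w), and the substitution turns the middle factor
   into exp(mu (w - z) x). *)
- set z := RtoC (- (1 / 4)) + RtoC (1 / 2) * tau.
  set w := RtoC (3 / 4) + RtoC (- (1 / 2)) * tau.
  have wE : z + j = w.
    rewrite /z /w /j.
    have -> : (3 / 4 = - (1 / 4) + 1)%R by field.
    have -> : (- (1 / 2) = 1 / 2 - 1)%R by field.
    by rewrite RtoC_plus RtoC_minus; ring.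
  have zj1 : z / j + RtoC 1 = w / j by rewrite -wE; field.
  have wt : w + tau = z + RtoC 1 by rewrite -wE /j; ring.
  have f1 : F_domain (tau / j) (z / j).
    by rewrite E; exists (- (1 / 4))%R, (- (1 / 4) + 1 / 2)%R; split=> //; right; lra.
  have f2 : F_domain (tau / j) (z / j + RtoC 1).
    by rewrite zj1 E; exists (3 / 4)%R, (3 / 4 + - (1 / 2))%R; split=> //; left; lra.
  have f3 : F_domain tau z by exists (- (1 / 4))%R, (1 / 2)%R; split=> //; right; lra.
  have f4 : F_domain tau w by exists (3 / 4)%R, (- (1 / 2))%R; split=> //; left; lra.
  have f5 : F_domain tau (z + RtoC 1).
    exists (3 / 4)%R, (1 / 2)%R; split; last by right; lra.
    rewrite /z; have -> : (3 / 4 = - (1 / 4) + 1)%R by field.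
    by rewrite RtoC_plus; ring.
  have f6 : F_domain tau (w + tau) by rewrite wt.
  rewrite (e_A He t1 f1 f2) (e_A He t0 f3 f5) (e_B He t0 f4 f6) zj1 wt !FS; last first.
  + by right; apply: regionI; rewrite /unit_itv; lra.
  + by left; apply: regionI; rewrite /unit_itv; lra.
  have Wr : uexp (nc_scale (mu * w) ncX) = (uexp (nc_scale (mu * z) ncX) * uexp (nc_scale (mu * j) ncX))%g.
    by rewrite -uexpD ?ncX_nil //; congr (uexp (nc_scale _ _)); rewrite -wE; ring.
  have mj : uexp (nc_scale (mu * j) ncX) = (uexp (nc_scale (twopii * j) ncX))^-1%g.
    by rewrite uexpN ?ncX_nil //; congr (uexp (nc_scale _ _)); rewrite /mu; ring.
  rewrite !usubstM !usubstV (@subst_uexp_X j mu) Wr mj !invgM !invgK !mulgA.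
  by rewrite !(mulgK, mulgVK).
- set z := RtoC (1 / 2) + RtoC 0 * tau.
  have zt : z + tau = RtoC (1 / 2) + RtoC 1 * tau by rewrite /z; ring.
  have zjt : z / j + tau / j = (z + tau) / j by field.
  have f1 : F_domain (tau / j) (z / j).
    by rewrite E; exists (1 / 2)%R, (1 / 2 + 0)%R; split=> //; left; lra.
  have f2 : F_domain (tau / j) (z / j + tau / j).
    by rewrite zjt zt E; exists (1 / 2)%R, (1 / 2 + 1)%R; split=> //; left; lra.
  have f3 : F_domain tau z by exists (1 / 2)%R, 0%R; split=> //; left; lra.
  have f4 : F_domain tau (z + tau) by rewrite zt; exists (1 / 2)%R, 1%R; split=> //; left; lra.
  rewrite (e_B He t1 f1 f2) (e_B He t0 f3 f4) zjt !FS; last first.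
  + by left; apply: regionI; rewrite /unit_itv; lra.
  + by left; rewrite zt; apply: regionI; rewrite /unit_itv; lra.
  (* The exponent is split by tau = 1 - j: the first factor cancels the exp(2 pi i x) in B(tau / j),
     and exp(2 pi i j x) is the image of exp(2 pi i x) under the substitution. *)
  have Wr : uexp (nc_scale (mu * (z + tau)) ncX) =
     ((uexp (nc_scale twopii ncX))^-1 * (uexp (nc_scale (mu * z) ncX) * uexp (nc_scale (twopii * j) ncX)))%g.
    rewrite uexpN ?ncX_nil // -!uexpD ?ncX_nil //; congr (uexp (nc_scale _ _)).
    by rewrite /mu /j; ring.
  rewrite !usubstM !usubstV (@subst_uexp_X j mu) Wr !invgM !mulgA.
  by rewrite !(mulgK, mulgVK).
Qed.

End Periods.

(** * From the two generators to all braids *)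

Section Twist.

Lemma Ad_exp_tD al be e : Ad_exp_t al (Ad_exp_t be e) = Ad_exp_t (al + be) e.
Proof.
by rewrite /Ad_exp_t uexpD ?nc_t_nil //= invgM !mulgA.
Qed.

Lemma Ad_exp_t0 e : Ad_exp_t 0 e = e.
Proof. by case: e => A B; rewrite /Ad_exp_t uexp0 /= invg1 !mul1g !mulg1. Qed.

(** Braids act by group words, which commute with every endomorphism; it is used for conjugations
    and for substitutions. *)
Lemma braid_act_hom (phi : useries -> useries) g e :
  (forall A B, phi (A * B)%g = (phi A * phi B)%g) ->
  braid_act g (phi e.1, phi e.2) = (phi (braid_act g e).1, phi (braid_act g e).2).
Proof.
move=> pM; have p1 : phi 1%g = 1%g.
  by rewrite -[LHS](mulgK (phi 1%g)) -pM mulg1 mulgV.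
have pV A : phi A^-1%g = (phi A)^-1%g.
  by rewrite -[LHS](mulgK (phi A)) -pM mulVg p1 mul1g.
rewrite /braid_act; elim: (repr g) => [//|l w IH] /=; rewrite IH.
by case: l => -[] []; rewrite /= !pM ?pV.
Qed.

Lemma braid_act_Ad g al e : braid_act g (Ad_exp_t al e) = Ad_exp_t al (braid_act g e).
Proof.
rewrite /Ad_exp_t; set u := uexp _.
rewrite (@braid_act_hom (fun A => u * A * u^-1)%g) // => A B.
by rewrite !mulgA mulgVK.
Qed.

Lemma braid_act_sl2 g a e : braid_act g (sl2_act a e) = sl2_act a (braid_act g e).
Proof. by rewrite /sl2_act (@braid_act_hom (usubst a)) //; exact: usubstM. Qed.

Lemma sl2_act_Ad (j mu al : C) e : j <> 0 ->
  sl2_act (mx2 j 0 mu (/ j)) (Ad_exp_t al e) = Ad_exp_t al (sl2_act (mx2 j 0 mu (/ j)) e).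
Proof. by move=> j0; rewrite /sl2_act /Ad_exp_t /= !usubstM !usubstV !subst_uexp_t. Qed.

(** As matrices, a(M N, tau) = a(N, tau) a(M, N tau); substitutions compose in the opposite
    order. *)
Lemma autfactor_comp (M N : 'M[Z]_2) tau e : (\det M = 1)%ring -> (\det N = 1)%ring ->
  upper_half_plane tau ->
  sl2_act (autfactor M (mobius N tau)) (sl2_act (autfactor N tau) e) =
  sl2_act (autfactor (M *m N)%ring tau) e.
Proof.
move=> dM dN t0; have jN := jfac_neq0 dN t0; have jM := jfac_neq0 dM (uhp_mobius dN t0).
have dMN : (\det (M *m N) = 1)%ring by rewrite det_mulmx dM dN; exact: GRing.mulr1.
have jMN := jfac_neq0 dMN t0; have DN := det_coords dN.
have [e1 e2 e3 e4] := mulmx_coords M N.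
suff H A : nc_subst (autfactor M (mobius N tau)) (nc_subst (autfactor N tau) A) =
    nc_subst (autfactor (M *m N)%ring tau) A.
  by rewrite /sl2_act; congr pair; apply: useriesP; exact: H.
apply: nc_subst_comp => k l.
move: jM jN jMN DN; rewrite /jfac /mobius /autfactor e3 e4.
set a := Malpha N; set b := Mbeta N; set c := Mgamma N; set d := Mdelta N.
set c' := Mgamma M; set d' := Mdelta M => jM jN jMN DN.
(* For the lower left entry, where det N = 1 turns b c + 1 into a d. *)
have bE : b * c = a * d - 1 by rewrite -DN; ring.
have jM' : c' * (a * tau + b) + d' * (c * tau + d) <> 0.
  by move=> K; apply: jMN; rewrite -K; ring.
case: (ord2P k) => ->; case: (ord2P l) => ->; rewrite !mxE /=.
- by field.
- ring.
- have -> : twopii * c * (c' * ((a * tau + b) / (c * tau + d)) + d') + / (c * tau + d) * (twopii * c') =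
    twopii * (c' * (c * a * tau + b * c + 1) / (c * tau + d) + c * d') by field.
  by rewrite bE; field.
- by field; do !split.
Qed.

Lemma sl2_act_autfactor_Ad (M : 'M[Z]_2) tau al e : (\det M = 1)%ring -> upper_half_plane tau ->
  sl2_act (autfactor M tau) (Ad_exp_t al e) = Ad_exp_t al (sl2_act (autfactor M tau) e).
Proof. by move=> dM t0; apply: sl2_act_Ad; exact: (jfac_neq0 dM t0). Qed.

Lemma sl2_act_id e : sl2_act (mx2 (RtoC 1) 0 0 (RtoC 1)) e = e.
Proof.
by case: e => A B; rewrite /sl2_act; congr pair; apply: useriesP; apply: nc_subst_id; rewrite mxE.
Qed.

Lemma autfactor1 tau e : sl2_act (autfactor 1%:M%ring tau) e = e.
Proof.
rewrite -[RHS]sl2_act_id /autfactor /Mgamma /Mdelta -mx2_id !mxE /= !IZR1 !IZR0.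
have -> : RtoC 0 * tau + RtoC 1 = 1 by ring.
have -> : twopii * 0 = 0 by ring.
by have -> : / 1 = RtoC 1 by field.
Qed.

Variable f : B3 -> C -> C.
Hypothesis Hf : is_cocycle f.

Definition twist (g : B3) (tau : C) (e : useries * useries) : useries * useries :=
  Ad_exp_t (f g tau) (braid_act g (sl2_act (autfactor (sl2_bar g) tau) e)).

(** Conjugation by exp(al t) commutes with the braid action, and with the substitutions because they
    fix t; the exponents then add by the cocycle identity. *)
Lemma twistM g h tau e : upper_half_plane tau ->
  twist g (mobius (sl2_bar h) tau) (twist h tau e) = twist (g * h)%g tau e.
Proof.
move=> t0; have t1 := uhp_bar h t0; rewrite /twist sl2_act_autfactor_Ad ?det_sl2_bar //.
rewrite braid_act_Ad Ad_exp_tD -cocycle_mul // braid_actM -braid_act_sl2.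
by rewrite autfactor_comp ?det_sl2_bar // -sl2_barM.
Qed.

Lemma twist1 tau e : upper_half_plane tau -> twist 1%g tau e = e.
Proof.
by move=> t0; rewrite /twist (cocycle1 Hf t0) Ad_exp_t0 sl2_bar_one autfactor1 braid_act1.
Qed.

Lemma twist_generated (E : C -> useries * useries) :
  (forall tau, upper_half_plane tau -> E (mobius (sl2_bar sigma1) tau) = twist sigma1 tau (E tau)) ->
  (forall tau, upper_half_plane tau -> E (mobius (sl2_bar sigma2) tau) = twist sigma2 tau (E tau)) ->
  forall g tau, upper_half_plane tau -> E (mobius (sl2_bar g) tau) = twist g tau (E tau).
Proof.
move=> E1 E2; apply: B3_ind => // [tau t0|g h Eg Eh tau t0|g Eg tau t0].
- by rewrite mobius_bar1 twist1.
- by rewrite mobiusM // Eg ?Eh ?twistM //; exact: uhp_bar.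
(* The law for g at the point g^-1 tau is inverted by applying [twist] for g^-1 to both sides. *)
- have t1 := uhp_bar g^-1%g t0; have := Eg _ t1; rewrite mobiusVK // => ->.
  have K := twistM g^-1%g g (E (mobius (sl2_bar g^-1%g) tau)) t1.
  by rewrite mobiusVK // mulVg twist1 // in K.
Qed.

End Twist.

(** Functions on the half-plane are encoded as functions on [C], so uniqueness of f is asserted at
    points of the half-plane. The existence of e includes the independence of its formulas from the
    base point. *)
Theorem proposition5p4 :
  (exists f : B3 -> C -> C,
     is_cocycle f /\
     forall f' : B3 -> C -> C, is_cocycle f' ->
       forall (g : B3) (tau : C), upper_half_plane tau -> f' g tau = f g tau) /\
  (forall (f : B3 -> C -> C) (theta : C -> C -> C) (F : C -> C -> useries),
     is_cocycle f -> is_theta theta -> is_F theta F ->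
     exists e : C -> useries * useries,
       is_e F e /\
       forall (g : B3) (tau : C), upper_half_plane tau ->
         e (mobius (sl2_bar g) tau) =
         Ad_exp_t (f g tau)
           (braid_act g (sl2_act (autfactor (sl2_bar g) tau) (e tau)))).
Proof.
split=> [|f theta F Hf Ht HF].
  exists cocycle; split=> [|f' Hf']; first exact: cocycleP.
  exact: cocycle_unique cocycleP Hf'.
have He := e_ofP Ht HF; exists (e_of F); split=> //.
apply: (twist_generated Hf) => tau t0; rewrite /twist.
- rewrite (cocycle_sigma1 Hf t0) Ad_exp_t0 sl2_bar1 mobius_T (e_T Ht HF He t0).
  have -> : autfactor (mx2 1 1 0 1)%ring tau = mx2 (RtoC 1) 0 0 (RtoC 1).
    rewrite /autfactor /Mgamma /Mdelta !mxE /= !IZR1 !IZR0.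
    have -> : RtoC 0 * tau + RtoC 1 = 1 by ring.
    have -> : twopii * 0 = 0 by ring.
    by have -> : / 1 = RtoC 1 by field.
  by rewrite sl2_act_id [e_of F tau]surjective_pairing braid_act_sigma1.
- rewrite (cocycle_sigma2 Hf t0) sl2_bar2 mobius_S (e_S Ht HF He t0).
  have j0 := uhp_1sub_neq0 t0; have j0' := Im_gt0_neq0 (uhp_sub1 t0).
  (* Thus f(sigma_2, tau) is minus the exponent in the constant factor exp(log(1 / j) t). *)
  have -> : -(1) / (tau - 1) = / (1 - tau) by field.
  have -> // : autfactor (mx2 1 0 (-1) 1)%ring tau = mx2 (1 - tau) 0 (- twopii) (/ (1 - tau)).
  rewrite /autfactor /Mgamma /Mdelta !mxE /= !IZR1 !IZRm1.
  have -> : RtoC (-1) = - RtoC 1 by rewrite -RtoC_opp.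
  have -> : - RtoC 1 * tau + 1 = 1 - tau by ring.
  by have -> : twopii * - RtoC 1 = - twopii by ring.
Qed.
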